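(* Let $a>0$ and let $$\lambda_a=\inf_{0\ne v\in\mathfrak D(Q_W^{\,a})}\frac{Q_W^{\,a}(v)}{\|v\|_{L^2}^2}.$$ Any function $v\in\mathfrak D(Q_W^{\,a})$ attaining this infimum belongs to the closure of $C_c^\infty(-a,a)$ with respect to the form norm $\|v\|_{Q_W^{\,a}}=\bigl(Q_W^{\,a}(v)+(1-\lambda_a)\|v\|_{L^2}^2\bigr)^{1/2}$ associated with $Q_W^{\,a}$. In particular, $\lambda_a$ is the infimum of the Rayleigh quotient $$\frac{\langle B_av,v\rangle_{L^2}}{\|v\|_{L^2}^2}$$ over nonzero $v\in C_c^\infty(-a,a)$.
   Context: All function spaces are complex; $\langle v_1,v_2\rangle_{L^2}=\int v_1\overline{v_2}\,dx$; $L^2(-a,a)$ is viewed as a closed subspace of $L^2(\mathbb R)$ by extending functions by zero. $C_c^\infty(-a,a)$ denotes the smooth functions compactly supported in $(-a,a)$. Weil functional: with $\Lambda$ the von Mangoldt function and $C_0$ the Euler--Mascheroni constant, $$W(f)=\int_{-\infty}^{\infty} f(x)(e^{x/2}+e^{-x/2})\,dx-\sum_{n\ge1}\frac{\Lambda(n)}{\sqrt n}\bigl(f(\log n)+f(-\log n)\bigr)-(\log 4\pi+C_0)f(0)-\int_0^\infty\{f(x)+f(-x)-2e^{-x/2}f(0)\}\frac{e^{x/2}\,dx}{e^x-e^{-x}}.$$ With $\widetilde v(x)=\overline{v(-x)}$ and $*$ denoting convolution, put $Q_W(v_1,v_2)=W(v_1*\widetilde{v_2})$ and $Q_W(v)=Q_W(v,v)$.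 For $v\in L^2(-a,a)$ the function $f=v*\widetilde v$ is continuous with compact support and $\mathrm{Re}\,f(x)\le f(0)$, so $Q_W(v)\in(-\infty,+\infty]$ is well defined. $Q_W^{\,a}$ is the restriction of $Q_W$ to $L^2(-a,a)$, with form domain $\mathfrak D(Q_W^{\,a})=\{v\in L^2(-a,a): |Q_W^{\,a}(v)|<\infty\}$. It is known that $Q_W^{\,a}$ is a densely defined, lower bounded, closed symmetric form and that the infimum $\lambda_a$ is attained. Screw function: $g:\mathbb R\to\mathbb R$ is the continuous even function $$g(t)=-4(e^{t/2}+e^{-t/2}-2)+\sum_{n\le e^{|t|}}\frac{\Lambda(n)}{\sqrt n}(|t|-\log n)-\frac{|t|}2(\psi(1/4)-\log\pi)-\frac14\bigl(\Phi(1,2,1/4)-e^{-|t|/2}\Phi(e^{-2|t|},2,1/4)\bigr),$$ where $\psi$ is the digamma function and $\Phi(z,s,\alpha)=\sum_{n\ge0}(n+\alpha)^{-s}z^n$. Operators: $L_0^2(-a,a)=\{u\in L^2(-a,a):\int_{-a}^a u\,dx=0\}$; $P_a:L^2(\mathbb R)\to L^2_0(-a,a)$ is the orthogonal projection; $(Gu)(x)=\int_{-\infty}^\infty g(x-y)u(y)\,dy$; $G_a=P_aGP_a:L_0^2(-a,a)\to L_0^2(-a,a)$. $D=i\,d/dx$ on $L^2(-a,a)$ with domain $H_0^1(-a,a)$ (its range is $L_0^2(-a,a)$), and $D^\ast=i\,d/dx$ is its adjoint, with domain $H^1(-a,a)$. $B_a=D^\ast G_aD$ with domain $H_0^1(-a,a)$.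 *)

(* Defs.v *)
From HB Require Import structures.
From mathcomp Require Import all_boot all_order all_algebra.
From mathcomp Require Import complex.
From mathcomp Require Import all_classical all_reals all_analysis.

Set Implicit Arguments.
Unset Strict Implicit.
Unset Printing Implicit Defensive.

Import Order.TTheory GRing.Theory Num.Theory.
Import numFieldNormedType.Exports.

Local Open Scope classical_set_scope.
Local Open Scope ring_scope.
Local Open Scope complex_scope.

Section arithmetic_and_special_functions.
Context {R : realType}.
Notation mu := (@lebesgue_measure R).

(* [primes n] is a singleton exactly when n is a prime power p ^ k, k >= 1. *)
Definition von_mangoldt (n : nat) : R :=
  if primes n is [:: p] then ln p%:R else 0.

Definition euler_mascheroni : R :=
  limn (fun n => series harmonic n - ln n%:R).

Definition Gamma_fun (x : R) : R :=
  \int[mu]_(t in `]0, +oo[) (t `^ (x - 1) * expR (- t)).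

Definition digamma (x : R) : R := derive1 Gamma_fun x / Gamma_fun x.

Definition lerch (z s alpha : R) : R :=
  limn (series (fun n => (n%:R + alpha) `^ (- s) * z ^+ n)).

Definition screw (t : R) : R :=
  - 4 * (expR (t / 2) + expR (- (t / 2)) - 2)
  + \sum_(1 <= n < (Num.truncn (expR `|t|)).+1)
      von_mangoldt n / Num.sqrt n%:R * (`|t| - ln n%:R)
  - `|t| / 2 * (digamma (1 / 4) - ln pi)
  - 1 / 4 * (lerch 1 2 (1 / 4)
             - expR (- (`|t| / 2)) * lerch (expR (- (2 * `|t|))) 2 (1 / 4)).

End arithmetic_and_special_functions.

Section function_spaces.
Context {R : realType}.
Notation mu := (@lebesgue_measure R).
Implicit Types (a : R) (u v w : R -> R[i]).

Definition cintegral (f : R -> R[i]) : R[i] :=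
  (\int[mu]_x complex.Re (f x)) +i* (\int[mu]_x complex.Im (f x)).

Definition cderiv (f : R -> R[i]) : R -> R[i] := fun x =>
  (derive1 (fun y => complex.Re (f y)) x)
  +i* (derive1 (fun y => complex.Im (f y)) x).

Definition smooth_real (f : R -> R) : Prop :=
  forall n x, derivable (derive1n n f) x 1.

Definition inner v1 v2 : R[i] := cintegral (fun x => v1 x * conjc (v2 x)).

Definition l2norm v : R := Num.sqrt (complex.Re (inner v v)).

(* L^2(-a,a) inside L^2(R).  Elements are represented by honest functions
   vanishing pointwise outside (-a,a); two representatives are equal in L^2
   when the [l2norm] of their difference is 0, so a nonzero element is one with
   [l2norm v != 0]. *)
Definition L2 a : set (R -> R[i]) := [set v |
  [/\ (fun x => complex.Re (v x)) \in Lfun mu 2%:E,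
      (fun x => complex.Im (v x)) \in Lfun mu 2%:E
    & forall x, ~ `]- a, a[%classic x -> v x = 0]].

Definition L20 a : set (R -> R[i]) := [set u | L2 a u /\ cintegral u = 0].

Definition Ccinfty a : set (R -> R[i]) := [set v |
  [/\ smooth_real (fun x => complex.Re (v x)),
      smooth_real (fun x => complex.Im (v x)),
      compact (closure [set x | v x != 0])
    & closure [set x | v x != 0] `<=` `]- a, a[]].

Definition is_weak_deriv a u w : Prop :=
  [/\ L2 a u, L2 a w & forall phi, Ccinfty a phi ->
    cintegral (fun x => u x * cderiv phi x)
    = - cintegral (fun x => w x * phi x)].

Definition H1 a : set (R -> R[i]) := [set u | exists w, is_weak_deriv a u w].

(* Determined only up to a null set; the choice of representative is
   irrelevant, since everything below depends on it through integrals. *)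
Definition weak_deriv a u : R -> R[i] := xget 0 [set w | is_weak_deriv a u w].

Definition H01 a : set (R -> R[i]) := [set v | H1 a v /\
  forall e : R, 0 < e -> exists2 phi, Ccinfty a phi &
    Num.sqrt (l2norm (v \- phi) ^+ 2
              + l2norm (weak_deriv a v \- weak_deriv a phi) ^+ 2) < e].

End function_spaces.

Section weil_form.
Context {R : realType}.
Notation mu := (@lebesgue_measure R).
Implicit Types (a : R) (v : R -> R[i]).

(* The kernel of the Weil functional W is real, so Re W(f) = weil (Re f).  Only
   the last integral may be infinite. *)
Definition weil (h : R -> R) : \bar R :=
  ((\int[mu]_x (h x * (expR (x / 2) + expR (- (x / 2))))
    - limn (fun N => \sum_(1 <= n < N)
              von_mangoldt n / Num.sqrt n%:R * (h (ln n%:R) + h (- ln n%:R)))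
    - (ln (4 * pi) + euler_mascheroni) * h 0)%:E
   - \int[mu]_(x in `]0%R, +oo[)
       ((h x + h (- x) - 2 * expR (- (x / 2)) * h 0)
        * (expR (x / 2) / (expR x - expR (- x))))%:E)%E.

Definition tilde v : R -> R[i] := fun x => conjc (v (- x)).

Definition convolution (v1 v2 : R -> R[i]) : R -> R[i] :=
  fun x => cintegral (fun y => v1 (x - y) * v2 y).

(* f = v * ~v satisfies f(-x) = conj (f x), so the imaginary part of every term
   of W(f) vanishes and W(f) is its real part. *)
Definition QW v : \bar R :=
  weil (fun x => complex.Re (convolution v (tilde v) x)).

Definition domQW a : set (R -> R[i]) := [set v | L2 a v /\ (`|QW v| < +oo)%E].

Definition rayleighQW v : R := fine (QW v) / l2norm v ^+ 2.

Definition lambda a : R :=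
  inf [set rayleighQW v | v in [set v | domQW a v /\ l2norm v != 0]].

Definition normQW a v : \bar R :=
  sqrte (QW v + ((1 - lambda a) * l2norm v ^+ 2)%:E)%E.

End weil_form.

Section operators.
Context {R : realType}.
Implicit Types (a : R) (u v w : R -> R[i]).

(* The orthogonality condition only involves w on (-a,a), so the projection
   makes sense for every locally square integrable w; this is needed since
   G u grows at infinity. *)
Definition projL20 a w : R -> R[i] := xget 0 [set u |
  L20 a u /\ forall h, L20 a h -> inner (fun x => w x - u x) h = 0].

Definition Gop u : R -> R[i] :=
  fun x => cintegral (fun y => (screw (x - y))%:C * u y).

Definition Gop_a a u : R -> R[i] := projL20 a (Gop (projL20 a u)).

(* Outside their domains H01 and H1 the two operators take the value 0. *)
Definition Dop a v : R -> R[i] :=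
  if v \in H01 a then fun x => 'i%C * weak_deriv a v x else 0.

Definition Dop_adj a u : R -> R[i] :=
  if u \in H1 a then fun x => 'i%C * weak_deriv a u x else 0.

Definition Bop a v : R -> R[i] := Dop_adj a (Gop_a a (Dop a v)).

(* Complex-valued a priori: that these quotients are real is not assumed. *)
Definition rayleighB a v : R[i] := inner (Bop a v) v / (l2norm v ^+ 2)%:C.

End operators.

(* Main.v *)
(* Split v into real and imaginary parts p and put D_p(x) = int |p(y+x) - p(y)|^2 dy.
   Since (p * p~)(0) - (p * p~)(x) = D_p(x) / 2, the form Q_W(v) is the sum over p
   of an L^2-bounded term and of the energy int_0^oo k(x) D_p(x) dx, where
   k(x) = e^(x/2) / (e^x - e^-x) ~ 1 / (2x).  Test functions are dense in the
   whole form domain: dilate inwards by a factor s -> 1+, then mollify; both steps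
   are controlled by the part of the energy near x = 0, which is small when the
   energy is finite.  So no property of a minimizer other than finiteness of its
   energy matters, and lambda_a is already the infimum over test functions.

   On a test function phi, integration by parts turns <B_a phi, phi> into
   int int g(x-y) phi'(y) conj(phi'(x)), hence into -int g h'' with h = phi * phi~.
   Integrating by parts twice against each piece of g gives Q_W(phi); the Lerch part
   of g yields the energy through k(x) = sum_n e^(-(2n+1/2)x), and the coefficient
   of |t| gives the right constant because
   -digamma(1/4) = log 4 + C_0 + 2 sum_n (1/(2n+1/2) - 1/(2n+1)). *)
Require Import Defs.
From mathcomp Require Import all_boot all_order all_algebra.
From mathcomp Require Import complex.
From mathcomp Require Import all_classical all_reals all_analysis.
From mathcomp Require Import measurable_realfun.
From mathcomp Require Import ring lra.

Set Implicit Arguments.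
Unset Strict Implicit.
Unset Printing Implicit Defensive.

Import Order.TTheory GRing.Theory Num.Theory.
Import numFieldNormedType.Exports.

Local Open Scope classical_set_scope.
Local Open Scope ring_scope.
Local Open Scope complex_scope.

(** * Invariance of Lebesgue measure *)

Section lebesgue_invariance.
Context {R : realType}.
Notation mu := (@lebesgue_measure R).

(** The energy is cut at a translation eta. Translations beyond eta cost only a multiple of the L2
    norm, because k is integrable there. Translations up to eta are handled by bounds that survive
    mollification (translation differences do not grow) and dilation (k behaves like 1/x, hence is
    homogeneous up to a constant factor). The L2 error of mollification is in turn bounded by the
    local energy, since the mollifier rho_d <= M/d is dominated by a multiple of k on (0, d).

    Projections and weak derivatives are picked by [xget] and are known only up to null functions.
    They are therefore never computed, only paired with test functions and compared with smooth
    models. The uniqueness this requires reuses the density theorem, which applies to indicators of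
    intervals because their energy is finite. G u grows at infinity, but only its values on (-a, a)
    matter, so g is truncated to [-2a, 2a].

    The derivative of Gamma at 1/4 is obtained from log-convexity and the functional equation, not
    by differentiating under the integral. *)

Lemma ge0_integral_affine (s c : R) (f : R -> \bar R) : 0 < s ->
  measurable_fun setT f -> (forall x, 0 <= f x)%E ->
  (\int[mu]_x f (s * x + c)%R = s^-1%:E * \int[mu]_x f x)%E.
Proof.
move=> s0 mf f0.
pose T : R -> measurableTypeR R := fun x => s * x + c.
have mT : measurable_fun setT T.
  by apply: measurable_funD => //; exact: measurable_funM.
have si : 0 <= s^-1 by rewrite invr_ge0 ltW.
have -> : (\int[mu]_x f (s * x + c)%R = \int[pushforward mu T]_x f x)%E.
  by rewrite ge0_integral_pushforward// preimage_setT.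
rewrite -[s^-1]/((NngNum si)%:num) -ge0_integral_mscale//.
apply: eq_measure_integral => A mA _.
(* The pushforward, scaled by s, gives half-open intervals their length, so it is Lebesgue measure
   by uniqueness. *)
pose m2 := mscale (NngNum (ltW s0)) (measure_function_pushforward__canonical__measure_function_Measure mu mT).
have E : forall B, measurable B -> mu B = m2 B.
  move=> B mB; apply: lebesgue_measure_unique => //= _ [[a b]] _ <-.
  rewrite /m2 /mscale/=.
  rewrite -[pushforward mu T `]a, b]]/(mu (T @^-1` `]a, b]%classic)).
  have -> : T @^-1` `]a, b] = `](a - c) / s, (b - c) / s]%classic.
    apply/seteqP; split => x /=; rewrite !in_itv/= /T.
    - by move=> /andP[h1 h2]; rewrite ltr_pdivrMr// ler_pdivlMr// mulrC; lra.
    - by rewrite ltr_pdivrMr// ler_pdivlMr// [x * s]mulrC => /andP[h1 h2]; lra.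
  rewrite !lebesgue_measure_itv/= !lte_fin ltr_pM2r ?invr_gt0// ltrD2r.
  case: ifPn => _; last by rewrite mule0.
  rewrite -EFinB -EFinM; congr EFin.
  by field; rewrite gt_eqF.
rewrite -[RHS]/(s^-1%:E * mu A)%E E// -[m2 A]/(s%:E * pushforward mu T A)%E.
by rewrite muleA -EFinM mulVf ?gt_eqF// mul1e.
Qed.

(** Passes from nonnegative to signed functions. Integrability is not asked for, because the
    integral is by definition the difference of the integrals of the positive and negative parts. *)
Lemma integral_invariant (T : R -> R) :
  (forall g : R -> \bar R, measurable_fun setT g -> (forall x, 0 <= g x)%E ->
    (\int[mu]_x g (T x) = \int[mu]_x g x)%E) ->
  forall f : R -> \bar R, measurable_fun setT f ->
  (\int[mu]_x f (T x) = \int[mu]_x f x)%E.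
Proof.
move=> H f mf.
rewrite [LHS]integralE [RHS]integralE; congr (_ - _)%E.
  have /(_ (fun x => funepos_ge0 f x)) E := H _ (measurable_funepos mf).
  by rewrite -E; apply: eq_integral => x _; rewrite !funeposE.
have /(_ (fun x => funeneg_ge0 f x)) E := H _ (measurable_funeneg mf).
by rewrite -E; apply: eq_integral => x _; rewrite !funenegE.
Qed.

Lemma integral_reflection (f : R -> \bar R) : measurable_fun setT f ->
  (\int[mu]_x f (- x)%R = \int[mu]_x f x)%E.
Proof.
move: f; apply: integral_invariant => g mg g0.
pose T : R -> measurableTypeR R := fun x => - x.
have mT : measurable_fun setT T by apply: measurableT_comp.
have -> : (\int[mu]_x g (- x)%R = \int[pushforward mu T]_x g x)%E.
  by rewrite ge0_integral_pushforward// preimage_setT.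
by apply: eq_measure_integral => A mA _; exact: lebesgue_measureN.
Qed.

Lemma integral_translation (c : R) (f : R -> \bar R) : measurable_fun setT f ->
  (\int[mu]_x f (x + c)%R = \int[mu]_x f x)%E.
Proof.
move: f; apply: (@integral_invariant (fun x => x + c)) => g mg g0.
rewrite -[RHS]mul1e -[X in (X%:E * _)%E]invr1 -(ge0_integral_affine c)//.
by apply: eq_integral => x _; rewrite mul1r.
Qed.

Lemma integral_reflection_translation (c : R) (f : R -> \bar R) :
  measurable_fun setT f ->
  (\int[mu]_x f (c - x)%R = \int[mu]_x f x)%E.
Proof.
move=> mf; rewrite -[RHS](integral_translation c)//.
rewrite -[RHS](integral_reflection (f := fun x => f (x + c)))//.
  by apply: eq_integral => x _; rewrite addrC.
by apply: measurableT_comp => //; exact: measurable_funD.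
Qed.

End lebesgue_invariance.

(** * Real square-integrable functions *)

Section real_L2.
Context {R : realType}.
Notation mu := (@lebesgue_measure R).
Implicit Types (p q : R -> R).

(** Kept in the extended reals, so that inequalities between squared norms hold for all measurable
    functions; [ip] below is the real-valued version for square-integrable ones. *)
Definition sq p : \bar R := (\int[mu]_x ((p x) ^+ 2)%:E)%E.

Definition real_L2 p := measurable_fun setT p /\ (sq p < +oo)%E.

Definition ip p q : R := \int[mu]_x (p x * q x).

Lemma measurable_sq p : measurable_fun setT p ->
  measurable_fun setT (fun x => ((p x) ^+ 2)%:E).
Proof. by move=> mp; apply/measurable_EFinP; exact: measurable_funX. Qed.

Lemma sq_ge0 p : (0 <= sq p)%E.
Proof. by apply: integral_ge0 => x _; rewrite lee_fin sqr_ge0. Qed.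

Lemma eq_sq p q : p =1 q -> sq p = sq q.
Proof. by move=> pq; apply: eq_integral => x _; rewrite pq. Qed.

Lemma measurable_shift p (c : R) : measurable_fun setT p ->
  measurable_fun setT (fun x : R => p (x + c)).
Proof. by move=> mp; apply: measurableT_comp => //; exact: measurable_funD. Qed.

Lemma measurable_reflect p : measurable_fun setT p ->
  measurable_fun setT (fun x : R => p (- x)).
Proof. by move=> mp; apply: measurableT_comp. Qed.

Lemma sq_shift p (c : R) : measurable_fun setT p ->
  sq (fun x => p (x + c)) = sq p.
Proof.
move=> mp; rewrite /sq.
by rewrite (@integral_translation R c (fun x => (p x ^+ 2)%:E))//; exact: measurable_sq.
Qed.

Lemma sq_reflect p : measurable_fun setT p -> sq (fun x => p (- x)) = sq p.
Proof.
move=> mp; rewrite /sq.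
by rewrite (@integral_reflection R (fun x => (p x ^+ 2)%:E))//; exact: measurable_sq.
Qed.

Lemma sqZ (c : R) p : measurable_fun setT p ->
  sq (fun x => c * p x) = ((c ^+ 2)%:E * sq p)%E.
Proof.
move=> mp; rewrite /sq -ge0_integralZl_EFin ?sqr_ge0//.
- by apply: eq_integral => x _; rewrite exprMn EFinM.
- by move=> x _; rewrite lee_fin sqr_ge0.
- exact: measurable_sq.
Qed.

Lemma sqN p : sq (fun x => - p x) = sq p.
Proof. by apply: eq_integral => x _; rewrite sqrrN. Qed.

(** Pointwise this is 2pq <= e p^2 + q^2 / e. The free weight lets the first coefficient tend to 1,
    which [Qreal_approx] needs through [le_enD]. *)
Lemma le_sqD (e : R) p q : 0 < e ->
  measurable_fun setT p -> measurable_fun setT q ->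
  (sq (fun x => p x + q x)%R <= (1 + e)%:E * sq p + (1 + e^-1)%:E * sq q)%E.
Proof.
move=> e0 mp mq; have ei : 0 < e^-1 by rewrite invr_gt0.
have h1 : 0 <= 1 + e by lra.
have h2 : 0 <= 1 + e^-1 by lra.
have hs (r : R -> R) x : (@setT R) x -> (0%:E <= ((r x) ^+ 2)%:E)%E.
  by rewrite lee_fin sqr_ge0.
rewrite /sq -2?ge0_integralZl_EFin//; try exact: measurable_sq.
have hm (r : R -> R) k : measurable_fun setT r ->
    measurable_fun [set: R] (fun x => k%:E * ((r x) ^+ 2)%:E)%E.
  by move=> mr; apply: measurable_funeM; exact: measurable_sq.
all: try by move=> x _; rewrite lee_fin sqr_ge0.
rewrite -ge0_integralD//; try exact: hm.
all: try by move=> x _; rewrite mule_ge0 ?lee_fin ?sqr_ge0.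
apply: ge0_le_integral => //.
- by move=> x _; rewrite lee_fin sqr_ge0.
- by apply: measurable_sq; exact: measurable_funD.
- by apply: emeasurable_funD; exact: hm.
move=> x _; rewrite -!EFinM -EFinD lee_fin.
rewrite -subr_ge0.
have -> : (1 + e) * p x ^+ 2 + (1 + e^-1) * q x ^+ 2 - (p x + q x) ^+ 2 =
  e * (p x - e^-1 * q x) ^+ 2.
  by field; rewrite gt_eqF.
by rewrite mulr_ge0 ?sqr_ge0// ltW.
Qed.

Lemma le_sqD2 p q :
  measurable_fun setT p -> measurable_fun setT q ->
  (sq (fun x => p x + q x)%R <= 2%:E * (sq p + sq q))%E.
Proof.
move=> mp mq; apply: (le_trans (le_sqD ltr01 mp mq)).
by rewrite invr1 (@ge0_muleDr _ _ (sq p) (sq q)) ?sq_ge0.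
Qed.

Lemma le_sqB2 p q :
  measurable_fun setT p -> measurable_fun setT q ->
  (sq (fun x => p x - q x)%R <= 2%:E * (sq p + sq q))%E.
Proof.
move=> mp mq; rewrite -(sqN q); apply: le_sqD2 => //.
by apply: measurableT_comp.
Qed.

Lemma real_L2Z (c : R) p : real_L2 p -> real_L2 (fun x => c * p x).
Proof.
move=> [mp fp]; split; first exact: measurable_funM.
by rewrite sqZ// lte_mul_pinfty ?lee_fin ?sqr_ge0.
Qed.

Lemma real_L2B p q : real_L2 p -> real_L2 q -> real_L2 (fun x => p x - q x).
Proof.
move=> [mp fp] [mq fq]; split; first exact: measurable_funB.
apply: le_lt_trans (le_sqB2 mp mq) _.
by rewrite lte_mul_pinfty ?lee_fin// lte_add_pinfty.
Qed.

Lemma real_L2_shift p (c : R) : real_L2 p -> real_L2 (fun x => p (x + c)).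
Proof. by move=> [mp fp]; split; [exact: measurable_shift|rewrite sq_shift]. Qed.

Lemma real_L2_reflect p : real_L2 p -> real_L2 (fun x => p (- x)).
Proof. by move=> [mp fp]; split; [exact: measurable_reflect|rewrite sq_reflect]. Qed.

Lemma integrable_sqr p : real_L2 p ->
  mu.-integrable setT (fun x => (p x ^+ 2)%:E).
Proof.
move=> [mp fp]; apply/integrableP; split; first exact: measurable_sq.
rewrite (le_lt_trans _ fp)//; apply: ge0_le_integral => //.
- by apply: measurableT_comp => //; exact: measurable_sq.
- exact: measurable_sq.
by move=> x _; rewrite abse_EFin lee_fin ger0_norm ?sqr_ge0.
Qed.

Lemma integrable_mul p q : real_L2 p -> real_L2 q ->
  mu.-integrable setT (fun x => (p x * q x)%:E).
Proof.
move=> Lp Lq.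
have h := integrableD measurableT (integrable_sqr Lp) (integrable_sqr Lq).
apply: le_integrable h => //.
- apply/measurable_EFinP; apply: measurable_funM; [exact: Lp.1|exact: Lq.1].
move=> x _; rewrite -EFinD !abse_EFin lee_fin.
rewrite [leRHS]ger0_norm ?addr_ge0 ?sqr_ge0// ler_norml; apply/andP; split.
  have := sqr_ge0 (p x + q x); nra.
have := sqr_ge0 (p x - q x); nra.
Qed.

Lemma sqE p : real_L2 p -> sq p = (ip p p)%:E.
Proof.
move=> Lp; rewrite /ip /Rintegral fineK//.
by apply: integrable_fin_num => //; exact: integrable_mul.
Qed.

Lemma ip_ge0 p : 0 <= ip p p.
Proof. by apply: Rintegral_ge0 => x _; rewrite -expr2 sqr_ge0. Qed.

Lemma ipC p q : ip p q = ip q p.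
Proof. by apply: eq_Rintegral => x _; rewrite mulrC. Qed.

Lemma ipBl p q r : real_L2 p -> real_L2 q -> real_L2 r ->
  ip (fun x => p x - q x) r = ip p r - ip q r.
Proof.
move=> Lp Lq Lr; rewrite /ip -RintegralB//; try exact: integrable_mul.
by apply: eq_Rintegral => x _; rewrite mulrBl.
Qed.

Lemma ipZl (c : R) p q : real_L2 p -> real_L2 q ->
  ip (fun x => c * p x) q = c * ip p q.
Proof.
move=> Lp Lq; rewrite /ip -RintegralZl//; try exact: integrable_mul.
by apply: eq_Rintegral => x _; rewrite mulrA.
Qed.

Lemma ip_sqB p q : real_L2 p -> real_L2 q ->
  ip (fun x => p x - q x) (fun x => p x - q x) = ip p p - 2 * ip p q + ip q q.
Proof.
move=> Lp Lq; have Lpq := real_L2B Lp Lq.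
rewrite (ipBl Lp Lq Lpq) (ipC p) (ipC q) (ipBl Lp Lq Lp) (ipBl Lp Lq Lq) (ipC q p); ring.
Qed.

(** Cauchy-Schwarz in additive, weighted form, free of square roots: expand the squared norm of p -
    (s/e) q for the signs s = 1 and s = -1. *)
Lemma norm_ip_le (e : R) p q : 0 < e -> real_L2 p -> real_L2 q ->
  `|ip p q| <= (e * ip p p + e^-1 * ip q q) / 2.
Proof.
move=> e0 Lp Lq.
have h (s : R) : s ^+ 2 = 1 -> s * ip p q <= (e * ip p p + e^-1 * ip q q) / 2.
  move=> s1.
  have Lq' := real_L2Z (s / e) Lq.
  have := ip_ge0 (fun x => p x - s / e * q x).
  rewrite ip_sqB// [ip p (fun x => _ * _)]ipC ipZl// ipZl// [ip q (fun x => _ * _)]ipC ipZl//.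
  rewrite (ipC q p) => H.
  have := mulr_ge0 (ltW e0) H.
  have -> : e * (ip p p - 2 * (s / e * ip p q) + s / e * (s / e * ip q q)) =
    e * ip p p - 2 * (s * ip p q) + e^-1 * (s ^+ 2 * ip q q).
    by field; rewrite gt_eqF.
  rewrite s1; lra.
rewrite ler_norml; apply/andP; split.
  have := h (-1); rewrite sqrrN expr1n => /(_ erefl); lra.
have := h 1; rewrite expr1n => /(_ erefl); lra.
Qed.

Lemma ip_shift p q (c : R) : measurable_fun setT p -> measurable_fun setT q ->
  ip (fun x => p (x + c)) (fun x => q (x + c)) = ip p q.
Proof.
move=> mp mq; rewrite /ip /Rintegral.
rewrite (@integral_translation R c (fun x => (p x * q x)%:E))//.
by apply/measurable_EFinP; exact: measurable_funM.
Qed.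

Lemma ip_reflect p q : measurable_fun setT p -> measurable_fun setT q ->
  ip (fun x => p (- x)) (fun x => q (- x)) = ip p q.
Proof.
move=> mp mq; rewrite /ip /Rintegral.
rewrite (@integral_reflection R (fun x => (p x * q x)%:E))//.
by apply/measurable_EFinP; exact: measurable_funM.
Qed.

(** For real p this is p * p~, the function to which the Weil functional is applied. *)
Definition corr p (x : R) : R := ip (fun y => p (y + x)) p.

Definition tdiff p (x : R) : \bar R := sq (fun y => p (y + x) - p y).

Lemma tdiff_ge0 p x : (0 <= tdiff p x)%E. Proof. exact: sq_ge0. Qed.

Lemma corr0 p : corr p 0 = ip p p.
Proof. by rewrite /corr; congr ip; apply/funext => y; rewrite addr0. Qed.

Lemma tdiffE p x : real_L2 p -> tdiff p x = (2 * (corr p 0 - corr p x))%:E.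
Proof.
move=> Lp; have Ls := real_L2_shift x Lp.
rewrite /tdiff sqE; last exact: real_L2B.
rewrite ip_sqB// ip_shift; [|exact: Lp.1..].
rewrite corr0 /corr; congr EFin; ring.
Qed.

Lemma corrN p x : real_L2 p -> corr p (- x) = corr p x.
Proof.
move=> Lp; have Ls := (real_L2_shift (-x) Lp).1.
rewrite /corr -(ip_shift x)//; last exact: Lp.1.
rewrite ipC; congr ip; apply/funext => y; by rewrite addrK.
Qed.

(** With d = p - q, the difference is <p(.+x), d> + <d(.+x), q>, and each term is linear in d. The
    bound is uniform in x. *)
Lemma corrB_le (e : R) p q x : 0 < e -> real_L2 p -> real_L2 q ->
  `|corr p x - corr q x| <=
  (e * (ip p p + ip q q)) / 2 +
  e^-1 * ip (fun y => p y - q y) (fun y => p y - q y).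
Proof.
move=> e0 Lp Lq; set d := fun y => p y - q y.
have Ld : real_L2 d by exact: real_L2B.
have Ls := real_L2_shift x Lp.
have Lqs := real_L2_shift x Lq.
have -> : corr p x - corr q x = ip (fun y => p (y + x)) d + ip (fun y => d (y + x)) q.
  rewrite ipC ipBl// /d (ipBl Ls)// /corr (ipC p) (ipC q); ring.
apply: (le_trans (ler_normD _ _)).
have Lds := real_L2_shift x Ld.
have h1 := norm_ip_le e0 Ls Ld.
have h2 := norm_ip_le e0 Lq Lds.
rewrite ipC in h2.
rewrite (ip_shift _ Lp.1 Lp.1) in h1.
rewrite (ip_shift _ Ld.1 Ld.1) in h2.
lra.
Qed.

Lemma corr_le p x : real_L2 p -> `|corr p x| <= ip p p.
Proof.
move=> Lp; have := norm_ip_le ltr01 (real_L2_shift x Lp) Lp.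
by rewrite invr1 !mul1r (ip_shift _ Lp.1 Lp.1) => /le_trans; apply; lra.
Qed.

Lemma measurable_translates p : measurable_fun setT p ->
  measurable_fun setT (fun z : R * R => p (z.2 + z.1)).
Proof.
by move=> mp; apply: measurableT_comp => //; exact: measurable_funD.
Qed.

Lemma measurable_tdiff p : measurable_fun setT p -> measurable_fun setT (tdiff p).
Proof.
move=> mp.
apply: (@measurable_fun_fubini_tonelli_F _ _ _ _ _ mu
   (fun z : R * R => ((p (z.2 + z.1) - p z.2) ^+ 2)%:E)).
  apply/measurable_EFinP; apply: measurable_funX; apply: measurable_funB.
    exact: measurable_translates.
  by apply: measurableT_comp.
by move=> z; rewrite lee_fin sqr_ge0.
Qed.

(** Inherited from [tdiff], whose integrand is nonnegative, so that Tonelli's theorem gives its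
    measurability. *)
Lemma measurable_corr p : real_L2 p -> measurable_fun setT (corr p).
Proof.
move=> Lp.
have -> : corr p = (fun x => corr p 0 - 2^-1 * fine (tdiff p x)).
  by apply/funext => x; rewrite tdiffE//=; lra.
apply: measurable_funB => //; apply: measurable_funM => //.
by apply: measurableT_comp => //; exact: measurable_tdiff Lp.1.
Qed.

Lemma corr_supp p (a x : R) : (forall y, a <= `|y| -> p y = 0) ->
  2 * a <= `|x| -> corr p x = 0.
Proof.
move=> pa ax; rewrite /corr /ip /Rintegral integral0_eq// => y _.
have [/pa ->|ya] := lerP a `|y|; first by rewrite mulr0.
rewrite pa ?mul0r//.
have := ler_normD (y + x) (- y); rewrite normrN [y + x]addrC addrK; lra.
Qed.

End real_L2.

(** * Calculus on the line *)

Section calculus.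
Context {R : realType}.
Notation mu := (@lebesgue_measure R).
Implicit Types (f g : R -> R) (x a b c : R).

Lemma is_derive_add f g x a b : is_derive x (1 : R) f a -> is_derive x (1 : R) g b ->
  is_derive x (1 : R) (fun y => f y + g y) (a + b).
Proof. by move=> fa gb; apply: is_deriveD. Qed.

Lemma is_derive_sub f g x a b : is_derive x (1 : R) f a -> is_derive x (1 : R) g b ->
  is_derive x (1 : R) (fun y => f y - g y) (a - b).
Proof. by move=> fa gb; apply: is_deriveB. Qed.

Lemma is_derive_mul f g x a b : is_derive x (1 : R) f a -> is_derive x (1 : R) g b ->
  is_derive x (1 : R) (fun y => f y * g y) (a * g x + f x * b).
Proof.
move=> fa gb; have := is_deriveM fa gb.
by rewrite /GRing.scale/= addrC [g x * a]mulrC.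
Qed.

Lemma is_derive_scale f x a c : is_derive x (1 : R) f a ->
  is_derive x (1 : R) (fun y => c * f y) (c * a).
Proof.
move=> fa; have := is_derive_mul (is_derive_cst c x 1) fa.
by rewrite mul0r add0r.
Qed.

Lemma is_derive_affine x (s c : R) : is_derive x (1 : R) (fun y => s * y + c) s.
Proof.
have := is_derive_add (is_derive_scale s (is_derive_id x (1 : R))) (is_derive_cst c x 1).
by rewrite mulr1 addr0.
Qed.

Lemma is_derive_compo f g x a b : is_derive (g x) (1 : R) f a ->
  is_derive x (1 : R) g b -> is_derive x (1 : R) (fun y => f (g y)) (a * b).
Proof. by move=> fa gb; apply: (@is_derive1_comp R f g). Qed.

Lemma is_derive_opp f x a : is_derive x (1 : R) f a ->
  is_derive x (1 : R) (fun y => - f y) (- a).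
Proof. by move=> fa; apply: is_deriveN. Qed.

Lemma is_derive_pow f x a (n : nat) : is_derive x (1 : R) f a ->
  is_derive x (1 : R) (fun y => f y ^+ n) (n%:R * f x ^+ n.-1 * a).
Proof.
move=> fa; have -> : (fun y => f y ^+ n) = f ^+ n.
  by apply/funext => y; elim: n => [|n ih]//; rewrite !exprS ih.
exact: is_deriveX.
Qed.

Lemma is_derive_expR_comp g x b : is_derive x (1 : R) g b ->
  is_derive x (1 : R) (fun y => expR (g y)) (expR (g x) * b).
Proof. exact: (@is_derive_compo expR). Qed.

Lemma is_derive_cont f x a : is_derive x (1 : R) f a -> {for x, continuous f}.
Proof.
move=> [df _]; apply: differentiable_continuous.
exact/derivable1_diffP.
Qed.

Lemma is_derive_derive1 f x a : is_derive x (1 : R) f a -> derive1 f x = a.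
Proof. by move=> fa; rewrite derive1E; apply: derive_val. Qed.

Lemma is_derive_deriv1 f x : derivable f x 1 -> is_derive x (1 : R) f (derive1 f x).
Proof. by move=> df; rewrite derive1E; exact/derivableP. Qed.

Lemma continuous_integrable_itv f a b : continuous f ->
  mu.-integrable `[a, b] (EFin \o f).
Proof.
move=> cf; apply: continuous_compact_integrable; first exact: segment_compact.
exact: continuous_subspaceT.
Qed.

Lemma continuous_measurableT f : continuous f -> measurable_fun setT f.
Proof. exact: continuous_measurable_fun. Qed.

Lemma FTC_itv (F f : R -> R) a b : a <= b ->
  (forall x, is_derive x (1 : R) F (f x)) -> continuous f ->
  \int[mu]_(x in `[a, b]) f x = F b - F a.
Proof.
move=> ab dF cf; move: ab; rewrite le_eqVlt => /predU1P[<-|ab].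
  by rewrite set_itv1 Rintegral_set1 subrr.
rewrite /Rintegral (@continuous_FTC2 _ f F)//.
- exact: continuous_subspaceT.
- have cF x : {for x, continuous F} by exact: is_derive_cont (dF x).
  split.
  + by move=> x _; case: (dF x).
  + by apply: cvg_at_right_filter; exact: cF.
  + by apply: cvg_at_left_filter; exact: cF.
- by move=> x _; exact: is_derive_derive1.
Qed.

Lemma integral_expR_neg b : 0 < b ->
  (\int[mu]_(x in `]0%R, +oo[) (expR (- (b * x)))%:E = (b^-1)%:E)%E.
Proof.
move=> b0.
have dF x : is_derive x (1 : R) (fun y => - b^-1 * expR (- b * y + 0)) (expR (- (b * x))).
  have := is_derive_scale (- b^-1) (is_derive_expR_comp (is_derive_affine x (- b) 0)).
  by rewrite mulrC -mulrA mulrNN mulfV ?gt_eqF// mulr1 addr0 mulNr.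
have cF x : {for x, continuous (fun y => - b^-1 * expR (- b * y + 0))}.
  exact: is_derive_cont (dF x).
rewrite integral_itv_obnd_cbnd; last first.
  apply/measurable_EFinP; apply: measurableT_comp => //; apply: measurableT_comp => //.
rewrite (@ge0_continuous_FTC2y _ (fun x => expR (- (b * x)))
  (fun y => - b^-1 * expR (- b * y + 0)) 0 0)//.
- by rewrite mulr0 addr0 expR0 mulr1 -EFinB sub0r opprK.
- apply: continuous_subspaceT => x.
  have -> : (fun x => expR (- (b * x))) = (fun y => expR (- b * y + 0)).
    by apply/funext => y; rewrite addr0 mulNr.
  exact: is_derive_cont (is_derive_expR_comp (is_derive_affine x (- b) 0)).
- rewrite -[X in _ --> X](mulr0 (- b^-1)); apply: cvgM; first exact: cvg_cst.
  have h : (fun y => expR (- b * y + 0)) = (fun y => expR (- y)) \o (fun y => b * y).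
    by apply/funext => y; rewrite /= addr0 mulNr.
  rewrite h; apply: cvg_comp (@cvgr_expR R).
  by apply: gt0_cvgMry => //; exact: cvg_id.
- by apply: cvg_at_right_filter; exact: cF.
- by move=> x _; exact: is_derive_derive1.
Qed.

End calculus.

(** * The kernel of the archimedean term *)

Section kernel.
Context {R : realType}.
Notation mu := (@lebesgue_measure R).

Definition kap (x : R) : R := expR (x / 2) / (expR x - expR (- x)).

Definition kb (n : nat) : R := 2 * n%:R + 1 / 2.

Lemma kb_gt0 n : 0 < kb n.
Proof. by rewrite /kb; have := ler0n R n; lra. Qed.

Lemma kapE x : 0 < x -> kap x = expR (- (x / 2)) * (1 - expR (- (2 * x)))^-1.
Proof.
move=> x0; rewrite /kap.
have h : expR (- (2 * x)) < 1 by rewrite expR_lt1; lra.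
have e1 : expR x = expR (x / 2) ^+ 2 by rewrite -expRM_natl; congr expR; lra.
have e2 : expR (- x) = (expR (x / 2) ^+ 2)^-1 by rewrite expRN e1.
have e3 : expR (- (2 * x)) = (expR (x / 2) ^+ 4)^-1.
  by rewrite expRN -expRM_natl; congr (_^-1); congr expR; lra.
have e4 : expR (- (x / 2)) = (expR (x / 2))^-1 by rewrite expRN.
move: h; rewrite e1 e2 e3 e4 => h.
have p0 := expR_gt0 (x / 2); move: p0 h; set u := expR _ => p0 h.
have u4 : 1 < u ^+ 4 by rewrite -invf_lt1// exprn_gt0.
field.
have h1 : u ^+ 4 - 1 != 0 by lra.
by rewrite gt_eqF.
Qed.

Lemma kap_gt0 x : 0 < x -> 0 < kap x.
Proof.
move=> x0; rewrite kapE// mulr_gt0 ?expR_gt0// invr_gt0 subr_gt0 expR_lt1; lra.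
Qed.

(** With [kap_le] this places the kernel between 1/(4x) and 3/(2x) near 0, which is all that the
    density argument uses of its singularity. Here e^(-x/2) >= 1/2 and 1 - e^(-2x) <= 2x. *)
Lemma kap_ge x : 0 < x -> x <= 1 -> (4 * x)^-1 <= kap x.
Proof.
move=> x0 x1; rewrite kapE//.
have -> : (4 * x)^-1 = 2^-1 * (2 * x)^-1 by field; rewrite gt_eqF.
have h : expR (- (2 * x)) < 1 by rewrite expR_lt1; lra.
apply: ler_pM.
- by rewrite invr_ge0.
- by rewrite invr_ge0; lra.
- have := expR_ge1Dx (- (x / 2)); lra.
- rewrite lef_pV2 ?posrE//; last by lra.
  have := expR_ge1Dx (- (2 * x)); lra.
  lra.
Qed.

Lemma kap_le x : 0 < x -> x <= 1 -> kap x <= 3 / (2 * x).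
Proof.
move=> x0 x1; rewrite kapE//.
have h : expR (- (2 * x)) < 1 by rewrite expR_lt1; lra.
(* From e^(-2x) <= 1/(1 + 2x) one gets 2x/(1 + 2x), and 1 + 2x <= 3. *)
have h2 : 2 * x / 3 <= 1 - expR (- (2 * x)).
  have : expR (- (2 * x)) <= (1 + 2 * x)^-1.
    rewrite expRN lef_pV2 ?posrE ?expR_gt0//; last by lra.
    exact: expR_ge1Dx.
  suff : (1 + 2 * x)^-1 <= 1 - 2 * x / 3 by lra.
  rewrite -div1r ler_pdivrMr; last by lra.
  nra.
have -> : 3 / (2 * x) = 1 * (2 * x / 3)^-1 by field; rewrite gt_eqF.
apply: ler_pM.
- exact: expR_ge0.
- by rewrite invr_ge0 subr_ge0 ltW.
- by rewrite expR_le1; lra.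
- by rewrite lef_pV2 ?posrE//; [lra|lra].
Qed.

Lemma kap_le_exp (eta x : R) : 0 < eta -> eta <= x ->
  kap x <= (1 - expR (- (2 * eta)))^-1 * expR (- (2^-1 * x)).
Proof.
move=> e0 ex; rewrite kapE; last by lra.
have h : expR (- (2 * eta)) < 1 by rewrite expR_lt1; lra.
have h2 : expR (- (2 * x)) <= expR (- (2 * eta)) by rewrite ler_expR; lra.
rewrite [x / 2]mulrC [leLHS]mulrC ler_wpM2r ?expR_ge0// lef_pV2 ?posrE; lra.
Qed.

Lemma measurable_kap : measurable_fun (`]0, +oo[%classic : set R) kap.
Proof.
apply: (eq_measurable_fun
  (fun x : R => expR (- (x / 2)) * (1 - expR (- (2 * x))) `^ (-1))).
  move=> x; rewrite inE/= in_itv/= andbT => x0; rewrite kapE// powR_inv1//.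
  by rewrite subr_ge0 expR_le1; lra.
apply: measurable_funTS; apply: measurable_funM.
  by apply: measurableT_comp => //; apply: measurableT_comp => //; exact: measurable_funM.
apply: (measurableT_comp (measurable_powR _)); apply: measurable_funB => //.
by apply: measurableT_comp => //; apply: measurableT_comp => //; exact: measurable_funM.
Qed.

Lemma cvg_kap x : 0 < x ->
  series (fun n => expR (- (kb n * x))) @ \oo --> kap x.
Proof.
move=> x0; rewrite kapE//.
have -> : (fun n => expR (- (kb n * x))) =
    geometric (expR (- (x / 2))) (expR (- (2 * x))).
  apply/funext => n; rewrite /geometric/= -expRM_natl -expRD; congr expR.
  by rewrite /kb; ring.
apply: cvg_geometric_series.
by rewrite ger0_norm ?expR_ge0// expR_lt1; lra.
Qed.

Lemma kap_eseries x : 0 < x ->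
  (kap x)%:E = (\sum_(n <oo) (expR (- (kb n * x)))%:E)%E.
Proof.
move=> x0; apply/esym/cvg_lim => //.
have -> : (fun n => \sum_(0 <= i < n) (expR (- (kb i * x)))%:E)%E =
    EFin \o series (fun n => expR (- (kb n * x))).
  by apply/funext => n; rewrite /= /series/= sumEFin.
by apply: cvg_EFin; [exact: nearW|exact: cvg_kap].
Qed.

Lemma integral_kap_tail (eta : R) : 0 < eta ->
  (\int[mu]_(x in `[eta, +oo[) (kap x)%:E < +oo)%E.
Proof.
move=> e0; set c := (1 - expR (- (2 * eta)))^-1.
have c0 : 0 <= c by rewrite invr_ge0 subr_ge0 expR_le1; lra.
have mexp : measurable_fun setT (fun x : R => expR (- (2^-1 * x))).
  by apply: measurableT_comp => //; apply: measurableT_comp => //; exact: measurable_funM.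
apply: (@le_lt_trans _ _ (\int[mu]_(x in `]0%R, +oo[) (c * expR (- (2^-1 * x)))%:E)%E).
  apply: (@le_trans _ _ (\int[mu]_(x in `[eta, +oo[) (c * expR (- (2^-1 * x)))%:E)%E).
    apply: ge0_le_integral => //.
    - move=> x; rewrite /= in_itv/= andbT => ex.
      by rewrite lee_fin ltW// kap_gt0//; lra.
    - apply/measurable_EFinP; apply: measurable_funS measurable_kap => //.
      by move=> x /=; rewrite !in_itv/= !andbT; lra.
    - by apply/measurable_EFinP; apply: measurable_funTS; exact: measurable_funM.
    - move=> x; rewrite /= in_itv/= andbT => ex; rewrite lee_fin; exact: kap_le_exp.
  apply: ge0_subset_integral => //.
  - by apply/measurable_EFinP; apply: measurable_funTS; exact: measurable_funM.
  - by move=> x _; rewrite lee_fin mulr_ge0 ?expR_ge0.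
  - by move=> x /=; rewrite !in_itv/= !andbT; lra.
under eq_integral do rewrite EFinM.
rewrite ge0_integralZl_EFin//.
- by rewrite integral_expR_neg// -EFinM ltry.
by apply/measurable_EFinP; exact: measurable_funTS.
Qed.

(** The integral of (1 - e^(-x/2)) e^(-kb n x) over the half-line, equal to 1/(2n+1/2) - 1/(2n+1).
    The sum enters both the archimedean constant of W and digamma(1/4). *)
Definition jterm (n : nat) : R := (kb n)^-1 - (kb n + 1 / 2)^-1.

Definition jsum : R := limn (series jterm).

Lemma jterm_ge0 n : 0 <= jterm n.
Proof.
rewrite /jterm subr_ge0 lef_pV2 ?posrE ?kb_gt0//; have := kb_gt0 n; lra.
Qed.

Lemma cvg_jsum : series jterm @ \oo --> jsum.
Proof.
suff : cvgn (series jterm) by [].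
apply: nondecreasing_is_cvgn.
  by apply: nondecreasing_series => n _ _; exact: jterm_ge0.
exists 2 => _ [n _ <-].
(* Since kb (n+1) >= kb n + 1/2, the terms are dominated by a telescoping sum that starts at 1 / kb
   0 = 2. *)
suff h : series jterm n <= 2 - (kb n)^-1.
  by have : 0 <= (kb n)^-1 by [rewrite invr_ge0 ltW// kb_gt0]; lra.
elim: n => [|n ih].
  by rewrite /series/= big_geq// /kb mulr0 add0r div1r invrK; lra.
rewrite seriesSr /jterm.
have : (kb n.+1)^-1 <= (kb n + 1 / 2)^-1.
  rewrite lef_pV2 ?posrE ?kb_gt0//; last by have := kb_gt0 n; lra.
  rewrite /kb -(natr1 n); lra.
lra.
Qed.

Lemma integral_jsum :
  (\int[mu]_(x in `]0%R, +oo[) ((1 - expR (- (x / 2))) * kap x)%:E = jsum%:E)%E.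
Proof.
have mexp (b : R) : measurable_fun setT (fun x : R => expR (- (b * x))).
  by apply: measurableT_comp => //; apply: measurableT_comp => //; exact: measurable_funM.
have mexp2 : measurable_fun setT (fun x : R => expR (- (x / 2))).
  by apply: measurableT_comp => //; apply: measurableT_comp => //; exact: measurable_funM.
have ge (x : R) : `]0%R, +oo[%classic x -> 0 <= 1 - expR (- (x / 2)).
  by rewrite /= in_itv/= andbT => x0; rewrite subr_ge0 expR_le1; lra.
transitivity (\int[mu]_(x in `]0%R, +oo[)
    (\sum_(n <oo) ((1 - expR (- (x / 2))) * expR (- (kb n * x)))%:E))%E.
  apply: eq_integral => x; rewrite inE/= in_itv/= andbT => x0.
  rewrite EFinM kap_eseries// -nneseriesZl//.
rewrite integral_nneseries//; last 2 first.
- move=> n; apply/measurable_EFinP; apply: measurable_funTS; apply: measurable_funM; last exact: mexp.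
  exact: measurable_funB.
- by move=> n x x0; rewrite lee_fin mulr_ge0 ?ge ?expR_ge0.
transitivity (\sum_(n <oo) (jterm n)%:E)%E.
  apply: eq_eseriesr => n _; rewrite /jterm EFinB.
  rewrite -integral_expR_neg ?kb_gt0// -integral_expR_neg; last by have := kb_gt0 n; lra.
  have ib b : 0 < b -> mu.-integrable `]0%R, +oo[ (fun x : R => (expR (- (b * x)))%:E).
    move=> b0; apply/integrableP; split.
      by apply/measurable_EFinP; apply: measurable_funTS; exact: mexp.
    under eq_integral do rewrite abse_EFin ger0_norm ?expR_ge0//.
    by rewrite integral_expR_neg// ltry.
  rewrite -integralB//; try apply: ib; rewrite ?kb_gt0//; last by have := kb_gt0 n; lra.
  apply: eq_integral => x _; rewrite -EFinB; congr EFin.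
  rewrite mulrBl mul1r -expRD; congr (_ - expR _); ring.
apply/cvg_lim => //.
have -> : (fun n => \sum_(0 <= i < n) (jterm i)%:E)%E = EFin \o series jterm.
  by apply/funext => n; rewrite /= /series/= sumEFin.
by apply: cvg_EFin; [exact: nearW|exact: cvg_jsum].
Qed.

End kernel.

(** * The energy and the bounded part of the Weil functional *)

(** The integral of g may be infinite, which is the case of infinite energy. Integrating (f - g)^- +
    f = g + (f - g)^+ involves only nonnegative functions, and the finite terms can then be
    cancelled. *)
Lemma integral_sub_ge0 d (T : measurableType d) (R : realType)
    (mu : {measure set T -> \bar R}) (D : set T) (f g : T -> R) :
  measurable D -> measurable_fun D f -> measurable_fun D g ->
  (forall x, D x -> 0 <= f x) -> (forall x, D x -> 0 <= g x) ->
  (\int[mu]_(x in D) (f x)%:E < +oo)%E ->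
  (\int[mu]_(x in D) (f x - g x)%:E =
   \int[mu]_(x in D) (f x)%:E - \int[mu]_(x in D) (g x)%:E)%E.
Proof.
move=> mD mf mg f0 g0 foo.
have mfg : measurable_fun D (fun x => (f x - g x)%:E).
  by apply/measurable_EFinP; exact: measurable_funB.
have If0 : (0 <= \int[mu]_(x in D) (f x)%:E)%E by apply: integral_ge0 => x /f0; rewrite lee_fin.
have Iff : (\int[mu]_(x in D) (f x)%:E)%E \is a fin_num by rewrite ge0_fin_numE.
have key : (\int[mu]_(x in D) (fun x => (f x - g x)%:E)^\- x +
    \int[mu]_(x in D) (f x)%:E = \int[mu]_(x in D) (g x)%:E +
    \int[mu]_(x in D) (fun x => (f x - g x)%:E)^\+ x)%E.
  rewrite -!ge0_integralD//.
  - apply: eq_integral => x _; rewrite funeposE funenegE.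
    rewrite -EFinN -!EFin_max -!EFinD; congr EFin.
    by rewrite !maxEle; case: ifPn => h1; case: ifPn => h2; lra.
  - by apply/measurable_EFinP.
  - exact: measurable_funepos.
  - exact: measurable_funeneg.
  - by apply/measurable_EFinP.
have Ip : (\int[mu]_(x in D) (fun x => (f x - g x)%:E)^\+ x)%E \is a fin_num.
  rewrite ge0_fin_numE; last exact: integral_ge0.
  apply: le_lt_trans foo; apply: ge0_le_integral => //.
  - exact: measurable_funepos.
  - exact/measurable_EFinP.
  - move=> x Dx; rewrite funeposE -EFin_max lee_fin.
    by have := g0 _ Dx; have := f0 _ Dx; rewrite maxEle; case: ifPn; lra.
rewrite [LHS]integralE; move: key Ip.
move: (\int[mu]_(x in D) (fun x => (f x - g x)%:E)^\+ x)%E => P.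
move: (\int[mu]_(x in D) (fun x => (f x - g x)%:E)^\- x)%E => N.
move: If0 Iff; move: (\int[mu]_(x in D) (f x)%:E)%E (\int[mu]_(x in D) (g x)%:E)%E.
move=> [F| |] [G| |] //= _ _; case: P => [P| |]//; case: N => [N| |] //=.
by rewrite -!EFinD => -[h] _; congr EFin; lra.
Qed.

Section weil_decomposition.
Context {R : realType}.
Notation mu := (@lebesgue_measure R).

Lemma integrable_itv_indic (i : interval R) (f : R -> R) :
  mu.-integrable [set` i] (EFin \o f) ->
  mu.-integrable setT (fun x => (f x * \1_([set` i]) x)%:E).
Proof.
move=> fi; have mI : measurable ([set` i] : set (measurableTypeR R)).
  exact: measurable_itv.
apply: eq_integrable ((integrable_mkcond _ mI).1 fi) => // x _ /=.
by rewrite patchE indicE; case: ifP => _; rewrite ?mulr1 ?mulr0.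
Qed.

Implicit Types (p q h : R -> R) (v : R -> R[i]).

Definition en p : \bar R := (\int[mu]_(x in `]0%R, +oo[) ((kap x)%:E * tdiff p x))%E.

Lemma integrand_en_ge0 p (x : R) : `]0%R, +oo[%classic x -> (0 <= (kap x)%:E * tdiff p x)%E.
Proof.
rewrite /= in_itv/= andbT => x0; rewrite mule_ge0 ?lee_fin ?tdiff_ge0//.
exact/ltW/kap_gt0.
Qed.

Lemma measurable_integrand_en p : measurable_fun setT p ->
  measurable_fun (`]0%R, +oo[%classic : set R) (fun x => (kap x)%:E * tdiff p x)%E.
Proof.
move=> mp; apply: emeasurable_funM.
  by apply/measurable_EFinP; exact: measurable_kap.
by apply: measurable_funTS; exact: measurable_tdiff.
Qed.

Lemma en_ge0 p : (0 <= en p)%E.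
Proof. by apply: integral_ge0; exact: integrand_en_ge0. Qed.

Lemma eq_en p q : p =1 q -> en p = en q.
Proof.
move=> pq; apply: eq_integral => x _; congr (_ * _)%E.
by apply: eq_sq => y; rewrite !pq.
Qed.

Lemma le_enD (e : R) p q : 0 < e ->
  measurable_fun setT p -> measurable_fun setT q ->
  (en (fun x => p x + q x)%R <= (1 + e)%:E * en p + (1 + e^-1)%:E * en q)%E.
Proof.
move=> e0 mp mq; have ei : 0 < e^-1 by rewrite invr_gt0.
have h1 : 0 <= 1 + e by lra.
have h2 : 0 <= 1 + e^-1 by lra.
rewrite /en -2?ge0_integralZl_EFin//; try exact: measurable_integrand_en;
  try exact: integrand_en_ge0.
have hm r k : measurable_fun setT r ->
    measurable_fun (`]0%R, +oo[%classic : set R) (fun x => k%:E * ((kap x)%:E * tdiff r x))%E.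
  by move=> mr; apply: measurable_funeM; exact: measurable_integrand_en.
have hp (r : R -> R) (k x : R) : 0 <= k -> `]0%R, +oo[%classic x -> (0 <= k%:E * ((kap x)%:E * tdiff r x))%E.
  by move=> k0 x0; rewrite mule_ge0 ?lee_fin//; exact: integrand_en_ge0.
rewrite -ge0_integralD//; try exact: hm; try (by move=> x; exact: hp).
apply: ge0_le_integral => //.
- exact: integrand_en_ge0.
- by apply: measurable_integrand_en; exact: measurable_funD.
- by apply: emeasurable_funD; exact: hm.
move=> x x0; have k0 : (0 <= (kap x)%:E)%E.
  by move: x0; rewrite /= in_itv/= andbT => x0; rewrite lee_fin ltW// kap_gt0.
rewrite muleCA [X in (_ + X)%E]muleCA -ge0_muleDr ?mule_ge0 ?tdiff_ge0//.
apply: lee_wpmul2l => //; rewrite /tdiff.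
have ms (r : R -> R) : measurable_fun setT r ->
    measurable_fun setT (fun y : R => r (y + x) - r y).
  by move=> mr; apply: measurable_funB => //; exact: measurable_shift.
apply: le_trans (le_sqD e0 (ms _ mp) (ms _ mq)).
by rewrite le_eqVlt; apply/orP; left; apply/eqP; apply: eq_sq => y; ring.
Qed.

Definition prime_sum h (N : nat) : R :=
  \sum_(1 <= n < N) von_mangoldt n / Num.sqrt n%:R * (h (ln n%:R) + h (- ln n%:R)).

(** The part of W that is bounded in the sup norm once the support is fixed: the polar term minus
    the prime sum. *)
Definition regular h : R :=
  \int[mu]_x (h x * (expR (x / 2) + expR (- (x / 2)))) - limn (prime_sum h).

(** An exclusive bound: n < cutoff A exactly when n <= e^A. *)
Definition cutoff (A : R) : nat := (Num.truncn (expR A)).+1.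

Lemma prime_sum_supp (A : R) h : (forall x, A <= `|x| -> h x = 0) ->
  limn (prime_sum h) = prime_sum h (cutoff A).
Proof.
move=> hA; apply: cvg_lim => //; apply: cvg_near_cst.
near=> N; rewrite /prime_sum.
have AN : (cutoff A <= N)%N by near: N; exact: nbhs_infty_ge.
rewrite (big_cat_nat _ AN)//= [X in _ + X]big_nat_cond [X in _ + X]big1 ?addr0//.
move=> n /andP[/andP[cn _] _].
have lA : A <= ln n%:R.
  rewrite -[A]expRK ler_ln ?posrE ?expR_gt0//; last first.
    by rewrite ltr0n (leq_trans _ cn).
  apply: ltW; apply: (lt_le_trans (truncnS_gt _)).
  by rewrite ler_nat.
rewrite !hA ?addr0 ?mulr0// ?normrN (le_trans lA)//; exact: ler_norm.
Unshelve. all: by end_near. Qed.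

Definition bounded_supp (A B : R) h :=
  [/\ measurable_fun setT h, forall x, A <= `|x| -> h x = 0 & forall x, `|h x| <= B].

Definition weight (x : R) : R := expR (x / 2) + expR (- (x / 2)).

Lemma weight_ge0 x : 0 <= weight x.
Proof. by rewrite addr_ge0 ?expR_ge0. Qed.

Lemma continuous_weight : continuous weight.
Proof.
move=> x; apply: cvgD.
  apply: (@continuous_comp _ _ _ (fun y : R => y / 2) expR); last exact: continuous_expR.
  by apply: cvgM; [exact: cvg_id|exact: cvg_cst].
apply: (@continuous_comp _ _ _ (fun y : R => - (y / 2)) expR); last exact: continuous_expR.
by apply: cvgN; apply: cvgM; [exact: cvg_id|exact: cvg_cst].
Qed.

Lemma integrable_weight (A B : R) h : bounded_supp A B h ->
  mu.-integrable setT (fun x => (h x * weight x)%:E).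
Proof.
move=> [mh hA hB].
have mw : measurable_fun setT weight.
  by apply: continuous_measurableT; exact: continuous_weight.
have iw : mu.-integrable setT (fun x => ((B * weight x) * (\1_(`[- A, A]%classic) x))%:E).
  have cw : continuous (fun x => B * weight x).
    by move=> x; apply: cvgM; [exact: cvg_cst|exact: continuous_weight].
  exact: integrable_itv_indic (@continuous_integrable_itv R _ (- A) A cw).
apply: le_integrable iw => //.
  by apply/measurable_EFinP; exact: measurable_funM.
move=> x _; rewrite !abse_EFin lee_fin !normrM indicE.
have [Ax|xA] := lerP A `|x|; first by rewrite hA// normr0 mul0r !mulr_ge0.
rewrite mem_set ?normr1 ?mulr1.
  rewrite ler_wpM2r//; exact: le_trans (hB x) (ler_norm _).
by rewrite /= in_itv/=; move: xA; rewrite ltr_norml => /andP[/ltW -> /ltW ->].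
Qed.

Lemma regularE (A : R) h : (forall x, A <= `|x| -> h x = 0) ->
  regular h = \int[mu]_x (h x * weight x) - prime_sum h (cutoff A).
Proof. by move=> hA; rewrite /regular (prime_sum_supp hA). Qed.

Lemma regularD (A B1 B2 : R) h1 h2 : bounded_supp A B1 h1 -> bounded_supp A B2 h2 ->
  regular (fun x => h1 x + h2 x) = regular h1 + regular h2.
Proof.
move=> b1 b2; have [_ s1 _] := b1; have [_ s2 _] := b2.
rewrite !(@regularE A)//; last by move=> x Ax; rewrite s1// s2// addr0.
have -> : prime_sum (fun x => h1 x + h2 x) (cutoff A) =
    prime_sum h1 (cutoff A) + prime_sum h2 (cutoff A).
  rewrite /prime_sum -big_split/=; apply: eq_bigr => n _; ring.
have -> : \int[mu]_x ((h1 x + h2 x) * weight x) =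
    \int[mu]_x (h1 x * weight x) + \int[mu]_x (h2 x * weight x).
  rewrite -RintegralD//; first by apply: eq_Rintegral => x _; rewrite mulrDl.
  - exact: integrable_weight b1.
  - exact: integrable_weight b2.
ring.
Qed.

Lemma von_mangoldt_ge0 n : 0 <= von_mangoldt n :> R.
Proof.
rewrite /von_mangoldt; case: (primes n) (mem_primes ^~ n) => [|p [|]]// h.
have := h p; rewrite inE eqxx => /esym/andP[/prime_gt0 p0 _].
by rewrite ln_ge0// ler1n.
Qed.

Definition regular_bound (A : R) : R :=
  \int[mu]_(x in `[- A, A]) weight x +
  2 * \sum_(1 <= n < cutoff A) von_mangoldt n / Num.sqrt n%:R.

Lemma regular_bound_ge0 A : 0 <= regular_bound A.
Proof.
rewrite addr_ge0//; first by apply: Rintegral_ge0 => x _; exact: weight_ge0.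
rewrite mulr_ge0// sumr_ge0// => n _.
by rewrite mulr_ge0 ?von_mangoldt_ge0 ?invr_ge0 ?sqrtr_ge0.
Qed.

Lemma regular_le (A B : R) h : bounded_supp A B h ->
  `|regular h| <= regular_bound A * B.
Proof.
move=> bh; have [mh hA hB] := bh; rewrite (regularE hA) /regular_bound mulrDl.
have B0 : 0 <= B by exact: le_trans (hB 0).
apply: (le_trans (ler_normB _ _)); apply: lerD.
  have iw := integrable_weight bh.
  apply: (le_trans (le_normr_Rintegral _ iw)) => //.
  have ic : mu.-integrable `[- A, A] (EFin \o weight).
    by apply: continuous_integrable_itv; exact: continuous_weight.
  rewrite -RintegralZr// [leRHS]Rintegral_mkcond.
  apply: le_Rintegral => //.
  - by have := integrable_norm iw.
  - have cw : continuous (fun x : R => weight x * B).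
      by move=> x; apply: cvgM; [exact: continuous_weight|exact: cvg_cst].
    have := integrable_itv_indic (@continuous_integrable_itv R _ (- A) A cw).
    apply: eq_integrable => // x _.
    by rewrite /= patchE indicE; case: ifP => _; rewrite ?mulr1 ?mulr0.
  - move=> x _; rewrite patchE normrM (ger0_norm (weight_ge0 x)).
    case: ifPn => xA; first by rewrite mulrC ler_wpM2l// weight_ge0.
    rewrite hA ?normr0 ?mul0r// leNgt; apply: contraNN xA.
    by rewrite ltr_norml inE/= in_itv/= => /andP[/ltW -> /ltW ->].
rewrite [2 * _]mulrC -mulrA mulr_suml; apply: (le_trans (ler_norm_sum _ _ _)).
apply: ler_sum => n _; rewrite normrM.
have v0 : 0 <= von_mangoldt n / Num.sqrt n%:R :> R.
  by rewrite mulr_ge0 ?von_mangoldt_ge0 ?invr_ge0 ?sqrtr_ge0.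
rewrite (ger0_norm v0) ler_wpM2l//.
apply: (le_trans (ler_normD _ _)).
have := hB (ln n%:R); have := hB (- ln n%:R); lra.
Qed.

End weil_decomposition.

(** * The Weil form as an L2-bounded part plus the energy *)

Section weil_form_formula.
Context {R : realType}.
Notation mu := (@lebesgue_measure R).
Implicit Types (p q h : R -> R) (v : R -> R[i]) (a : R).

Lemma Lfun_real_L2 p : p \in Lfun mu 2%:E <-> real_L2 p.
Proof.
split.
- move=> Lp; split; first by have := sub_Lfun_mfun Lp; rewrite inE.
  by have := integrable_lty measurableT (Lfun2_integrable_sqr Lp).
move=> [mp fp]; rewrite inE; apply/andP; split; rewrite inE//=.
rewrite /finite_norm unlock poweR_lty//.
apply: le_lt_trans fp; rewrite le_eqVlt; apply/orP; left; apply/eqP.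
by apply: eq_integral => x _; rewrite /= powR_mulrn// real_normK ?num_real.
Qed.

Definition re v : R -> R := fun x => complex.Re (v x).
Definition im v : R -> R := fun x => complex.Im (v x).

Lemma L2_parts a v : L2 a v ->
  [/\ real_L2 (re v), real_L2 (im v),
     forall y, a <= `|y| -> re v y = 0 & forall y, a <= `|y| -> im v y = 0].
Proof.
move=> [/Lfun_real_L2 Lp /Lfun_real_L2 Lq v0].
have h y : a <= `|y| -> v y = 0.
  move=> ay; apply: v0; rewrite /= in_itv/= => /andP[h1 h2].
  by move: ay; rewrite leNgt ltr_norml h1 h2.
by split => // y /h; rewrite /re /im => ->.
Qed.

Lemma re_inner v : real_L2 (re v) -> real_L2 (im v) ->
  complex.Re (inner v v) = ip (re v) (re v) + ip (im v) (im v).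
Proof.
move=> Lp Lq; rewrite /inner /cintegral/= /ip -RintegralD//; try exact: integrable_mul.
apply: eq_Rintegral => x _; rewrite /re /im; case: (v x) => p q /=; ring.
Qed.

Lemma l2norm_sqr v : real_L2 (re v) -> real_L2 (im v) ->
  l2norm v ^+ 2 = ip (re v) (re v) + ip (im v) (im v).
Proof.
move=> Lp Lq; rewrite /l2norm sqr_sqrtr re_inner//.
by rewrite addr_ge0 ?ip_ge0.
Qed.

(** The products of a real with an imaginary part are purely imaginary, so the form decouples into
    two real problems. *)
Lemma re_convolution v x : real_L2 (re v) -> real_L2 (im v) ->
  complex.Re (convolution v (tilde v) x) = corr (re v) x + corr (im v) x.
Proof.
move=> Lp Lq.
have H p : real_L2 p -> corr p x = \int[mu]_y (p (x - y) * p (- y)) /\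
    mu.-integrable setT (fun y => (p (x - y) * p (- y))%:E).
  move=> L; have Ls := real_L2_shift x L; split.
    rewrite /corr -ip_reflect; [|exact: Ls.1|exact: L.1].
    by apply: eq_Rintegral => y _; rewrite [x - y]addrC.
  have := integrable_mul (real_L2_reflect Ls) (real_L2_reflect L).
  by apply: eq_integrable => // y _; rewrite [x - y]addrC.
have [-> ip_] := H _ Lp; have [-> iq_] := H _ Lq.
rewrite /convolution /cintegral/= -RintegralD//.
apply: eq_Rintegral => y _; rewrite /re /im /tilde.
by case: (v (x - y)) => p q; case: (v (- y)) => r s /=; ring.
Qed.

(** The summand 2 jsum is what the archimedean integral leaves when e^(-x/2) f(0) is replaced by
    f(0) in it; the result is the full coefficient of -f(0) once the energy is split off. *)
Definition weil_cst : R := ln (4 * pi) + euler_mascheroni + 2 * jsum.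

Definition creg p : R := regular (corr p) - weil_cst * ip p p.

Lemma integral_weil_tail p q : real_L2 p -> real_L2 q ->
  let h := fun x => corr p x + corr q x in
  (\int[mu]_(x in `]0%R, +oo[)
    ((h x + h (- x) - 2 * expR (- (x / 2)) * h 0)
        * (expR (x / 2) / (expR x - expR (- x))))%:E
   = (2 * jsum * h 0)%:E - (en p + en q))%E.
Proof.
move=> Lp Lq h.
have h0 : 0 <= h 0 by rewrite /h !corr0 addr_ge0 ?ip_ge0.
have mexp2 : measurable_fun setT (fun x : R => expR (- (x / 2))).
  by apply: measurableT_comp => //; apply: measurableT_comp => //; exact: measurable_funM.
have mI : measurable (`]0, +oo[%classic : set (measurableTypeR R)) by exact: measurable_itv.
(* The integrand is F - G: F is integrable and yields the constant, while G is the energy density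
   and may have infinite integral. *)
pose F x := (2 * h 0) * ((1 - expR (- (x / 2))) * kap x).
pose G x := kap x * (2 * (h 0 - h x)).
have mF0 : measurable_fun (`]0, +oo[%classic : set R) (fun x => (1 - expR (- (x / 2))) * kap x).
  apply: measurable_funM; last exact: measurable_kap.
  by apply: measurable_funTS; exact: measurable_funB.
have mF : measurable_fun (`]0, +oo[%classic : set R) F by exact: measurable_funM.
have mh : measurable_fun setT h.
  by apply: measurable_funD; exact: measurable_corr.
have mG : measurable_fun (`]0, +oo[%classic : set R) G.
  apply: measurable_funM; first exact: measurable_kap.
  by apply: measurable_funTS; apply: measurable_funM => //; exact: measurable_funB.
have F00 (x : R) : `]0, +oo[%classic x -> 0 <= (1 - expR (- (x / 2))) * kap x.
  rewrite /= in_itv/= andbT => x0; rewrite mulr_ge0 ?(ltW (kap_gt0 x0))//.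
  by rewrite subr_ge0 expR_le1; lra.
have IF : (\int[mu]_(x in `]0%R, +oo[) (F x)%:E = (2 * jsum * h 0)%:E)%E.
  under eq_integral do rewrite EFinM.
  rewrite ge0_integralZl_EFin//.
  - by rewrite integral_jsum -EFinM; congr EFin; ring.
  - exact/measurable_EFinP.
  - by rewrite mulr_ge0.
have IG : (\int[mu]_(x in `]0%R, +oo[) (G x)%:E = en p + en q)%E.
  rewrite /en -ge0_integralD//; try exact: integrand_en_ge0;
    try (apply: measurable_integrand_en; by [exact: Lp.1|exact: Lq.1]).
  apply: eq_integral => x _; rewrite !tdiffE// -!EFinM -EFinD; congr EFin.
  by rewrite /G /h; ring.
rewrite -IF -IG -integral_sub_ge0//.
- apply: eq_integral => x _; congr EFin; rewrite -/(kap x) /F /G.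
  have -> : h (- x) = h x by rewrite /h !corrN.
  ring.
- by move=> x x0; rewrite mulr_ge0 ?F00// mulr_ge0.
- move=> x; rewrite /= in_itv/= andbT => x0; rewrite mulr_ge0 ?(ltW (kap_gt0 x0))//.
  rewrite mulr_ge0// subr_ge0 /h; apply: lerD.
    by rewrite corr0; exact: le_trans (ler_norm _) (corr_le x Lp).
  by rewrite corr0; exact: le_trans (ler_norm _) (corr_le x Lq).
- by rewrite IF ltry.
Qed.

Lemma bounded_supp_corr a p : real_L2 p -> (forall y, a <= `|y| -> p y = 0) ->
  bounded_supp (2 * a) (ip p p) (corr p).
Proof.
move=> Lp pa; split.
- exact: measurable_corr.
- by move=> x; exact: corr_supp.
- by move=> x; exact: corr_le.
Qed.

Lemma QWE a v : L2 a v ->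
  QW v = ((creg (re v) + creg (im v))%:E + (en (re v) + en (im v)))%E.
Proof.
move=> /L2_parts[Lp Lq sp sq_].
rewrite /QW; have -> : (fun x => complex.Re (convolution v (tilde v) x)) =
    (fun x => corr (re v) x + corr (im v) x).
  by apply/funext => x; rewrite re_convolution.
rewrite /weil integral_weil_tail//.
have bp := bounded_supp_corr Lp sp; have bq := bounded_supp_corr Lq sq_.
have := regularD bp bq; rewrite {1}/regular => ->.
have : (0 <= en (re v) + en (im v))%E by rewrite adde_ge0 ?en_ge0.
case: (en (re v) + en (im v))%E => [e| |]//= _.
rewrite -!EFinB -EFinD; congr EFin.
by rewrite /creg /weil_cst !corr0; ring.
Qed.

Lemma creg_le a p : real_L2 p -> (forall y, a <= `|y| -> p y = 0) ->
  `|creg p| <= (regular_bound (2 * a) + `|weil_cst|) * ip p p.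
Proof.
move=> Lp sp; rewrite /creg [leRHS]mulrDl.
apply: (le_trans (ler_normB _ _)); apply: lerD.
  exact: regular_le (bounded_supp_corr Lp sp).
by rewrite normrM (ger0_norm (ip_ge0 _)).
Qed.

(** [creg] is quadratic in p but linear in [corr p], so the uniform bound of [corrB_le] controls its
    variation. *)
Lemma cregB_le a (e : R) p q : 0 < e -> real_L2 p -> real_L2 q ->
  (forall y, a <= `|y| -> p y = 0) -> (forall y, a <= `|y| -> q y = 0) ->
  `|creg p - creg q| <= (regular_bound (2 * a) + `|weil_cst|) *
    ((e * (ip p p + ip q q)) / 2 +
     e^-1 * ip (fun y => p y - q y) (fun y => p y - q y)).
Proof.
move=> e0 Lp Lq sp sq_.
set B := (X in _ <= _ * X).
have hB x : `|corr p x - corr q x| <= B by exact: corrB_le.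
have bp := bounded_supp_corr Lp sp; have bq := bounded_supp_corr Lq sq_.
have bN : bounded_supp (2 * a) (ip q q) (fun x => - corr q x).
  have [h1 h2 h3] := bq; split.
  - exact: measurableT_comp.
  - by move=> x /h2 ->; rewrite oppr0.
  - by move=> x; rewrite normrN.
have bd : bounded_supp (2 * a) B (fun x => corr p x - corr q x).
  have [h1 h2 _] := bp; have [h3 h4 _] := bN; split => //.
  - exact: measurable_funD.
  - by move=> x ax; rewrite h2// h4// addr0.
have Ed : regular (fun x => corr p x - corr q x) = regular (corr p) - regular (corr q).
  have := regularD bd bq; under [X in regular X]eq_fun do rewrite subrK.
  by move=> ->; rewrite addrK.
have -> : creg p - creg q = regular (fun x => corr p x - corr q x) -
    weil_cst * (corr p 0 - corr q 0).
  by rewrite Ed /creg !corr0; ring.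
rewrite [leRHS]mulrDl; apply: (le_trans (ler_normB _ _)); apply: lerD.
  exact: regular_le.
by rewrite normrM ler_wpM2l.
Qed.

End weil_form_formula.

(** * Smooth functions and convolutions *)

Section smooth_functions.
Context {R : realType}.
Notation mu := (@lebesgue_measure R).
Implicit Types (f g psi : R -> R).

(** Coinduction for smoothness: it replaces formulas for higher derivatives by closure of a class
    under one derivative. *)
Lemma smooth_class (S : (R -> R) -> Prop) :
  (forall f, S f -> exists2 g, S g & forall x, is_derive x (1 : R) f (g x)) ->
  forall f, S f -> smooth_real f.
Proof.
move=> HS f Sf.
have key n : S (derive1n n f).
  elim: n => [//|n /HS[g Sg gE]]; rewrite derive1nS.
  suff -> : derive1 (derive1n n f) = g by [].
  by apply/funext => x; exact: is_derive_derive1.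
by move=> n x; have [g _ /(_ x)[]] := HS _ (key n).
Qed.

Lemma smooth_is_derive f : smooth_real f ->
  forall x, is_derive x (1 : R) f (derive1 f x).
Proof. by move=> sf x; apply: is_derive_deriv1; exact: (sf 0%N). Qed.

Lemma smooth_derive1 f : smooth_real f -> smooth_real (derive1 f).
Proof. by move=> sf n x; have := sf n.+1 x; rewrite /derive1n iterSr. Qed.

Lemma smooth_continuous f : smooth_real f -> continuous f.
Proof. by move=> sf x; exact: is_derive_cont (smooth_is_derive sf x). Qed.

(** Meant for points where a function is pasted together, such as the edge of a bump; one estimate
    covers both sides. *)
Lemma is_derive0_quadratic f (x C : R) :
  (forall y, `|f y - f x| <= C * (y - x) ^+ 2) -> is_derive x (1 : R) f 0.
Proof.
move=> H; apply/is_derive1_caratheodory.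
exists (fun z => (f z - f x) / (z - x)); split.
- move=> z; have [->|zx] := eqVneq z x; first by rewrite !subrr mulr0.
  by rewrite divfK// subr_eq0.
- have E0 : (f x - f x) / (x - x) = 0 by rewrite subrr mul0r.
  rewrite /prop_for /continuous_at E0; apply/cvgr0Pnorm_le => e e0.
  have C0 : 0 <= C.
    have := H (x + 1); rewrite [x + 1]addrC addrK expr1n mulr1.
    exact: le_trans.
  near=> z.
  have [->|zx] := eqVneq z x; first by rewrite !subrr mul0r normr0 ltW.
  rewrite normrM normfV ler_pdivrMr ?normr_gt0 ?subr_eq0//.
  apply: (le_trans (H z)); rewrite -[X in C * X]real_normK ?num_real// expr2 mulrA.
  rewrite ler_wpM2r//.
  have : `|z - x| <= e / (C + 1).
    by rewrite distrC; near: z; apply: cvgr_dist_le => //; rewrite divr_gt0// ltr_wpDl.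
  rewrite ler_pdivlMr; last by rewrite ltr_wpDl.
  have := normr_ge0 (z - x); nra.
- by rewrite subrr mul0r.
Unshelve. all: by end_near. Qed.

End smooth_functions.

(** * A smooth bump on (0, 1) *)

Section bump.
Context {R : realType}.
Notation mu := (@lebesgue_measure R).

Definition bump_wt (x : R) : R := x * (1 - x).

(** The factors P and w^(-k) make the family stable under differentiation; the bump itself is
    [bump_fun 1 0]. *)
Definition bump_fun (P : {poly R}) (k : nat) (x : R) : R :=
  if 0 < bump_wt x then P.[x] * (bump_wt x) ^- k * expR (- (bump_wt x)^-1) else 0.

Lemma horner_bound (P : {poly R}) : exists2 M : R, 0 <= M &
  forall x : R, 0 <= x -> x <= 1 -> `|P.[x]| <= M.
Proof.
have [|c _ cmax] := @EVT_max R (fun x => `|P.[x]|) 0 1 ler01.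
  apply: continuous_subspaceT => x.
  apply: (@continuous_comp _ _ _ (horner P) (@Num.norm _ R)); first exact: continuous_horner.
  exact: norm_continuous.
exists `|P.[c]| => // x x0 x1; apply: cmax.
by rewrite in_itv/= x0 x1.
Qed.

Lemma bump_wt_gt0 x : 0 < bump_wt x -> 0 < x /\ x < 1.
Proof. rewrite /bump_wt => h; split; nra. Qed.

(** With n = k + 2, the bound e^(1/w) >= (1/(n w))^n beats w^(-k) by two powers of w, and w(y) <= |y
    - x| on the bump when w(x) <= 0. Hence the function is quadratically small at x. *)
Lemma bump_fun_flat P k (x : R) : bump_wt x <= 0 -> is_derive x (1 : R) (bump_fun P k) 0.
Proof.
move=> wx; have [M M0 PM] := horner_bound P.
have [n nE] : exists n, n = k.+2 by exists k.+2.
have n0 : 0 < n%:R :> R by rewrite nE ltr0n.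
apply: (@is_derive0_quadratic _ _ _ (M * n%:R ^+ n)) => y.
rewrite {2}/bump_fun ltNge wx/= subr0 /bump_fun.
have cst0 : 0 <= M * n%:R ^+ n by rewrite mulr_ge0 ?exprn_ge0// ltW.
case: ifPn => wy; last by rewrite normr0 mulr_ge0 ?sqr_ge0.
have [y0 y1] := bump_wt_gt0 wy.
have wyx : bump_wt y ^+ 2 <= (y - x) ^+ 2.
  have [x0|x0] := lerP x 0.
    have h : bump_wt y <= y - x by rewrite /bump_wt; nra.
    by rewrite lerXn2r ?nnegrE// ltW// (lt_le_trans wy).
  have x1 : 1 <= x by move: wx; rewrite /bump_wt; nra.
  have h : bump_wt y <= x - y by rewrite /bump_wt; nra.
  by rewrite -[leRHS]sqrrN opprB lerXn2r ?nnegrE// ltW// (lt_le_trans wy).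
apply: (@le_trans _ _ (M * n%:R ^+ n * bump_wt y ^+ 2)); last by rewrite ler_wpM2l.
set w := bump_wt y in wy *.
rewrite !normrM (ger0_norm (expR_ge0 _)) -!mulrA; apply: ler_pM => //.
- by apply: PM; apply: ltW.
rewrite gtr0_norm ?invr_gt0 ?exprn_gt0//.
have wp : 0 < n%:R * w by exact: mulr_gt0.
rewrite ler_pdivrMl ?exprn_gt0// mulrCA -exprD addn2 -nE -exprMn.
rewrite expRN -[leRHS]invrK lef_pV2 ?posrE ?expR_gt0 ?invr_gt0 ?exprn_gt0//.
have -> : w^-1 = n%:R * (n%:R * w)^-1 by field; rewrite !gt_eqF.
rewrite -[X in X <= _]exprVn expRM_natl lerXn2r ?nnegrE ?expR_ge0 ?invr_ge0 ?(ltW wp)//.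
have := expR_ge1Dx (n%:R * w)^-1; lra.
Qed.

Lemma bump_fun_derive P k : exists Q, forall x : R,
  is_derive x (1 : R) (bump_fun P k) (bump_fun Q k.+2 x).
Proof.
have [W WE] : exists W : {poly R}, forall x, W.[x] = bump_wt x.
  by exists ('X * (1 - 'X)) => x; rewrite !hornerE.
(* The product rule, brought over the common denominator w^(k+2). *)
exists (P^`() * W ^+ 2 - (P * W * W^`()) *+ k + P * W^`()) => x.
have [wx|wx] := lerP (bump_wt x) 0.
  by rewrite /bump_fun [X in is_derive _ _ _ X]ifF ?ltNge ?wx//; exact: bump_fun_flat.
have dW : is_derive x (1 : R) bump_wt (W^`().[x]).
  have := is_derive_poly W x.
  by have -> : horner W = bump_wt by apply/funext => y; exact: WE.
have dP : is_derive x (1 : R) (horner P) (P^`().[x]) by exact: is_derive_poly.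
have w0 : bump_wt x != 0 by rewrite gt_eqF.
have dI : is_derive x (1 : R) (fun y => (bump_wt y)^-1) (- (bump_wt x) ^- 2 * W^`().[x]).
  have := is_deriveV (f := bump_wt) w0 dW.
  by rewrite /GRing.scale/=.
apply: (@near_eq_is_derive _ _ _
  (fun y => P.[y] * ((bump_wt y)^-1) ^+ k * expR (- (bump_wt y)^-1))).
  near=> y; rewrite /bump_fun.
  have -> : 0 < bump_wt y by near: y; exact: (cvgr_gt _ (is_derive_cont dW)).
  by rewrite exprVn.
have dk := is_derive_pow k dI.
have dE := is_derive_expR_comp (is_derive_opp dI).
apply: is_derive_eq (is_derive_mul (is_derive_mul dP dk) dE) _.
rewrite /bump_fun wx.
rewrite !(hornerD, hornerN, hornerM, hornerMn, horner_exp, WE) -[in RHS]mulr_natl.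
case: k {dk} => [|k]; first by rewrite !expr0 !mulr0n mul0r; field.
rewrite -[k.+1.-1]/k -!exprVn -mulr_natl !exprS.
by field.
Unshelve. all: by end_near. Qed.

Lemma smooth_bump P k : smooth_real (bump_fun P k).
Proof.
apply: (@smooth_class _ (fun f => exists P k, f = bump_fun P k)); last by exists P, k.
move=> _ [P' [k' ->]]; have [Q HQ] := bump_fun_derive P' k'.
by exists (bump_fun Q k'.+2) => //; exists Q, k'.+2.
Qed.

End bump.

(** * Compactly supported functions and convolution with them *)

Section convolution.
Context {R : realType}.
Notation mu := (@lebesgue_measure R).
Implicit Types (f g psi u w : R -> R).

Definition supp_in (b : R) f := forall x, b <= `|x| -> f x = 0.

Definition csmooth psi := smooth_real psi /\ exists b, supp_in b psi.

Lemma smooth_scale psi (c s : R) : smooth_real psi ->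
  smooth_real (fun x => c * psi (s * x)).
Proof.
move=> sp.
apply: (@smooth_class _ (fun f => exists c g, smooth_real g /\ f = (fun x => c * g (s * x)))).
  move=> _ [c' [g [sg ->]]]; exists (fun x => (c' * s) * derive1 g (s * x)).
    by exists (c' * s), (derive1 g); split; [exact: (smooth_derive1 sg)|].
  move=> x.
  have ds : is_derive x (1 : R) (fun y => s * y) s.
    by have := is_derive_scale s (is_derive_id x (1 : R)); rewrite mulr1.
  apply: is_derive_eq (is_derive_scale c' (is_derive_compo (smooth_is_derive sg (s * x)) ds)) _.
  by ring.
by exists c, psi.
Qed.

(** The radius grows so that psi vanishes in a whole neighbourhood of every point considered. *)
Lemma supp_in_derive1 b b' psi : smooth_real psi -> b < b' ->
  supp_in b psi -> supp_in b' (derive1 psi).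
Proof.
move=> sp bb' sb x bx.
apply: is_derive_derive1.
apply: (near_eq_is_derive _ (is_derive_cst (0 : R) x 1)).
near=> y; rewrite sb//.
have : `|x - y| < b' - b.
  by near: y; apply: cvgr_dist_lt => //; rewrite subr_gt0.
have := ler_normD (x - y) y; rewrite subrK; lra.
Unshelve. all: by end_near. Qed.

Lemma csmooth_derive1 psi : csmooth psi -> csmooth (derive1 psi).
Proof.
move=> [sp [b sb]]; split; first exact: smooth_derive1.
by exists (b + 1); apply: supp_in_derive1 sb => //; rewrite ltrDl.
Qed.

Lemma continuous_supp_bounded f b : continuous f -> supp_in b f ->
  exists2 M, 0 <= M & forall x, `|f x| <= M.
Proof.
move=> cf sb.
have [b0|b0] := lerP b 0.
  by exists 0 => // x; rewrite sb ?normr0//; exact: le_trans b0 _.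
have bb : - b <= b by lra.
have [|c _ cmax] := @EVT_max R (fun x => `|f x|) (- b) b bb.
  apply: continuous_subspaceT => x.
  apply: (@continuous_comp _ _ _ f (@Num.norm _ R)); first exact: cf.
  exact: norm_continuous.
exists `|f c| => // x; have [bx|xb] := lerP b `|x|; first by rewrite sb// normr0.
by apply: cmax; rewrite in_itv/=; move: xb; rewrite ltr_norml => /andP[/ltW -> /ltW ->].
Qed.

Lemma csmooth_bounded psi : csmooth psi -> exists2 M, 0 <= M & forall x, `|psi x| <= M.
Proof.
by move=> [sp [b sb]]; apply: continuous_supp_bounded sb; exact: smooth_continuous.
Qed.

Lemma smooth_measurable psi : smooth_real psi -> measurable_fun setT psi.
Proof. by move=> sp; apply: continuous_measurableT; exact: smooth_continuous. Qed.

Lemma supp_itv b f x : supp_in b f -> f x = f x * \1_(`[- b, b]%classic) x.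
Proof.
move=> sb; rewrite indicE; have [bx|xb] := lerP b `|x|; first by rewrite sb// mul0r.
rewrite mem_set ?mulr1// /= in_itv/=.
by move: xb; rewrite ltr_norml => /andP[/ltW -> /ltW ->].
Qed.

Lemma bounded_supp_integrable f b M : measurable_fun setT f -> supp_in b f ->
  (forall x, `|f x| <= M) -> mu.-integrable setT (EFin \o f).
Proof.
move=> mf sb fM.
have iM : mu.-integrable setT (fun x => (M * \1_(`[- b, b]%classic) x)%:E).
  have cM : continuous (fun _ : R => M) by move=> x; exact: cvg_cst.
  exact: integrable_itv_indic (@continuous_integrable_itv R _ (- b) b cM).
apply: le_integrable iM => //; first exact/measurable_EFinP.
move=> x _; rewrite /= lee_fin (supp_itv x sb) !normrM ler_wpM2r//.
exact: le_trans (fM x) (ler_norm _).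
Qed.

Lemma continuous_supp_integrable f b : continuous f -> supp_in b f ->
  mu.-integrable setT (EFin \o f).
Proof.
move=> cf sb; have [M _ fM] := continuous_supp_bounded cf sb.
by apply: bounded_supp_integrable sb fM; exact: continuous_measurableT.
Qed.

Lemma csmooth_integrable psi : csmooth psi -> mu.-integrable setT (EFin \o psi).
Proof.
by move=> [sp [b sb]]; apply: continuous_supp_integrable sb; exact: smooth_continuous.
Qed.

Lemma csmooth_real_L2 psi : csmooth psi -> real_L2 psi.
Proof.
move=> cp; have [sp [b sb]] := cp; split; first exact: smooth_measurable.
have [M M0 pM] := csmooth_bounded cp.
have h : mu.-integrable setT (EFin \o (fun x => psi x ^+ 2)).
  apply: (@bounded_supp_integrable _ b (M ^+ 2)).
  - by apply: measurable_funX; exact: smooth_measurable.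
  - by move=> x /sb ->; rewrite expr0n.
  - by move=> x; rewrite normrX lerXn2r ?nnegrE.
exact: (integrable_lty measurableT h).
Qed.

Lemma integrable_real_L2 u b : real_L2 u -> supp_in b u -> mu.-integrable setT (EFin \o u).
Proof.
move=> Lu sb.
have i1 : mu.-integrable setT (fun x => (1 * \1_(`[- b, b]%classic) x : R)%:E).
  have cM : continuous (fun _ : R => (1 : R)) by move=> x; exact: cvg_cst.
  exact: integrable_itv_indic (@continuous_integrable_itv R _ (- b) b cM).
apply: le_integrable (integrableD measurableT (integrable_sqr Lu) i1) => //.
  by apply/measurable_EFinP; exact: Lu.1.
move=> x _; rewrite -EFinD !abse_EFin lee_fin indicE mul1r.
rewrite [leRHS]ger0_norm ?addr_ge0 ?sqr_ge0//.
have [bx|xb] := lerP b `|x|; first by rewrite sb// normr0 addr_ge0 ?sqr_ge0.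
rewrite mem_set.
  rewrite -(real_normK (num_real (u x))) -[true%:R]/(1 : R).
  have := sqr_ge0 (`|u x| - 1); nra.
by rewrite /= in_itv/=; move: xb; rewrite ltr_norml => /andP[/ltW -> /ltW ->].
Qed.

Definition convol u psi (x : R) : R := \int[mu]_z (u z * psi (x - z)).

Lemma integrable_conv u psi (x : R) : mu.-integrable setT (EFin \o u) ->
  measurable_fun setT psi -> (exists2 M, 0 <= M & forall y, `|psi y| <= M) ->
  mu.-integrable setT (EFin \o (fun z => u z * psi (x - z))).
Proof.
move=> iu mpsi [M M0 pM].
have mu_ : measurable_fun setT u by apply/measurable_EFinP; exact: measurable_int iu.
apply: le_integrable (integrableZl measurableT M iu) => //.
  apply/measurable_EFinP; apply: measurable_funM => //.
  by apply: measurableT_comp => //; exact: measurable_funB.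
move=> z _; rewrite /= lee_fin !normrM mulrC ler_wpM2r//.
exact: le_trans (pM _) (ler_norm _).
Qed.

(** The derivative falls on psi, whose derivative is bounded by some M, so M |u| dominates and u
    need only be integrable. *)
Lemma is_derive_conv u psi (x : R) : mu.-integrable setT (EFin \o u) -> csmooth psi ->
  is_derive x (1 : R) (convol u psi) (convol u (derive1 psi) x).
Proof.
move=> iu cp; have cd := csmooth_derive1 cp.
have [M M0 dM] := csmooth_bounded cd.
have d1 (z y : R) : is_derive y (1 : R) (fun t => u z * psi (t - z)) (u z * derive1 psi (y - z)).
  apply: is_derive_scale.
  have ds := is_derive_sub (is_derive_id y (1 : R)) (is_derive_cst z y 1).
  have := is_derive_compo (g := fun t => t - z) (smooth_is_derive cp.1 (y - z)) ds.
  by rewrite subr0 mulr1.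
have xI : `](x - 1), (x + 1)[%classic x by rewrite /= in_itv/=; lra.
have H1 (y : R) : `](x - 1), (x + 1)[%classic y ->
    mu.-integrable setT (EFin \o (fun z => u z * psi (y - z))).
  move=> _; apply: integrable_conv => //; first exact: smooth_measurable cp.1.
  exact: csmooth_bounded.
have H2 (y z : R) : `](x - 1), (x + 1)[%classic y -> setT z ->
    derivable (fun t => u z * psi (t - z)) y 1.
  by move=> _ _; case: (d1 z y).
have G0 (z : R) : 0 <= M * `|u z| by rewrite mulr_ge0.
have iG : mu.-integrable setT (EFin \o (fun z => M * `|u z|)).
  exact: (integrableZl measurableT M (integrable_norm iu)).
have GM (y z : R) : `](x - 1), (x + 1)[%classic y -> setT z ->
    `|partial1of2 (fun t z => u z * psi (t - z)) y z| <= M * `|u z|.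
  move=> _ _; rewrite /partial1of2 (is_derive_derive1 (d1 z y)) normrM mulrC.
  by rewrite ler_wpM2r.
have D1 := @derivable_under_integral R _ _ mu (fun t z => u z * psi (t - z)) setT
  measurableT x (x - 1) (x + 1) xI H1 H2 _ G0 iG GM.
have D2 := @differentiation_under_integral R _ _ mu (fun t z => u z * psi (t - z)) setT
  measurableT x (x - 1) (x + 1) xI H1 H2 _ G0 iG GM.
apply: is_derive_eq (is_derive_deriv1 D1) _.
rewrite -/(convol u psi) in D2; rewrite D2.
by apply: eq_Rintegral => z _; rewrite /partial1of2 (is_derive_derive1 (d1 z x)).
Qed.

Lemma smooth_conv u psi : mu.-integrable setT (EFin \o u) -> csmooth psi ->
  smooth_real (convol u psi).
Proof.
move=> iu cp.
apply: (@smooth_class _ (fun f => exists2 psi, csmooth psi & f = convol u psi)).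
  move=> _ [q cq ->]; exists (convol u (derive1 q)).
    by exists (derive1 q) => //; exact: csmooth_derive1.
  by move=> x; exact: is_derive_conv.
by exists psi.
Qed.

Lemma conv_supp u psi (A d : R) : supp_in A u ->
  supp_in d psi -> supp_in (A + d) (convol u psi).
Proof.
move=> su sd x Ax; rewrite /convol /Rintegral integral0_eq// => z _.
have [/su ->|zA] := lerP A `|z|; first by rewrite mul0r.
rewrite sd ?mulr0//; have := ler_normD (x - z) z; rewrite subrK; lra.
Qed.

Lemma convE u psi (x : R) : measurable_fun setT u -> measurable_fun setT psi ->
  convol u psi x = \int[mu]_y (psi y * u (x - y)).
Proof.
move=> mu_ mpsi; rewrite /convol /Rintegral.
rewrite -(@integral_reflection_translation R x (fun y => (psi y * u (x - y))%:E)).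
  by congr fine; apply: eq_integral => z _; rewrite subKr mulrC.
apply/measurable_EFinP; apply: measurable_funM => //.
by apply: measurableT_comp => //; exact: measurable_funB.
Qed.

End convolution.

(** * Mollification and density of test functions *)

Section mollifier.
Context {R : realType}.
Notation mu := (@lebesgue_measure R).
Implicit Types (f g psi u w : R -> R).

Lemma bump0_ge0 (x : R) : 0 <= bump_fun 1 0 x.
Proof.
rewrite /bump_fun; case: ifP => // _.
by rewrite hornerC expr0 invr1 !mul1r expR_ge0.
Qed.

Lemma bump0_supp (x : R) : ~~ (0 < x < 1) -> bump_fun 1 0 x = 0.
Proof.
move=> h; rewrite /bump_fun; case: ifPn => // /bump_wt_gt0[h1 h2].
by move: h; rewrite h1 h2.
Qed.

Lemma csmooth_bump0 : csmooth (bump_fun (1 : {poly R}) 0).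
Proof.
split; first exact: smooth_bump.
exists 1 => x x1; apply: bump0_supp; apply/negP => /andP[x0 x2].
by move: x1; rewrite gtr0_norm//; lra.
Qed.

Definition bump_mass : R := \int[mu]_x bump_fun 1 0 x.

Lemma bump_mass_gt0 : 0 < bump_mass.
Proof.
have i0 := csmooth_integrable csmooth_bump0.
(* 3/16 is the minimum of x (1 - x) on [1/4, 3/4]. *)
set c := expR (- (3 / 16)^-1) : R.
have ci : mu.-integrable setT (EFin \o (fun x : R => c * \1_(`[1 / 4, 3 / 4]%classic) x)).
  have cc : continuous (fun _ : R => c) by move=> x; exact: cvg_cst.
  exact: integrable_itv_indic (@continuous_integrable_itv R _ (1 / 4) (3 / 4) cc).
apply: (@lt_le_trans _ _ (\int[mu]_x (c * \1_(`[1 / 4, 3 / 4]%classic) x))); last first.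
  apply: le_Rintegral => // x _; rewrite indicE.
  have [xI|xI] := boolP (x \in `[1 / 4, 3 / 4]%classic); last by rewrite mulr0 bump0_ge0.
  move: xI; rewrite inE/= in_itv/= => /andP[x1 x2].
  have w : 3 / 16 <= bump_wt x by rewrite /bump_wt; nra.
  rewrite mulr1 /bump_fun ifT; last by lra.
  rewrite hornerC expr0 invr1 !mul1r ler_expR lerN2 lef_pV2 ?posrE; lra.
rewrite (_ : \int[mu]_x _ = c * \int[mu]_x (\1_(`[1 / 4, 3 / 4]%classic) x)); last first.
  by rewrite RintegralZl//; exact: integrable_indic_itv.
rewrite mulr_gt0 ?expR_gt0// /Rintegral integral_indic// setIT.
suff H : 0 < fine (lebesgue_measure (`[1 / 4, 3 / 4]%classic : set R)) by exact: H.
by rewrite lebesgue_measure_itv/= lte_fin ifT/=; lra.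
Qed.

(** The mollifier lives on (0, d), on one side of 0, so averages against it involve only positive
    translations, the ones that enter the energy. *)
Definition rho (d x : R) : R := (bump_mass * d)^-1 * bump_fun 1 0 (d^-1 * x).

Lemma rho_ge0 d x : 0 < d -> 0 <= rho d x.
Proof.
by move=> d0; rewrite mulr_ge0 ?bump0_ge0// invr_ge0 ltW// mulr_gt0 ?bump_mass_gt0.
Qed.

Lemma rho_supp d x : 0 < d -> ~~ (0 < x < d) -> rho d x = 0.
Proof.
move=> d0 h; rewrite /rho bump0_supp ?mulr0//; apply: contraNN h.
by rewrite [_ * x]mulrC ltr_pdivrMr// mul1r pmulr_lgt0 ?invr_gt0.
Qed.

Lemma rho_supp_in d : 0 < d -> supp_in d (rho d).
Proof.
move=> d0 x dx; apply: rho_supp => //; apply/negP => /andP[x0 xd].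
by move: dx; rewrite gtr0_norm//; lra.
Qed.

Lemma csmooth_rho d : 0 < d -> csmooth (rho d).
Proof.
move=> d0; split; first by apply: smooth_scale; exact: smooth_bump.
by exists d; exact: rho_supp_in.
Qed.

Lemma rho_le : exists2 M : R, 0 < M & forall d x, 0 < d -> rho d x <= M / d.
Proof.
have [M M0 bM] := csmooth_bounded csmooth_bump0.
exists (bump_mass^-1 * (M + 1)).
  by rewrite mulr_gt0 ?invr_gt0 ?bump_mass_gt0// ltr_wpDl.
move=> d x d0; rewrite /rho invfM mulrAC ler_wpM2r ?invr_ge0 ?(ltW d0)//.
rewrite ler_wpM2l ?invr_ge0 ?(ltW bump_mass_gt0)//.
by apply: (le_trans (ler_norm _)); apply: (le_trans (bM _)); lra.
Qed.

Lemma rho_mass d : 0 < d -> \int[mu]_x rho d x = 1.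
Proof.
move=> d0; rewrite /rho.
have m0 := bump_mass_gt0.
have c0 : 0 <= (bump_mass * d)^-1 by rewrite invr_ge0 ltW// mulr_gt0.
have mb : measurable_fun setT (bump_fun (1 : {poly R}) 0).
  exact: smooth_measurable csmooth_bump0.1.
rewrite /Rintegral; under eq_integral do rewrite EFinM.
rewrite ge0_integralZl_EFin//; last 2 first.
- by move=> x _; rewrite lee_fin bump0_ge0.
- by apply/measurable_EFinP; apply: measurableT_comp => //; exact: measurable_funM.
have mE : measurable_fun setT (fun x => (bump_fun (1 : {poly R}) 0 x)%:E).
  exact/measurable_EFinP.
have di : 0 < d^-1 by rewrite invr_gt0.
have b0 (x : R) : (0 <= (bump_fun 1 0 x)%:E)%E by rewrite lee_fin bump0_ge0.
have -> : (\int[mu]_x (bump_fun 1 0 (d^-1 * x))%:E = d%:E * \int[mu]_x (bump_fun 1 0 x)%:E)%E.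
  have := ge0_integral_affine 0 di mE b0; rewrite invrK => <-.
  by apply: eq_integral => x _; rewrite addr0.
have -> : (\int[mu]_x (bump_fun 1 0 x)%:E = bump_mass%:E)%E.
  rewrite /bump_mass /Rintegral fineK//; apply: integrable_fin_num => //.
  exact: csmooth_integrable csmooth_bump0.
by rewrite -!EFinM/=; field; rewrite !gt_eqF.
Qed.

(** The variance of F under the probability density r is nonnegative; when the right side is
    infinite the claim is void. *)
Lemma jensen_sqr (r F : R -> R) : (forall x, 0 <= r x) ->
  mu.-integrable setT (EFin \o r) -> \int[mu]_x r x = 1 ->
  measurable_fun setT F -> mu.-integrable setT (EFin \o (fun x => r x * F x)) ->
  (((\int[mu]_x (r x * F x)) ^+ 2)%:E <= \int[mu]_x (r x * F x ^+ 2)%:E)%E.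
Proof.
move=> r0 ir r1 mF iF.
have mr : measurable_fun setT r by apply/measurable_EFinP; exact: measurable_int ir.
have mF2 : measurable_fun setT (fun x => r x * F x ^+ 2).
  by apply: measurable_funM => //; exact: measurable_funX.
have F20 : (0 <= \int[mu]_x (r x * F x ^+ 2)%:E)%E.
  by apply: integral_ge0 => x _; rewrite lee_fin mulr_ge0 ?sqr_ge0.
have [Foo|] := ltP (\int[mu]_x (r x * F x ^+ 2)%:E)%E +oo%E; last first.
  by rewrite leye_eq => /eqP ->; rewrite leey.
have iF2 : mu.-integrable setT (EFin \o (fun x => r x * F x ^+ 2)).
  apply/integrableP; split; first exact/measurable_EFinP.
  have -> : (\int[mu]_x `|(r x * F x ^+ 2)%:E| = \int[mu]_x (r x * F x ^+ 2)%:E)%E.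
    apply: eq_integral => x _; rewrite gee0_abs// lee_fin.
    exact: mulr_ge0 (r0 x) (sqr_ge0 (F x)).
  exact: Foo.
set m := \int[mu]_x (r x * F x).
rewrite -[leRHS]fineK ?ge0_fin_numE// lee_fin -/(Rintegral _ _ _).
have h : 0 <= \int[mu]_x (r x * F x ^+ 2 - 2 * m * (r x * F x) + m ^+ 2 * r x).
  apply: Rintegral_ge0 => x _.
  have -> : r x * F x ^+ 2 - 2 * m * (r x * F x) + m ^+ 2 * r x = r x * (F x - m) ^+ 2 by ring.
  by rewrite mulr_ge0 ?sqr_ge0.
have i1 : mu.-integrable setT (EFin \o (fun x => 2 * m * (r x * F x))).
  exact: (integrableZl measurableT (2 * m) iF).
have i2 : mu.-integrable setT (EFin \o (fun x => m ^+ 2 * r x)).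
  exact: (integrableZl measurableT (m ^+ 2) ir).
have i3 : mu.-integrable setT (EFin \o (fun x => r x * F x ^+ 2 - 2 * m * (r x * F x))).
  exact: (integrableB measurableT iF2 i1).
move: h; rewrite RintegralD// RintegralB// RintegralZl// RintegralZl// r1 -/m.
lra.
Qed.

Lemma measurable_diff2 u : measurable_fun setT u ->
  measurable_fun setT (fun z : R * R => u (z.1 - z.2)).
Proof. by move=> mu_; apply: measurableT_comp => //; exact: measurable_funB. Qed.

Lemma integrable_rho_comp d w (x : R) : 0 < d -> mu.-integrable setT (EFin \o w) ->
  mu.-integrable setT (EFin \o (fun y => rho d y * w (x - y))).
Proof.
move=> d0 iw; have cr := csmooth_rho d0; have mr := smooth_measurable cr.1.
have [M M0 rM] := csmooth_bounded cr.
have mw : measurable_fun setT w by apply/measurable_EFinP; exact: measurable_int iw.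
have mwx : measurable_fun setT (fun y : R => w (x - y)).
  by apply: measurableT_comp => //; exact: measurable_funB.
have iwx : mu.-integrable setT (EFin \o (fun y => w (x - y))).
  move/integrableP : iw => [_ iw]; apply/integrableP; split; first exact/measurable_EFinP.
  rewrite (@integral_reflection_translation R x (fun y => `|(w y)%:E|%E))//.
  by apply: measurableT_comp => //; exact/measurable_EFinP.
apply: le_integrable (integrableZl measurableT M iwx) => //.
  by apply/measurable_EFinP; exact: measurable_funM.
move=> y _; rewrite /= lee_fin normrM [leRHS]normrM ler_wpM2r//.
exact: le_trans (rM _) (ler_norm _).
Qed.

Lemma measurable_rho_kernel d (F : R -> R -> R) : 0 < d ->
  measurable_fun setT (fun z : R * R => F z.1 z.2) ->
  measurable_fun setT (fun z : R * R => (rho d z.2 * F z.1 z.2 ^+ 2)%:E).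
Proof.
move=> d0 mF; apply/measurable_EFinP; apply: measurable_funM.
  apply: (measurableT_comp (smooth_measurable (csmooth_rho d0).1)).
  exact: measurable_snd.
exact: measurable_funX.
Qed.

(* Jensen's inequality and Tonelli's theorem, for averages against [rho d]. *)
Lemma sq_rho_average d (F : R -> R -> R) : 0 < d ->
  measurable_fun setT (fun z : R * R => F z.1 z.2) ->
  (forall x, measurable_fun setT (F x)) ->
  (forall x, mu.-integrable setT (EFin \o (fun y => rho d y * F x y))) ->
  measurable_fun setT (fun x => \int[mu]_y (rho d y * F x y)) ->
  (sq (fun x => \int[mu]_y (rho d y * F x y))%R <=
   \int[mu]_y ((rho d y)%:E * sq (F ^~ y)))%E.
Proof.
move=> d0 mF mFx iF mI.
have r0 x : 0 <= rho d x by exact: rho_ge0.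
have mK := measurable_rho_kernel d0 mF.
have K0 z : (0 <= (rho d z.2 * F z.1 z.2 ^+ 2)%:E)%E.
  by rewrite lee_fin mulr_ge0 ?sqr_ge0.
apply: (@le_trans _ _ (\int[mu]_x \int[mu]_y (rho d y * F x y ^+ 2)%:E)%E).
  apply: ge0_le_integral => //.
  - by move=> x _; rewrite lee_fin sqr_ge0.
  - exact: measurable_sq.
  - exact: (@measurable_fun_fubini_tonelli_F _ _ _ _ _ mu _ mK K0).
  - move=> x _; apply: jensen_sqr => //.
    + exact: csmooth_integrable (csmooth_rho d0).
    + exact: rho_mass.
rewrite (@fubini_tonelli _ _ _ _ _ mu mu _ mK K0)/=.
rewrite le_eqVlt; apply/orP; left; apply/eqP; apply: eq_integral => y _.
have mFy : measurable_fun setT (F ^~ y).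
  apply: (@measurableT_comp _ _ _ _ _ _ (fun z : R * R => F z.1 z.2) _ (fun x : R => (x, y))) => //.
rewrite /sq -ge0_integralZl_EFin//.
- by move=> x _; rewrite lee_fin sqr_ge0.
- exact: measurable_sq.
Qed.

Lemma sq_conv_le d w : 0 < d -> mu.-integrable setT (EFin \o w) ->
  (sq (convol w (rho d)) <= sq w)%E.
Proof.
move=> d0 iw; have cr := csmooth_rho d0; have mr := smooth_measurable cr.1.
have mw : measurable_fun setT w by apply/measurable_EFinP; exact: measurable_int iw.
have E : convol w (rho d) = (fun x => \int[mu]_y (rho d y * w (x - y))).
  by apply/funext => x; exact: convE.
have := @sq_rho_average d (fun x y => w (x - y)) d0 (measurable_diff2 mw).
rewrite -E => /(_ _ _ _)/le_trans; apply.
- by move=> x; apply: measurableT_comp => //; exact: measurable_funB.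
- by move=> x; exact: integrable_rho_comp.
- by apply: smooth_measurable; exact: smooth_conv.
have -> : (\int[mu]_y ((rho d y)%:E * sq (fun x : R => w (x - y)%R)) =
    \int[mu]_y ((rho d y)%:E * sq w))%E.
  by apply: eq_integral => y _; congr (_ * _)%E; exact: (sq_shift (- y) mw).
rewrite ge0_integralZr ?sq_ge0//.
- have <- : (1%:E = \int[mu]_y (rho d y)%:E)%E.
    rewrite -(rho_mass d0) /Rintegral fineK//; apply: integrable_fin_num => //.
    exact: csmooth_integrable.
  by rewrite mul1e.
- exact/measurable_EFinP.
- by move=> y _; rewrite lee_fin rho_ge0.
Qed.

(** Since [rho d] has mass 1, the left function is the average of u(x) - u(x - y) against it, and
    the squared norm of that difference in x is [tdiff u y]. *)
Lemma sq_sub_conv_le d u b : 0 < d -> real_L2 u -> supp_in b u ->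
  (sq (fun x => u x - convol u (rho d) x)%R <= \int[mu]_y ((rho d y)%:E * tdiff u y))%E.
Proof.
move=> d0 Lu sb; have iu := integrable_real_L2 Lu sb; have mu_ := Lu.1.
have cr := csmooth_rho d0; have mr := smooth_measurable cr.1.
have i1 x : mu.-integrable setT (EFin \o (fun y => rho d y * u x)).
  have := integrableZr measurableT (u x) (csmooth_integrable cr).
  by apply: eq_integrable.
have E : (fun x => u x - convol u (rho d) x) =
    (fun x => \int[mu]_y (rho d y * (u x - u (x - y)))).
  apply/funext => x; rewrite convE//.
  under [in RHS]eq_Rintegral do rewrite mulrBr.
  rewrite RintegralB//; last exact: integrable_rho_comp.
  by rewrite RintegralZr ?rho_mass ?mul1r//; exact: csmooth_integrable.
have mF : measurable_fun setT (fun z : R * R => u z.1 - u (z.1 - z.2)).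
  apply: measurable_funB; last exact: measurable_diff2.
  by apply: measurableT_comp.
have := @sq_rho_average d (fun x y => u x - u (x - y)) d0 mF.
rewrite -E => /(_ _ _ _)/le_trans; apply.
- move=> x; apply: measurable_funB => //.
  by apply: measurableT_comp => //; exact: measurable_funB.
- move=> x.
  have := integrableB measurableT (i1 x) (integrable_rho_comp x d0 iu).
  by apply: eq_integrable => // y _; rewrite /= mulrBr.
- by apply: measurable_funB => //; apply: smooth_measurable; exact: smooth_conv.
rewrite le_eqVlt; apply/orP; left; apply/eqP; apply: eq_integral => y _.
congr (_ * _)%E; rewrite /tdiff.
have md : measurable_fun setT (fun x : R => u (x + y) - u x).
  by apply: measurable_funB => //; exact: measurable_shift.
rewrite -(sq_shift (- y) md); apply: eq_sq => x.
by rewrite subrK.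
Qed.

(** Convolution commutes with translation and contracts L2. *)
Lemma tdiff_conv_le d u b (x : R) : 0 < d -> real_L2 u -> supp_in b u ->
  (tdiff (convol u (rho d)) x <= tdiff u x)%E.
Proof.
move=> d0 Lu sb; have iu := integrable_real_L2 Lu sb; have mu_ := Lu.1.
have cr := csmooth_rho d0; have mr := smooth_measurable cr.1.
have ius : mu.-integrable setT (EFin \o (fun y => u (y + x))).
  apply: (@integrable_real_L2 _ _ (b + `|x|)); first exact: real_L2_shift.
  move=> y by_; apply: sb; have := ler_normD (y + x) (- x); rewrite normrN addrK; lra.
have id_ : mu.-integrable setT (EFin \o (fun y => u (y + x) - u y)).
  exact: (integrableB measurableT ius iu).
apply: le_trans (sq_conv_le d0 id_).
rewrite /tdiff le_eqVlt; apply/orP; left; apply/eqP; apply: eq_sq => y.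
have mus : measurable_fun setT (fun y : R => u (y + x)) by exact: measurable_shift.
rewrite !convE//; last exact: measurable_funB.
rewrite -RintegralB//; try exact: integrable_rho_comp.
apply: eq_Rintegral => z _; rewrite -mulrBr; congr (_ * (u _ - _)); ring.
Qed.

End mollifier.

Section density.
Context {R : realType}.
Notation mu := (@lebesgue_measure R).
Implicit Types (f g psi u w p q r : R -> R).

(** From here to [lty_comb]: extended-real arithmetic in which the infinite cases are disposed of
    once. Dividing by c + 1 instead of c admits c = 0. *)
Lemma small_mul (c e : R) (x : \bar R) : 0 <= c -> (0 <= x)%E ->
  (x < (e / (c + 1))%:E)%E -> (c%:E * x < e%:E)%E.
Proof.
move=> c0; case: x => [x| |]//=; rewrite lee_fin lte_fin => x0 h.
rewrite -EFinM lte_fin.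
have e0 : 0 < e / (c + 1) by exact: le_lt_trans h.
move: h; rewrite ltr_pdivlMr; [nra|lra].
Qed.

Lemma ereal_splitting (x y : \bar R) (e : R) : (0 <= x)%E -> (0 <= y)%E ->
  (x + y)%E \is a fin_num -> (x + y - e%:E < y)%E -> (x < e%:E)%E.
Proof.
case: x => [x| |]//; case: y => [y| |]// _ _ _.
by move=> h; have : ((x + y - e)%:E < y%:E)%E := h; rewrite !lte_fin; lra.
Qed.

Lemma lee_2x4 (x : \bar R) : (0 <= x)%E -> (2%:E * (x + x) <= 4%:E * x)%E.
Proof.
case: x => [x| |]// _; first by rewrite -!EFinD -!EFinM lee_fin; lra.
by rewrite gt0_muley ?lte_fin// gt0_muley ?lte_fin.
Qed.

Lemma lee_26 (x y z : \bar R) : (0 <= x)%E -> (0 <= y)%E -> (0 <= z)%E ->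
  (z <= 12%:E * x)%E -> (y <= x)%E -> (2%:E * (z + y) <= 26%:E * x)%E.
Proof.
case: x => [x| |]// _; last by move=> *; rewrite (@gt0_muley _ 26%:E) ?lte_fin// leey.
case: y => [y| |]// _; case: z => [z| |]// _.
by rewrite -EFinD -!EFinM !lee_fin; lra.
Qed.

Lemma lte_sum2 (x y : \bar R) (e : R) : (0 <= x)%E -> (0 <= y)%E ->
  (x < (e / 4)%:E)%E -> (y < (e / 4)%:E)%E -> (2%:E * (x + y) < e%:E)%E.
Proof.
case: x => [x| |]// _; case: y => [y| |]// _.
by rewrite -EFinD -!EFinM !lte_fin; lra.
Qed.

Lemma lte_16 (x y : \bar R) (z : \bar R) (e : R) : (0 <= x)%E -> (0 <= y)%E -> (0 <= z)%E ->
  (z < (e / 16)%:E)%E -> (x <= 4%:E * z)%E -> (y < (e / 4)%:E)%E ->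
  (2%:E * (x + y) < e%:E)%E.
Proof.
case: x => [x| |]// _; case: y => [y| |]// _; case: z => [z| |]// _.
by rewrite -EFinD -!EFinM !lte_fin !lee_fin; lra.
Qed.

Lemma lty_comb (c d : R) (x y : \bar R) : 0 <= c -> 0 <= d -> (0 <= x)%E -> (0 <= y)%E ->
  (x < +oo)%E -> (y < +oo)%E -> (c%:E * x + d%:E * y < +oo)%E.
Proof.
case: x => [x| |]// _ _; case: y => [y| |]// *.
by rewrite -!EFinM -EFinD ltry.
Qed.

(** The part of the energy due to translations up to eta; the rest is controlled by the L2 norm
    alone, see [en_le_split]. *)
Definition enloc u (eta : R) : \bar R :=
  (\int[mu]_(x in `]0%R, eta]) ((kap x)%:E * tdiff u x))%E.

Lemma enloc_ge0 u eta : (0 <= enloc u eta)%E.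
Proof.
apply: integral_ge0 => x; rewrite /= in_itv/= => /andP[x0 _].
by apply: integrand_en_ge0; rewrite /= in_itv/= x0.
Qed.

Lemma measurable_integrand_enS u (D : set R) : measurable_fun setT u ->
  measurable D -> D `<=` `]0, +oo[%classic ->
  measurable_fun D (fun x => (kap x)%:E * tdiff u x)%E.
Proof.
move=> mu_ mD sD; apply: measurable_funS (measurable_integrand_en mu_) => //.
Qed.

Lemma sub_loc (eta : R) : `]0, eta]%classic `<=` (`]0, +oo[%classic : set R).
Proof. by move=> x /=; rewrite !in_itv/= => /andP[->]. Qed.

Lemma sub_far (eta : R) : 0 < eta -> `]eta, +oo[%classic `<=` (`]0, +oo[%classic : set R).
Proof. by move=> e0 x /=; rewrite !in_itv/= !andbT; apply: lt_trans. Qed.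

Lemma en_splitE u eta : measurable_fun setT u -> 0 < eta ->
  en u = (enloc u eta + \int[mu]_(x in `]eta, +oo[) ((kap x)%:E * tdiff u x))%E.
Proof.
move=> mu_ e0; rewrite /en /enloc.
have E : (`]0, +oo[%classic : set R) = `]0, eta]%classic `|` `]eta, +oo[%classic.
  by apply: itv_bndbnd_setU; rewrite bnd_simp// ltW.
rewrite E ge0_integral_setU//.
- by rewrite -E; exact: measurable_integrand_en.
- by rewrite -E; exact: integrand_en_ge0.
- by apply/disj_setPS => x [] /=; rewrite !in_itv/= !andbT => /andP[_ h1] h2; lra.
Qed.

Lemma enloc_mono u (eta eta' : R) : measurable_fun setT u -> eta <= eta' ->
  (enloc u eta <= enloc u eta')%E.
Proof.
move=> mu_ ee; apply: ge0_subset_integral => //.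
- by apply: measurable_integrand_enS => //; exact: sub_loc.
- by move=> x /sub_loc; exact: integrand_en_ge0.
- by move=> x /=; rewrite !in_itv/= => /andP[-> /le_trans]; exact.
Qed.

(** By monotone convergence the energy over translations above 1/(n+1) increases to the whole. As
    the whole is finite, what remains below 1/(n+1) is eventually smaller than e. *)
Lemma enloc_small u (e : R) : measurable_fun setT u -> (en u < +oo)%E -> 0 < e ->
  exists eta : R, [/\ 0 < eta, eta <= 1 & (enloc u eta < e%:E)%E].
Proof.
move=> mu_ eu e0.
pose F (n : nat) : set R := `]n.+1%:R^-1, +oo[%classic.
have sF n : F n `<=` (`]0, +oo[%classic : set R) by apply: sub_far; rewrite invr_gt0.
have UF : \bigcup_n F n = (`]0, +oo[%classic : set R).
  apply/seteqP; split => [x [n _]|x]; first exact: sF.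
  rewrite /= in_itv/= andbT => x0.
  exists (Num.truncn x^-1) => //; rewrite /F/= in_itv/= andbT.
  rewrite invf_plt ?posrE//; exact: truncnS_gt.
have mF n : measurable (F n : set (measurableTypeR R)) by exact: measurable_itv.
have H : (\int[mu]_(x in F n) ((kap x)%:E * tdiff u x))%E @[n --> \oo] --> en u.
  rewrite /en -UF; apply: ge0_nondecreasing_set_cvg_integral.
  - move=> m n mn; apply/subsetPset => x; rewrite /F/= !in_itv/= !andbT.
    by apply: le_lt_trans; rewrite lef_pV2 ?posrE// ler_nat ltnS.
  - exact: mF.
  - by move=> n; apply: measurable_integrand_enS => //; exact: mF.
  - by move=> n x /sF; exact: integrand_en_ge0.
have fu : en u \is a fin_num by rewrite ge0_fin_numE// en_ge0.
have lt1 : (en u - e%:E < en u)%E by rewrite lteBlDr// lteDl// lte_fin.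
have [n Hn] : exists n, (en u - e%:E < \int[mu]_(x in F n) ((kap x)%:E * tdiff u x))%E.
  apply: contrapT => /forallNP h.
  have : (en u <= en u - e%:E)%E.
    by apply: (cvge_to_le H); apply: nearW => n; rewrite leNgt; apply/negP/h.
  by rewrite leNgt lt1.
exists n.+1%:R^-1; split; first by rewrite invr_gt0.
  by rewrite invf_le1// ler1n.
move: Hn.
have := @en_splitE u n.+1%:R^-1 mu_; rewrite invr_gt0 => /(_ (ltr0Sn _ _)).
rewrite -/(F n) => E; move: fu; rewrite E.
have I0 : (0 <= \int[mu]_(x in F n) ((kap x)%:E * tdiff u x))%E.
  by apply: integral_ge0 => x /sF; exact: integrand_en_ge0.
exact: ereal_splitting (enloc_ge0 _ _) I0.
Qed.

Lemma tdiff_le4 w x : measurable_fun setT w -> (tdiff w x <= 4%:E * sq w)%E.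
Proof.
move=> mw; apply: (le_trans (le_sqB2 (measurable_shift x mw) mw)).
rewrite (sq_shift x mw); move: (sq_ge0 w); case: (sq w) => [r| |]//= r0.
- rewrite -!EFinD -!EFinM lee_fin; lra.
- by rewrite gt0_muley ?lte_fin// gt0_muley ?lte_fin.
Qed.

Lemma tdiffD_le p q x : measurable_fun setT p -> measurable_fun setT q ->
  (tdiff (fun y => p y - q y)%R x <= 2%:E * (tdiff p x + tdiff q x))%E.
Proof.
move=> mp mq; rewrite /tdiff.
have md (r : R -> R) : measurable_fun setT r -> measurable_fun setT (fun y : R => r (y + x) - r y).
  by move=> mr; apply: measurable_funB => //; exact: measurable_shift.
apply: le_trans (le_sqB2 (md _ mp) (md _ mq)).
by rewrite le_eqVlt; apply/orP; left; apply/eqP; apply: eq_sq => y; ring.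
Qed.

(** The factor 4 is the one in [tdiff_le4]. *)
Definition tailcst (eta : R) : R := 4 * fine (\int[mu]_(x in `[eta, +oo[) (kap x)%:E)%E.

Lemma tailcst_ge0 eta : 0 < eta -> 0 <= tailcst eta.
Proof.
move=> e0; rewrite mulr_ge0// fine_ge0// integral_ge0// => x.
by rewrite /= in_itv/= andbT => ex; rewrite lee_fin ltW// kap_gt0//; lra.
Qed.

Lemma en_le_split w eta : measurable_fun setT w -> 0 < eta ->
  (en w <= enloc w eta + (tailcst eta)%:E * sq w)%E.
Proof.
move=> mw e0; rewrite (en_splitE mw e0) leeD2l//.
have mk : measurable_fun (`]eta, +oo[%classic : set R) (EFin \o kap).
  apply/measurable_EFinP; apply: measurable_funS measurable_kap => //.
  exact: sub_far.
have k0 (x : R) : `]eta, +oo[%classic x -> (0 <= (kap x)%:E)%E.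
  by move=> /(sub_far e0); rewrite /= in_itv/= andbT => x0; rewrite lee_fin ltW// kap_gt0.
apply: (@le_trans _ _ (\int[mu]_(x in `]eta, +oo[) ((kap x)%:E * (4%:E * sq w)))%E).
  apply: ge0_le_integral => //.
  - by move=> x /(sub_far e0); exact: integrand_en_ge0.
  - by apply: measurable_integrand_enS => //; exact: sub_far.
  - by apply: emeasurable_funM.
  - by move=> x xe; apply: lee_wpmul2l; [exact: k0|exact: tdiff_le4].
rewrite ge0_integralZr ?mule_ge0 ?sq_ge0//.
have -> : (\int[mu]_(x in `]eta, +oo[) (kap x)%:E = \int[mu]_(x in `[eta, +oo[) (kap x)%:E)%E.
  by apply: integral_itv_obnd_cbnd.
rewrite /tailcst.
have : (0 <= \int[mu]_(x in `[eta, +oo[) (kap x)%:E)%E.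
  apply: integral_ge0 => x; rewrite /= in_itv/= andbT => ex.
  by rewrite lee_fin ltW// kap_gt0//; lra.
have := integral_kap_tail e0.
move: (integral _ _ _) => [k| |]//= _ _; by rewrite muleA -EFinM mulrC.
Qed.

Lemma enloc_sub_le p q (eta : R) : measurable_fun setT p -> measurable_fun setT q ->
  (enloc (fun y => p y - q y)%R eta <= 2%:E * (enloc p eta + enloc q eta))%E.
Proof.
move=> mp mq.
have mloc r : measurable_fun setT r ->
    measurable_fun (`]0, eta]%classic : set R) (fun x => (kap x)%:E * tdiff r x)%E.
  by move=> mr; apply: measurable_integrand_enS => //; exact: sub_loc.
have p0 r x : `]0, eta]%classic x -> (0 <= (kap x)%:E * tdiff r x)%E.
  by move=> /sub_loc; exact: integrand_en_ge0.
rewrite /enloc -ge0_integralD//; try exact: mloc; try (by move=> x; exact: p0).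
rewrite -ge0_integralZl_EFin//.
- apply: ge0_le_integral => //.
  + by move=> x; exact: p0.
  + by apply: mloc; exact: measurable_funB.
  + by apply: measurable_funeM; apply: emeasurable_funD; exact: mloc.
  + move=> x x0; rewrite -ge0_muleDr ?tdiff_ge0// muleCA.
    apply: lee_wpmul2l; last exact: tdiffD_le.
    move: (sub_loc x0); rewrite /= in_itv/= andbT => xp.
    by rewrite lee_fin ltW// kap_gt0.
- by move=> x x0; rewrite adde_ge0// p0.
- by apply: emeasurable_funD; exact: mloc.
Qed.

(** On (0, d] one has rho_d(y) <= M/d <= M/y <= 4 M kap(y), so the singularity of the kernel is
    strong enough to absorb the mollifier. The constant is independent of u, b and d. *)
Lemma sq_mollify_le : exists2 C : R, 0 < C & forall u b d, 0 < d -> d <= 1 ->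
  real_L2 u -> supp_in b u ->
  (sq (fun x => u x - convol u (rho d) x)%R <= C%:E * enloc u d)%E.
Proof.
have [M M0 rM] := @rho_le R.
exists (4 * M) => [|u b d d0 d1 Lu sb]; first by rewrite mulr_gt0.
have mr := smooth_measurable (csmooth_rho d0).1.
apply: (le_trans (sq_sub_conv_le d0 Lu sb)).
have mt := measurable_tdiff Lu.1.
have -> : (\int[mu]_y ((rho d y)%:E * tdiff u y) =
    \int[mu]_(y in `]0%R, d]) ((rho d y)%:E * tdiff u y))%E.
  rewrite [RHS]integral_mkcond; apply: eq_integral => y _; rewrite patchE.
  case: ifPn => // yd; rewrite rho_supp ?mul0e//; apply: contraNN yd => /andP[y0 yd].
  by rewrite inE/= in_itv/= y0 ltW.
rewrite /enloc -ge0_integralZl_EFin//.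
- apply: ge0_le_integral => //.
  + by move=> y _; rewrite mule_ge0 ?tdiff_ge0 ?lee_fin ?rho_ge0.
  + apply: measurable_funTS; apply: emeasurable_funM => //; exact/measurable_EFinP.
  + apply: measurable_funeM; apply: measurable_integrand_enS => //; [exact: Lu.1|exact: sub_loc].
  + move=> y; rewrite /= in_itv/= => /andP[y0 yd].
    rewrite muleA -EFinM; apply: lee_wpmul2r; first exact: tdiff_ge0.
    rewrite lee_fin; apply: (le_trans (rM _ _ d0)).
    have y1 : y <= 1 by exact: le_trans d1.
    have kg := kap_ge y0 y1.
    apply: (@le_trans _ _ (4 * M * (4 * y)^-1)); last first.
      by rewrite ler_wpM2l// mulr_ge0// ltW.
    have -> : 4 * M * (4 * y)^-1 = M / y by field; rewrite gt_eqF.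
    by rewrite ler_wpM2l ?(ltW M0)// lef_pV2 ?posrE.
- by move=> y /sub_loc; exact: integrand_en_ge0.
- by apply: measurable_integrand_enS => //; [exact: Lu.1|exact: sub_loc].
- by rewrite mulr_ge0// ltW.
Qed.

(** The order of choices matters: eta is fixed first, making the local energies of u and of all its
    mollifications small; then d is taken small relative to [tailcst eta], the price of the far
    part. *)
Lemma mollify u b (e : R) : real_L2 u -> supp_in b u -> (en u < +oo)%E -> 0 < e ->
  exists2 d0 : R, 0 < d0 & forall d, 0 < d -> d < d0 ->
    (sq (fun x => u x - convol u (rho d) x)%R < e%:E)%E /\
    (en (fun x => u x - convol u (rho d) x)%R < e%:E)%E.
Proof.
move=> Lu sb eu e0; have mu_ := Lu.1; have [C C0 HC] := sq_mollify_le.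
(* Prepared for [small_mul] with factor 4: a difference costs 2 (x + y), and mollification does not
   raise the local energy. *)
have e8 : 0 < (e / 2) / (4 + 1) by rewrite divr_gt0//; lra.
have [eta [eta0 eta1 Heta]] := enloc_small mu_ eu e8.
have t0 := tailcst_ge0 eta0.
set K := tailcst eta in t0.
have KC : 0 <= K * C by rewrite mulr_ge0// ltW.
have e1 : 0 < e / (C + 1) by rewrite divr_gt0//; lra.
have e2 : 0 < (e / 2) / (K * C + 1) by rewrite divr_gt0//; lra.
have [d1 [d10 d11 Hd1]] := enloc_small mu_ eu e1.
have [d2 [d20 d21 Hd2]] := enloc_small mu_ eu e2.
exists (Num.min d1 d2); first by rewrite lt_min d10 d20.
move=> d dp; rewrite lt_min => /andP[dd1 dd2].
have dle1 : d <= 1 by lra.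
have S := HC u b d dp dle1 Lu sb.
have cr := csmooth_rho dp.
have iu := integrable_real_L2 Lu sb.
have mc : measurable_fun setT (convol u (rho d)).
  by apply: smooth_measurable; exact: smooth_conv.
split.
  apply: (le_lt_trans S); apply: small_mul; [exact: ltW|exact: enloc_ge0|].
  by apply: le_lt_trans Hd1; apply: enloc_mono => //; exact: ltW.
apply: (le_lt_trans (@en_le_split _ eta _ eta0)); first exact: measurable_funB.
have -> : e = e / 2 + e / 2 by lra.
rewrite EFinD; apply: lteD.
- apply: (@le_lt_trans _ _ (4%:E * enloc u eta)%E); last first.
    by apply: small_mul => //; exact: enloc_ge0.
  apply: (le_trans (enloc_sub_le eta mu_ mc)).
  have -> : (4%:E * enloc u eta = 2%:E * (enloc u eta + enloc u eta))%E.
    move: (enloc_ge0 u eta); case: (enloc u eta) => [r| |]// _.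
      by rewrite -!EFinD -!EFinM; congr EFin; ring.
    by rewrite gt0_muley ?lte_fin// gt0_muley ?lte_fin.
  apply: lee_wpmul2l; first by rewrite lee_fin.
  apply: leeD2l.
  apply: ge0_le_integral => //.
  + by move=> x /sub_loc; exact: integrand_en_ge0.
  + by apply: measurable_integrand_enS => //; exact: sub_loc.
  + by apply: measurable_integrand_enS => //; exact: sub_loc.
  + move=> x /sub_loc; rewrite /= in_itv/= andbT => x0.
    apply: lee_wpmul2l; first by rewrite lee_fin ltW// kap_gt0.
    exact: tdiff_conv_le Lu sb.
- apply: (@le_lt_trans _ _ ((K * C)%:E * enloc u d)%E).
    have -> : ((K * C)%:E * enloc u d = K%:E * (C%:E * enloc u d))%E by rewrite muleA EFinM.
    by apply: lee_wpmul2l; [rewrite lee_fin|exact: S].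
  apply: small_mul => //; first exact: enloc_ge0.
  by apply: le_lt_trans Hd2; apply: enloc_mono => //; exact: ltW.
Qed.

Definition dil (s : R) p (x : R) : R := p (s * x).

Lemma measurable_dil s p : measurable_fun setT p -> measurable_fun setT (dil s p).
Proof. by move=> mp; apply: measurableT_comp => //; exact: measurable_funM. Qed.

Lemma sq_dil s p : 0 < s -> measurable_fun setT p -> sq (dil s p) = (s^-1%:E * sq p)%E.
Proof.
move=> s0 mp; rewrite /sq -(ge0_integral_affine 0 s0 (measurable_sq mp)).
  by apply: eq_integral => x _; rewrite /dil addr0.
by move=> x; rewrite lee_fin sqr_ge0.
Qed.

Lemma sq_dil_le s p : 1 <= s -> measurable_fun setT p -> (sq (dil s p) <= sq p)%E.
Proof.
move=> s1 mp; rewrite sq_dil//; last by lra.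
rewrite -[leRHS]mul1e; apply: lee_wpmul2r; first exact: sq_ge0.
by rewrite lee_fin invf_le1//; lra.
Qed.

Lemma tdiff_dil s p (x : R) : 0 < s -> measurable_fun setT p ->
  tdiff (dil s p) x = (s^-1%:E * tdiff p (s * x))%E.
Proof.
move=> s0 mp; rewrite /tdiff -sq_dil//.
  by apply: eq_sq => y; rewrite /dil mulrDr.
by apply: measurable_funB => //; exact: measurable_shift.
Qed.

(* Rescaling turns the kernel [kap x] into [kap (x / s)], comparable to it near 0. *)
Lemma enloc_dil_le s p (eta : R) : 1 <= s -> s <= 2 -> 0 < eta -> 2 * eta <= 1 ->
  measurable_fun setT p -> (enloc (dil s p) eta <= 12%:E * enloc p (2 * eta))%E.
Proof.
move=> s1 s2 eta0 eta1 mp; have s0 : 0 < s by lra.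
have mt := measurable_tdiff mp.
pose F (u : R) : \bar R :=
  (((kap u)%:E * tdiff p u) * (\1_(`]0, 2 * eta]%classic) u)%:E)%E.
have FE (x : R) : F x = ((fun u : R => (kap u)%:E * tdiff p u) \_ `]0%R, (2 * eta)%R]%classic)%E x.
  by rewrite patchE /F indicE; case: ifP => _; rewrite ?mule1 ?mule0.
have F0 (x : R) : (0 <= F x)%E.
  rewrite FE patchE; case: ifPn => //; rewrite inE => /sub_loc.
  exact: integrand_en_ge0.
have mF : measurable_fun setT F.
  rewrite (_ : F = ((fun u : R => (kap u)%:E * tdiff p u) \_ `]0%R, (2 * eta)%R]%classic)%E); last exact/funext.
  apply/(measurable_restrictT _ _).1 => //.
  by apply: measurable_integrand_enS => //; exact: sub_loc.
have IF : (\int[mu]_x F x = enloc p (2 * eta))%E.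
  by rewrite /enloc [RHS]integral_mkcond; apply: eq_integral => x _; rewrite FE.
apply: (@le_trans _ _ (\int[mu]_x (12%:E * F (s * x + 0)%R))%E); last first.
  have mFs : measurable_fun setT (fun x : R => F (s * x + 0)%R).
    by apply: measurableT_comp => //; apply: measurable_funD => //; exact: measurable_funM.
  rewrite ge0_integralZl_EFin// ge0_integral_affine// IF.
  apply: lee_wpmul2l; first by rewrite lee_fin.
  rewrite -[leRHS]mul1e; apply: lee_wpmul2r; first exact: enloc_ge0.
  by rewrite lee_fin invf_le1//; lra.
rewrite /enloc integral_mkcond; apply: ge0_le_integral => //.
- move=> x _; rewrite patchE; case: ifPn => //; rewrite inE => /sub_loc.
  exact: integrand_en_ge0.
- apply/(measurable_restrictT _ _).1 => //.
  apply: measurable_integrand_enS => //; last exact: sub_loc.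
  exact: measurable_dil.
- apply: measurable_funeM; apply: measurableT_comp => //.
  by apply: measurable_funD => //; exact: measurable_funM.
- move=> x _; rewrite patchE; case: ifPn => [|_]; last by rewrite mule_ge0.
  rewrite inE/= in_itv/= => /andP[x0 xe].
  rewrite addr0 FE patchE ifT; last first.
    by rewrite inE/= in_itv/=; apply/andP; split; nra.
  rewrite tdiff_dil// !muleA -!EFinM; apply: lee_wpmul2r; first exact: tdiff_ge0.
  have sx0 : 0 < s * x by exact: mulr_gt0.
  have sx1 : s * x <= 1 by nra.
  have x1 : x <= 1 by lra.
  have k1 := kap_le x0 x1.
  have k2 := kap_ge sx0 sx1.
  rewrite lee_fin; apply: (@le_trans _ _ (kap x * 1)).
    by rewrite ler_wpM2l ?(ltW (kap_gt0 x0))// invf_le1.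
  rewrite mulr1; apply: (le_trans k1).
  (* The chain is kap(x) <= 3/(2x) <= 3/(s x) = 12/(4 s x) <= 12 kap(s x), using s <= 2. *)
  apply: (@le_trans _ _ (12 * (4 * (s * x))^-1)); last by rewrite ler_wpM2l.
  have -> : 12 * (4 * (s * x))^-1 = 3 / (s * x) by field; rewrite !gt_eqF.
  by rewrite ler_wpM2l// lef_pV2 ?posrE ?mulr_gt0//; nra.
Qed.

(** By the mean value theorem |psi(s x) - psi(x)| <= M B (s - 1) on [-B, B], and both values vanish
    outside because s >= 1. *)
Lemma sq_dil_smooth psi b (e : R) : csmooth psi -> supp_in b psi -> 0 < e ->
  exists2 s0 : R, 1 < s0 & forall s, 1 <= s -> s < s0 ->
    (sq (fun x => dil s psi x - psi x)%R < e%:E)%E.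
Proof.
move=> cp sb e0; have [M M0 dM] := csmooth_bounded (csmooth_derive1 cp).
have mp := smooth_measurable cp.1.
pose B := `|b| + 1; have B0 : 0 < B by rewrite ltr_wpDl.
have sB : supp_in B psi.
  by move=> x Bx; apply: sb; apply: le_trans Bx; rewrite /B; have := ler_norm b; lra.
have lip x y : `|psi y - psi x| <= M * `|y - x|.
  wlog xy : x y / x <= y.
    move=> W; have [xy|/ltW yx] := leP x y; first exact: W.
    by rewrite distrC [in leRHS]distrC; exact: W.
  have := @MVT_segment R psi (derive1 psi) x y xy.
  move=> /(_ (fun z _ => smooth_is_derive cp.1 z))/(_ _)[|c _ ->].
    by apply: continuous_subspaceT; exact: smooth_continuous cp.1.
  by rewrite normrM ler_wpM2r.
pose K := 2 * B * (M * B) ^+ 2.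
have K0 : 0 <= K by rewrite mulr_ge0 ?sqr_ge0// mulr_ge0// ltW.
exists (1 + Num.min 1 (e / (K + 1))).
  by rewrite ltrDl lt_min ltr01 divr_gt0//; lra.
move=> s s1 ss; have t0 : 0 <= s - 1 by lra.
have [t1 t2] : s - 1 < 1 /\ s - 1 < e / (K + 1).
  by apply/andP; rewrite -lt_min; lra.
apply: (@le_lt_trans _ _ (K * (s - 1) ^+ 2)%:E); last first.
  rewrite lte_fin; move: t2; rewrite ltr_pdivlMr; last by lra.
  have : (s - 1) ^+ 2 <= s - 1 by rewrite expr2; nra.
  nra.
pose c := (M * B * (s - 1)) ^+ 2.
apply: (@le_trans _ _ (\int[mu]_x (c * \1_(`[- B, B]%classic) x)%:E)%E).
  apply: ge0_le_integral => //.
  - by move=> x _; rewrite lee_fin sqr_ge0.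
  - by apply: measurable_sq; apply: measurable_funB => //; exact: measurable_dil.
  - by apply/measurable_EFinP; apply: measurable_funM => //; exact: measurable_indic.
  - move=> x _; rewrite lee_fin indicE.
    have [Bx|xB] := lerP B `|x|.
      have Bsx : B <= `|s * x|.
        by rewrite normrM; apply: (le_trans Bx); rewrite ler_peMl// ger0_norm//; lra.
      by rewrite /dil (sB _ Bx) (sB _ Bsx) subrr expr0n mulr_ge0 ?sqr_ge0.
    rewrite mem_set; last first.
      by rewrite /= in_itv/=; move: xB; rewrite ltr_norml => /andP[/ltW -> /ltW ->].
    rewrite mulr1 -real_normK ?num_real// lerXn2r ?nnegrE ?mulr_ge0 ?(ltW B0)//.
    apply: (le_trans (lip _ _)); rewrite -mulrA ler_wpM2l//.
    have -> : s * x - x = (s - 1) * x by ring.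
    by rewrite normrM ger0_norm// mulrC ler_wpM2r// ltW.
under eq_integral do rewrite EFinM.
rewrite ge0_integralZl_EFin ?sqr_ge0//; last first.
  by apply/measurable_EFinP; exact: measurable_indic.
rewrite integral_indic// setIT.
suff H : (c%:E * lebesgue_measure (`[(- B)%R, B]%classic : set R) <= (K * (s - 1) ^+ 2)%:E)%E by exact: H.
rewrite lebesgue_measure_itv/= lte_fin ifT; last by lra.
rewrite -EFinD -EFinM lee_fin /c /K le_eqVlt; apply/orP; left; apply/eqP; ring.
Qed.

Lemma enN p : en (fun x => - p x) = en p.
Proof.
apply: eq_integral => x _; congr (_ * _)%E; rewrite /tdiff -[RHS]sqN.
by apply: eq_sq => y; rewrite opprB opprK addrC.
Qed.

#[local] Opaque sq tdiff en enloc.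

(** The local energy of a dilate is bounded uniformly in s <= 2, so only the L2 distance has to tend
    to 0. For that, p is replaced by a mollification u, to which [sq_dil_smooth] applies; dilating
    by s >= 1 does not enlarge the norm of p - u. *)
Lemma dilate p b (e : R) : real_L2 p -> supp_in b p -> (en p < +oo)%E -> 0 < e ->
  exists2 s : R, 1 < s & (sq (fun x => dil s p x - p x)%R < e%:E)%E /\
    (en (fun x => dil s p x - p x)%R < e%:E)%E.
Proof.
move=> Lp sb ep e0; have mp := Lp.1.
(* 26 = 2 (12 + 1): the factor 12 of [enloc_dil_le] for the dilate, 1 for p itself, doubled by
   [enloc_sub_le]. *)
have e8 : 0 < (e / 2) / (26 + 1) by rewrite divr_gt0//; lra.
have [eta' [eta'0 eta'1 Heta]] := enloc_small mp ep e8.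
(* Halved because dilation by s <= 2 can double the translations involved. *)
pose eta := eta' / 2.
have eta0 : 0 < eta by rewrite /eta; lra.
have eta2 : 2 * eta = eta' by rewrite /eta; lra.
have t0 := tailcst_ge0 eta0; set K := tailcst eta in t0.
pose e' := Num.min e ((e / 2) / (K + 1)).
have e'0 : 0 < e'.
  by rewrite lt_min e0/= divr_gt0//; lra.
have e'16 : 0 < e' / 16 by lra.
have [d0 d00 Hd] := mollify Lp sb ep e'16.
pose d := d0 / 2; have dp : 0 < d by rewrite /d; lra.
have dd0 : d < d0 by rewrite /d; lra.
have [Hu _] := Hd d dp dd0.
have cr := csmooth_rho dp; have iu := integrable_real_L2 Lp sb.
pose u := convol p (rho d).
have su : smooth_real u by exact: smooth_conv.
have sbu : supp_in (b + d) u by apply: conv_supp => //; exact: rho_supp_in.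
have cu : csmooth u by split => //; exists (b + d).
have mu_ : measurable_fun setT u by exact: smooth_measurable.
have e'4 : 0 < e' / 4 by lra.
have [s0 s01 Hs] := sq_dil_smooth cu sbu e'4.
pose s := Num.min 2 ((1 + s0) / 2).
have s1 : 1 < s by rewrite lt_min; apply/andP; split; lra.
have ss0 : s < s0 by rewrite gt_min; apply/orP; right; lra.
have s2 : s <= 2 by rewrite ge_min lexx.
have mds r : measurable_fun setT r -> measurable_fun setT (dil s r) by exact: measurable_dil.
have S : (sq (fun x => dil s p x - p x)%R < e'%:E)%E.
  pose q x := p x - u x.
  have mq : measurable_fun setT q by exact: measurable_funB.
  have -> : sq (fun x => dil s p x - p x) =
      sq (fun x => (dil s q x - q x) + (dil s u x - u x)).
    apply: eq_sq => x; rewrite /dil /q.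
    by move: (p (s * x)) (p x) (u (s * x)) (u x) => A1 A2 A3 A4; ring.
  apply: (le_lt_trans (le_sqD2 (measurable_funB (mds _ mq) mq) (measurable_funB (mds _ mu_) mu_))).
  have h1 : (sq (fun x => dil s q x - q x)%R <= 4%:E * sq q)%E.
    apply: (le_trans (le_sqB2 (mds _ mq) mq)).
    apply: (@le_trans _ _ (2%:E * (sq q + sq q))%E).
      by apply: lee_wpmul2l; [rewrite lee_fin|apply: leeD2r; apply: sq_dil_le => //; exact: ltW].
    exact: lee_2x4 (sq_ge0 q).
  have h2 := Hs s (ltW s1) ss0.
  exact: lte_16 (sq_ge0 _) (sq_ge0 _) (sq_ge0 q) Hu h1 h2.
exists s => //.
have e'e : e' <= e by rewrite ge_min lexx.
split; first by apply: (lt_le_trans S); rewrite lee_fin.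
have md : measurable_fun setT (fun x => dil s p x - p x) by apply: measurable_funB => //; exact: mds.
apply: (le_lt_trans (en_le_split md eta0)).
have -> : e = e / 2 + e / 2 by lra.
rewrite EFinD; apply: lteD; last first.
  apply: small_mul => //; first exact: sq_ge0.
  by apply: (lt_le_trans S); rewrite lee_fin ge_min lexx orbT.
apply: (@le_lt_trans _ _ (26%:E * enloc p eta')%E); last first.
  by apply: small_mul => //; exact: enloc_ge0.
apply: (le_trans (enloc_sub_le eta (mds _ mp) mp)).
have e21 : 2 * eta <= 1 by lra.
have h1 := @enloc_dil_le s p eta (ltW s1) s2 eta0 e21 mp.
rewrite eta2 in h1.
have h2 : (enloc p eta <= enloc p eta')%E by apply: enloc_mono => //; lra.
exact: lee_26 (enloc_ge0 _ _) (enloc_ge0 _ _) (enloc_ge0 _ _) h1 h2.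
Qed.

Theorem csmooth_dense (a : R) p (e : R) : 0 < a -> real_L2 p -> supp_in a p ->
  (en p < +oo)%E -> 0 < e ->
  exists psi b, [/\ smooth_real psi, b < a /\ supp_in b psi,
    (sq (fun x => p x - psi x)%R < e%:E)%E & (en (fun x => p x - psi x)%R < e%:E)%E].
Proof.
move=> a0 Lp sa ep e0; have mp := Lp.1.
have e4 : 0 < e / 4 by lra.
have [s s1 [Hs1 Hs2]] := dilate Lp sa ep e4.
have s0 : 0 < s by lra.
have mdp : measurable_fun setT (dil s p) by exact: measurable_dil.
have Lq : real_L2 (dil s p).
  split => //; apply: le_lt_trans Lp.2; apply: sq_dil_le => //; exact: ltW.
have sq_ : supp_in (a / s) (dil s p).
  move=> x ax; apply: sa; rewrite normrM (gtr0_norm s0).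
  by move: ax; rewrite ler_pdivrMr// mulrC.
have md : measurable_fun setT (fun x => dil s p x - p x) by exact: measurable_funB.
have eq_ : (en (dil s p) < +oo)%E.
  have := le_enD ltr01 md mp.
  under eq_en do rewrite subrK.
  move=> /le_lt_trans; apply.
  have Hs3 : (en (fun x => dil s p x - p x)%R < +oo)%E by apply: lt_trans Hs2 _; rewrite ltry.
  by apply: (lty_comb _ _ (en_ge0 _) (en_ge0 _) Hs3 ep); rewrite ?addr_ge0 ?invr_ge0.
have [d0 d00 Hd] := mollify Lq sq_ eq_ e4.
have as_ : a / s < a by rewrite ltr_pdivrMr//; nra.
(* At most half the gap opened by the dilation, so the mollified function stays supported strictly
   inside (-a, a). *)
pose d := Num.min (d0 / 2) ((a - a / s) / 2).
have dp : 0 < d by rewrite lt_min; apply/andP; split; lra.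
have dd0 : d < d0 by rewrite gt_min; apply/orP; left; lra.
have dda : d <= (a - a / s) / 2 by rewrite ge_min lexx orbT.
have [H1 H2] := Hd d dp dd0.
have cr := csmooth_rho dp; have iq := integrable_real_L2 Lq sq_.
pose psi := convol (dil s p) (rho d).
have sm : smooth_real psi by exact: smooth_conv.
have mpsi := smooth_measurable sm.
exists psi, (a / s + d); split => //.
- by split; [lra|apply: conv_supp => //; exact: rho_supp_in].
- have -> : sq (fun x => p x - psi x) =
      sq (fun x => (dil s p x - psi x) - (dil s p x - p x)).
    by apply: eq_sq => x; ring.
  apply: (le_lt_trans (le_sqB2 (measurable_funB mdp mpsi) md)).
  exact: lte_sum2 (sq_ge0 _) (sq_ge0 _) H1 Hs1.
- have mdN : measurable_fun setT (fun x => - (dil s p x - p x)) by exact: measurableT_comp.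
  have -> : en (fun x => p x - psi x) =
      en (fun x => (dil s p x - psi x) + - (dil s p x - p x)).
    by apply: eq_en => x; ring.
  apply: (le_lt_trans (le_enD ltr01 (measurable_funB mdp mpsi) mdN)).
  have -> : en (fun x => - (dil s p x - p x)) = en (fun x => dil s p x - p x).
    exact: enN.
  rewrite invr1 -ge0_muleDr ?en_ge0//.
  exact: lte_sum2 (en_ge0 _) (en_ge0 _) H2 Hs2.
Qed.

End density.

(** * The Gamma function and digamma(1/4) *)

Section log_calculus.
Context {R : realType}.

(** Subtracting the tangent and setting the remainder to 0 outside the radius r reduces this to the
    global criterion [is_derive0_quadratic]. *)
Lemma is_derive_quadratic (f : R -> R) (x l C r : R) : 0 < r ->
  (forall d, `|d| <= r -> `|f (x + d) - f x - d * l| <= C * d ^+ 2) -> is_derive x (1 : R) f l.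
Proof.
move=> r0 H.
pose g y := if `|y - x| <= r then f y - f x - (y - x) * l else 0.
have gx : g x = 0 by rewrite /g subrr normr0 ltW// subrr mul0r subr0.
have C0 : 0 <= C.
  have := H r; rewrite ger0_norm ?(ltW r0)// => /(_ (lexx _)) /(le_trans (normr_ge0 _)).
  by rewrite pmulr_lge0// exprn_gt0.
have dg : is_derive x (1 : R) g 0.
  apply: (@is_derive0_quadratic _ _ _ C) => y; rewrite gx subr0 /g.
  case: ifPn => yx; last by rewrite normr0 mulr_ge0 ?sqr_ge0.
  by have := H _ yx; rewrite [x + _]addrC subrK.
have := is_derive_add dg (is_derive_affine x l (f x - x * l)).
rewrite add0r; apply: near_eq_is_derive.
near=> y.
have yr : `|y - x| <= r by rewrite distrC; near: y; apply: cvgr_dist_le => //; exact: cvg_id.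
rewrite /g yr; ring.
Unshelve. all: by end_near. Qed.

Lemma ln_diff_le (z d : R) : 0 < z -> 0 < z + d -> ln (z + d) - ln z <= d / z.
Proof.
move=> z0 zd.
have -> : z + d = z * (1 + d / z) by field; exact: lt0r_neq0.
have h : 0 < 1 + d / z by have := divr_gt0 zd z0; rewrite mulrDl divff ?lt0r_neq0.
rewrite lnM ?posrE// addrAC subrr add0r; apply: le_ln1Dx; lra.
Qed.

Lemma ln_diff_ge (z d : R) : 0 < z -> 0 < z + d -> d / (z + d) <= ln (z + d) - ln z.
Proof.
move=> z0 zd; have := @ln_diff_le (z + d) (- d) zd; rewrite addrK => /(_ z0); lra.
Qed.

Lemma ln_diff_quadratic (z d : R) : 0 < z -> `|d| <= z / 2 ->
  `|ln (z + d) - ln z - d / z| <= 2 * d ^+ 2 / z ^+ 2.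
Proof.
move=> z0; rewrite ler_norml => /andP[d1 d2].
have zd : 0 < z + d by lra.
have h1 := ln_diff_le z0 zd.
have h2 := ln_diff_ge z0 zd.
have h3 : d / z - d / (z + d) <= 2 * d ^+ 2 / z ^+ 2.
  have -> : d / z - d / (z + d) = d ^+ 2 / (z * (z + d)).
    by field; rewrite !lt0r_neq0.
  rewrite ler_pdivrMr ?mulr_gt0// mulrAC ler_pdivlMr ?exprn_gt0//.
  have := sqr_ge0 d; nra.
rewrite ler_norml; apply/andP; split; first by lra.
have : 0 <= 2 * d ^+ 2 / z ^+ 2 by rewrite divr_ge0 ?sqr_ge0// mulr_ge0 ?sqr_ge0.
lra.
Qed.

End log_calculus.

(** * Derivative of a convex solution of L (x + 1) = L x + ln x *)

Section log_convex.
Context {R : realType}.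
Variable L : R -> R.
Hypothesis LS : forall x, 0 < x -> L (x + 1) = L x + ln x.
(** Convexity between y and y + 1, with L (y + 1) eliminated by [LS]. *)
Hypothesis L_le : forall y d, 0 < y -> 0 <= d -> d <= 1 -> L (y + d) <= d * ln y + L y.

(** The upper bound is [L_le]; the lower one comes from [L_le] on the step from y + d to y + 1,
    combined with [LS]. *)
Lemma lnGamma_incr (y d : R) : 0 < y -> 0 <= d -> d <= 1 ->
  d * (ln y - y^-1) <= L (y + d) - L y /\ L (y + d) - L y <= d * ln y.
Proof.
move=> y0 d0 d1.
have upper (z e : R) : 0 < z -> 0 <= e -> e <= 1 -> L (z + e) - L z <= e * ln z.
  by move=> z0 e0 e1; rewrite lerBlDr; exact: L_le.
have yd : 0 < y + d by lra.
split; last exact: upper.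
have h := upper (y + d) (1 - d) yd.
have : L (y + 1) - L (y + d) <= (1 - d) * ln (y + d).
  by rewrite (_ : y + 1 = y + d + (1 - d)); [apply: h; lra | ring].
rewrite LS//.
have h2 := ln_diff_le y0 yd.
have d1' : 0 <= 1 - d by lra.
have h3 := ler_wpM2l d1' h2.
have yi : 0 < y^-1 by rewrite invr_gt0.
have : d * d * y^-1 >= 0 by rewrite !mulr_ge0// ltW.
move: h3; rewrite !mulrBr !mulrBl !mul1r mulrA => h3 h4 h5; lra.
Qed.

(** For negative d the base point becomes y + d >= y - 1, which is the origin of the denominator.
    The bound tends to 0 as y grows, uniformly in d. *)
Lemma lnGamma_step (y d : R) : 1 < y -> `|d| <= 1 ->
  `|L (y + d) - L y - d * ln y| <= 2 / (y - 1).
Proof.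
move=> y1; rewrite ler_norml => /andP[d1 d2].
have y0 : 0 < y by lra.
have w0 : 0 < y - 1 by lra.
have q0 : 0 < (y - 1)^-1 by rewrite invr_gt0.
case: (leP 0 d) => d0.
  have [h1 h2] := lnGamma_incr y0 d0 d2.
  have h3 : d * y^-1 <= (y - 1)^-1.
    apply: (@le_trans _ _ (1 * y^-1)); first by rewrite ler_wpM2r ?invr_ge0// ltW.
    rewrite mul1r lef_pV2 ?posrE//; lra.
  rewrite ler_norml; move: h1 h2; rewrite mulrBr; lra.
have [w|] := ltP 0 (y + d); last by lra.
have e0 : 0 <= - d by lra.
have e1 : - d <= 1 by lra.
have [h1 h2] := lnGamma_incr w e0 e1.
move: h1 h2; rewrite addrK => h1 h2.
have yw : y - 1 <= y + d by lra.
have h3 : (y + d)^-1 <= (y - 1)^-1 by rewrite lef_pV2 ?posrE.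
have h4 : - d * (y + d)^-1 <= (y - 1)^-1.
  by rewrite -[leRHS]mul1r ler_pM ?invr_ge0// ltW.
have lny : 0 <= ln y - ln (y + d) by rewrite subr_ge0 ler_ln ?posrE//; lra.
have lny2 : ln y - ln (y + d) <= (y - 1)^-1.
  have := @ln_diff_le _ (y + d) (- d) w; rewrite addrK => /(_ y0); lra.
have h5 : - d * (ln y - ln (y + d)) <= (y - 1)^-1.
  by rewrite -[leRHS]mul1r ler_pM.
have h6 := mulr_ge0 e0 lny.
rewrite ler_norml; move: h1 h2 h4 h5 h6; rewrite !mulrBr; lra.
Qed.

Lemma lnGamma_sum (x : R) n : 0 < x ->
  L (x + n%:R) = L x + \sum_(k < n) ln (x + k%:R).
Proof.
move=> x0; elim: n => [|n IH]; first by rewrite addr0 big_ord0 addr0.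
rewrite big_ord_recr/= addrA -IH -addn1 natrD addrA.
have xn : 0 < x + n%:R by rewrite ltr_wpDr.
by rewrite LS.
Qed.

Lemma sum_inv_sqr (x : R) n : 0 < x ->
  \sum_(k < n.+1) (x + k%:R) ^- 2 <= x ^- 2 + x^-1 - (x + n%:R)^-1.
Proof.
move=> x0; elim: n => [|n IH].
  by rewrite big_ord1 !addr0 addrK.
rewrite big_ord_recr/=.
have xn : 0 < x + n%:R by rewrite ltr_wpDr.
have xn1 : 0 < x + n.+1%:R by rewrite ltr_wpDr.
have h : (x + n.+1%:R) ^- 2 <= (x + n%:R)^-1 - (x + n.+1%:R)^-1.
  have e : n.+1%:R = n%:R + 1 :> R by rewrite -natr1.
  have -> : (x + n%:R)^-1 - (x + n.+1%:R)^-1 = ((x + n%:R) * (x + n.+1%:R))^-1.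
    rewrite e in xn1 *; field.
    by rewrite (lt0r_neq0 xn1) (lt0r_neq0 xn).
  rewrite lef_pV2 ?posrE ?mulr_gt0 ?exprn_gt0// expr2 ler_pM2r// lerD2l ler_nat//.
lra.
Qed.

(** The functional equation moves the increment of L from x to x + n. There [lnGamma_step] makes it
    d ln (x + n) up to o(1), while the n logarithms collected on the way differ from their
    linearizations by O(d^2) in total, uniformly in n by [sum_inv_sqr]. Letting n tend to infinity
    leaves a quadratic remainder. *)
Lemma is_derive_lnGamma (x l : R) : 0 < x ->
  ln (x + n%:R) - \sum_(k < n) (x + k%:R)^-1 @[n --> \oo] --> l ->
  is_derive x (1 : R) L l.
Proof.
move=> x0 cl.
have r0 : 0 < Num.min (x / 2) 1 by rewrite lt_min ltr01 andbT divr_gt0.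
apply: (@is_derive_quadratic R L x l (2 * (x ^- 2 + x^-1)) _ r0) => d.
rewrite le_min => /andP[dx d1].
have xd : 0 < x + d by move: dx; rewrite ler_norml => /andP[]; lra.
(* With the index n + 2 the error of [lnGamma_step] is at most 2/(n + 1), a multiple of the harmonic
   sequence. *)
have B n : `|L (x + d) - L x - d * (ln (x + n.+2%:R) - \sum_(k < n.+2) (x + k%:R)^-1)|
    <= 2 / n.+1%:R + 2 * (x ^- 2 + x^-1) * d ^+ 2.
  have xn : 1 < x + n.+2%:R by rewrite ltr_pwDl// ler1n.
  have h1 := lnGamma_step xn d1.
  have h2 : 2 / (x + n.+2%:R - 1) <= 2 / n.+1%:R.
    rewrite ler_pM2l// lef_pV2 ?posrE//.
    + by rewrite -[n.+2]addn1 natrD; lra.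
    + by rewrite -[n.+2]addn1 natrD addrA addrK ltr_pwDl.
  have h3 : `|\sum_(k < n.+2) (ln (x + k%:R + d) - ln (x + k%:R) - d / (x + k%:R))| <=
      2 * (x ^- 2 + x^-1) * d ^+ 2.
    apply: (le_trans (ler_norm_sum _ _ _)).
    apply: (@le_trans _ _ (\sum_(k < n.+2) 2 * d ^+ 2 * (x + k%:R) ^- 2)).
      apply: ler_sum => k _; apply: ln_diff_quadratic; first by rewrite ltr_wpDr.
      by apply: (le_trans dx); rewrite ler_pM2r// lerDl.
    rewrite -mulr_sumr mulrAC ler_wpM2r ?sqr_ge0// ler_pM2l//.
    apply: (le_trans (sum_inv_sqr _ x0)).
    by rewrite gerBl invr_ge0 addr_ge0// ltW.
  have E : L (x + d) - L x - d * (ln (x + n.+2%:R) - \sum_(k < n.+2) (x + k%:R)^-1) =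
     (L (x + n.+2%:R + d) - L (x + n.+2%:R) - d * ln (x + n.+2%:R)) -
     \sum_(k < n.+2) (ln (x + k%:R + d) - ln (x + k%:R) - d / (x + k%:R)).
    rewrite [x + _ + d]addrAC (lnGamma_sum n.+2 xd) (lnGamma_sum n.+2 x0) !sumrB -mulr_sumr.
    have -> : \sum_(k < n.+2) ln (x + k%:R + d) = \sum_(k < n.+2) ln (x + d + k%:R).
      by apply: eq_bigr => k _; rewrite addrAC.
    ring.
  rewrite E; apply: (le_trans (ler_normB _ _)); apply: lerD h3.
  exact: le_trans h1 h2.
have c1 : `|L (x + d) - L x - d * (ln (x + n.+2%:R) - \sum_(k < n.+2) (x + k%:R)^-1)| @[n --> \oo]
    --> `|L (x + d) - L x - d * l|.
  apply: cvg_norm; apply: cvgB; first exact: cvg_cst.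
  apply: cvgM; first exact: cvg_cst.
  have := cl; rewrite -cvg_shiftS => cl1.
  by rewrite -(cvg_shiftS (fun n : nat => ln (x + n.+1%:R) - \sum_(k < n.+1) (x + k%:R)^-1)) in cl1.
have c2 : 2 / n.+1%:R + 2 * (x ^- 2 + x^-1) * d ^+ 2 @[n --> \oo] --> 2 * (x ^- 2 + x^-1) * d ^+ 2.
  have c0 : 2 / n.+1%:R @[n --> \oo] --> (2 * 0 : R).
    by apply: cvgM; [exact: cvg_cst | exact: cvg_harmonic].
  set K := 2 * _ * _; rewrite mulr0 in c0.
  by rewrite -[X in _ --> X]add0r; apply: cvgD c0 _; exact: cvg_cst.
by apply: ler_cvg_to c1 c2 _; apply: nearW => n; exact: B.
Qed.

End log_convex.

(** * The Gamma integral, its logarithmic convexity, and digamma(1/4) *)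

Section gamma_function.
Context {R : realType}.
Notation mu := (@lebesgue_measure R).
Implicit Types (x y t d : R).

Definition gint x t : R := t `^ (x - 1) * expR (- t).

(** The extended-real version of [Gamma_fun]: the functional equation is proved before finiteness
    and then used to establish it. *)
Definition eGamma x : \bar R := (\int[mu]_(t in `]0%R, +oo[) (gint x t)%:E)%E.

Lemma gint_ge0 x t : 0 <= gint x t.
Proof. by rewrite mulr_ge0 ?powR_ge0 ?expR_ge0. Qed.

Lemma measurable_gint x : measurable_fun setT (gint x).
Proof.
apply: measurable_funM; first exact: measurable_powR.
by apply: measurableT_comp => //; exact: measurable_funN.
Qed.

Lemma measurable_egint x (D : set (measurableTypeR R)) : measurable D ->
  measurable_fun D (fun t : R => (gint x t)%:E).
Proof.
move=> mD; apply/measurable_EFinP.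
by apply: measurable_funS (measurable_gint x).
Qed.

Lemma is_derive_gint x t : 0 < t ->
  is_derive t (1 : R) (gint (x + 1)) (x * gint x t - gint (x + 1) t).
Proof.
move=> t0.
have h1 : is_derive t (1 : R) (fun s => s `^ x) (x * t `^ (x - 1)).
  exact: is_derive1_powR.
have h2 := is_derive_expR_comp (is_derive_opp (is_derive_id t (1 : R))).
have -> : gint (x + 1) = (fun s => s `^ x * expR (- s)).
  by apply/funext => s; rewrite /gint addrK.
apply: is_derive_eq (is_derive_mul h1 h2) _.
rewrite /gint; ring.
Qed.

Lemma continuous_gint x t : 0 < t -> {for t, continuous (gint x)}.
Proof.
by move=> t0; rewrite -(subrK 1 x); exact: is_derive_cont (is_derive_gint (x - 1) t0).
Qed.

Lemma within_continuous_gint x a b : 0 < a ->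
  {within `[a, b], continuous (gint x)}.
Proof.
move=> a0; apply: continuous_in_subspaceT => t /set_mem/=; rewrite in_itv/= => /andP[at_ _].
by apply: continuous_gint; exact: lt_le_trans at_.
Qed.

Lemma gint_parts x a b : 0 < a -> a < b ->
  (\int[mu]_(t in `[a, b]) (x * gint x t)%:E =
   \int[mu]_(t in `[a, b]) (gint (x + 1) t)%:E + (gint (x + 1) b - gint (x + 1) a)%:E)%E.
Proof.
move=> a0 ab.
have pos t : t \in `]a, b[ -> 0 < t.
  by rewrite in_itv/= => /andP[/(lt_trans a0)].
have I y : mu.-integrable `[a, b] (EFin \o gint y).
  by apply: continuous_compact_integrable;
    [exact: segment_compact | exact: within_continuous_gint].
have D t : 0 < t -> is_derive t (1 : R) (gint (x + 1)) (x * gint x t - gint (x + 1) t).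
  exact: is_derive_gint.
have := @continuous_FTC2 R (fun t => x * gint x t - gint (x + 1) t) (gint (x + 1)) a b ab.
have c : {within `[a, b], continuous (fun t => x * gint x t - gint (x + 1) t)}.
  apply: continuous_in_subspaceT => t /set_mem/=; rewrite in_itv/= => /andP[at_ _].
  have t0 := lt_le_trans a0 at_.
  apply: cvgB; last exact: continuous_gint.
  apply: cvgM; first exact: cvg_cst. exact: continuous_gint.
move=> /(_ c); rewrite EFinB => <-.
- have mD : measurable (`[a, b]%classic : set (measurableTypeR R)) by exact: measurable_itv.
  have Ix : mu.-integrable `[a, b] (EFin \o (fun t => x * gint x t)).
    have := integrableZl mD x (I x).
    by apply: eq_integrable => // t _ /=; rewrite EFinM.
  have -> : (\int[mu]_(t in `[a, b]) (x * gint x t - gint (x + 1) t)%:E =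
     \int[mu]_(t in `[a, b]) (x * gint x t)%:E - \int[mu]_(t in `[a, b]) (gint (x + 1) t)%:E)%E.
    exact: (integralB_EFin mD Ix (I (x + 1))).
  rewrite addeC subeK//; exact: (integrable_fin_num mD (I (x + 1))).
- split.
  + by move=> t /pos /D[].
  + by apply: cvg_at_right_filter; exact: continuous_gint.
  + by apply: cvg_at_left_filter; apply: continuous_gint; exact: lt_trans ab.
- by move=> t /pos /D /is_derive_derive1.
Qed.

(** Compact segments exhausting the open half-line; the offset 2 makes them nondegenerate from n = 0
    on. *)
Definition pos_seg (n : nat) : set R := `[n.+2%:R^-1, n.+2%:R]%classic.

Lemma bigcup_pos_seg : \bigcup_n pos_seg n = `]0, +oo[%classic.
Proof.
apply/seteqP; split => t /=.
  by move=> [n _]; rewrite /pos_seg/= !in_itv/= andbT => /andP[+ _]; apply: lt_le_trans.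
rewrite in_itv/= andbT => t0.
exists (maxn (Num.truncn t) (Num.truncn t^-1)) => //=.
rewrite /pos_seg/= in_itv/=; apply/andP; split.
  rewrite -[leRHS]invrK lef_pV2 ?posrE ?invr_gt0//.
  apply: (le_trans (ltW (truncnS_gt _))).
  by rewrite ler_nat ltnS (leq_trans (leq_maxr (Num.truncn t) _)).
apply: (le_trans (ltW (truncnS_gt _))).
by rewrite ler_nat ltnS (leq_trans (leq_maxl _ (Num.truncn t^-1))).
Qed.

Lemma nondecreasing_pos_seg : nondecreasing_seq pos_seg.
Proof.
move=> m n mn; apply/subsetPset => t; rewrite /pos_seg/= !in_itv/= => /andP[h1 h2].
rewrite (le_trans _ h1) ?(le_trans h2) ?ler_nat//.
by rewrite lef_pV2 ?posrE// ler_nat.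
Qed.

Lemma cvg_pos_seg (f : R -> R) : measurable_fun setT f -> (forall t, 0 <= f t) ->
  ((\int[mu]_(t in pos_seg n) (f t)%:E)%E @[n --> \oo]) --> (\int[mu]_(t in `]0%R, +oo[) (f t)%:E)%E.
Proof.
move=> mf f0; rewrite -bigcup_pos_seg.
apply: ge0_nondecreasing_set_cvg_integral => //.
- exact: nondecreasing_pos_seg.
- by move=> n; exact: measurable_itv.
- by move=> n; apply/measurable_EFinP; exact: measurable_funS mf.
- by move=> n t _; rewrite lee_fin.
Qed.

(** Raise t/x <= e^(t/x) to the power -x. *)
Lemma gint_le x t : 0 < x -> 0 < t -> gint x t <= x `^ x / t.
Proof.
move=> x0 t0.
have h : expR (- t) <= (t / x) `^ (- x).
  have -> : expR (- t) = expR (t / x) `^ (- x).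
    by rewrite /powR gt_eqF ?expR_gt0// expRK; congr expR; field; exact: lt0r_neq0.
  rewrite !powRN lef_pV2 ?posrE ?powR_gt0 ?expR_gt0 ?divr_gt0//.
  apply: ge0_ler_powR; rewrite ?nnegrE ?divr_ge0 ?expR_ge0 ?ltW//.
  by have := expR_gt1Dx (lt0r_neq0 (divr_gt0 t0 x0)); lra.
apply: (le_trans (ler_wpM2l (powR_ge0 _ _) h)).
rewrite powRM ?invr_ge0 ?(ltW t0) ?(ltW x0)//.
have -> : x^-1 `^ (- x) = x `^ x.
  by rewrite -(powR_inv1 (ltW x0)) -powRrM mulN1r opprK.
rewrite mulrA -powRD ?(gt_eqF t0) ?implybT//.
have -> : x - 1 - x = -1 by ring.
by rewrite (powR_inv1 (ltW t0)) mulrC.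
Qed.

Lemma cvg_gint_y x : 0 < x -> gint x n.+2%:R @[n --> \oo] --> 0.
Proof.
move=> x0.
have h : x `^ x * (n.+1%:R)^-1 @[n --> \oo] --> 0.
  rewrite -[X in _ --> X](mulr0 (x `^ x)); apply: cvgM; first exact: cvg_cst.
  exact: cvg_harmonic.
apply: (squeeze_cvgr _ (cvg_cst 0) h).
apply: nearW => n; rewrite gint_ge0/=.
apply: le_trans (gint_le x0 (ltr0Sn _ _)) _.
by rewrite ler_wpM2l ?powR_ge0// lef_pV2 ?posrE// ler_nat.
Qed.

Lemma cvg_gint_0 x : 0 < x -> gint (x + 1) n.+2%:R^-1 @[n --> \oo] --> 0.
Proof.
move=> x0.
have h : (n.+2%:R^-1 : R) `^ x @[n --> \oo] --> 0.
  have := powR_cvg0 x0 => /cvg_at_rightP; apply; split; first by [].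
  by have := @cvg_harmonic R; rewrite -(cvg_shiftS).
apply: (squeeze_cvgr _ (cvg_cst 0) h).
apply: nearW => n; rewrite gint_ge0/= /gint addrK.
by rewrite ler_piMr ?powR_ge0// -expR0 ler_expR oppr_le0.
Qed.

(** Integration by parts on [pos_seg n]. The boundary terms are finite and tend to 0, so they may be
    subtracted in the limit even while the integrals could still be infinite. *)
Lemma eGammaS x : 0 < x -> eGamma (x + 1) = (x%:E * eGamma x)%E.
Proof.
move=> x0.
have m y : measurable_fun setT (gint y) by exact: measurable_gint.
have <- : (\int[mu]_(t in `]0%R, +oo[) (x * gint x t)%:E = x%:E * eGamma x)%E.
  rewrite -ge0_integralZl_EFin//=; last exact: ltW.
  - by move=> t _; rewrite lee_fin gint_ge0.
  - exact: measurable_egint.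
have := cvg_pos_seg (m (x + 1)) (gint_ge0 _).
have mx : measurable_fun setT (fun t : R => x * gint x t).
  by apply: measurable_funM => //; exact: measurable_cst.
have x0' t : 0 <= x * gint x t by rewrite mulr_ge0 ?gint_ge0// ltW.
have := cvg_pos_seg mx x0'.
have E n : (\int[mu]_(t in pos_seg n) (x * gint x t)%:E =
   \int[mu]_(t in pos_seg n) (gint (x + 1) t)%:E +
   (gint (x + 1) n.+2%:R - gint (x + 1) n.+2%:R^-1)%:E)%E.
  apply: gint_parts; first by rewrite invr_gt0.
  by rewrite (@lt_trans _ _ 1)// ?ltr1n// invf_lt1// ltr1n.
under eq_fun do rewrite E.
move=> c1 c2; apply: cvg_unique c2 _ => //.
have c3 : (gint (x + 1) n.+2%:R - gint (x + 1) n.+2%:R^-1)%:E @[n --> \oo] --> (0%:E : \bar R).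
  apply: cvg_EFin; first exact: nearW.
  rewrite -[X in _ --> X](subr0 0); apply: cvgB.
    by apply: cvg_gint_y; rewrite addr_gt0.
  exact: cvg_gint_0.
suff : ((\int[mu]_(t in pos_seg n) (gint (x + 1) t)%:E)%E @[n --> \oo] -->
   (\int[mu]_(t in `]0%R, +oo[) (x * gint x t)%:E - 0))%E by rewrite sube0.
have d : (\int[mu]_(t in `]0%R, +oo[) (x * gint x t)%:E +? - 0%:E)%E by rewrite fin_num_adde_defl.
rewrite -[0%R]/(0%R : R).
have E' : (fun n => (\int[mu]_(t in pos_seg n) (gint (x + 1) t)%:E)%E) = (fun n =>
    (\int[mu]_(t in pos_seg n) (gint (x + 1) t)%:E +
     (gint (x + 1) n.+2%:R - gint (x + 1) n.+2%:R^-1)%:E) -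
    (gint (x + 1) n.+2%:R - gint (x + 1) n.+2%:R^-1)%:E)%E.
  by apply/funext => n; rewrite addeK.
rewrite E'; exact: (cvgeB d c1 c3).
Qed.

Lemma eGamma_gt0 x : (0 < eGamma x)%E.
Proof.
apply: (@lt_le_trans _ _ (\int[mu]_(t in `[1%R, 2%R]) (gint x t)%:E)%E); last first.
  apply: ge0_subset_integral => //=.
  - exact: measurable_egint.
  - by move=> t _; rewrite lee_fin gint_ge0.
  - by move=> t /=; rewrite !in_itv/= andbT => /andP[+ _]; apply: lt_le_trans.
(* The power is monotone in t, so its minimum on [1, 2] is attained at an endpoint. *)
pose m := Num.min (1 `^ (x - 1)) (2 `^ (x - 1)) * expR (- 2).
have m0 : 0 < m by rewrite mulr_gt0 ?expR_gt0// lt_min !powR_gt0.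
apply: (@lt_le_trans _ _ (\int[mu]_(t in `[1%R, 2%R]) (cst m%:E) t)%E).
  rewrite integral_cst/=; last exact: measurable_itv.
  by rewrite lebesgue_measure_itv/= lte_fin ltr1n -EFinB -EFinM lte_fin mulr_gt0// subr_gt0 ltr1n.
apply: ge0_le_integral => //=.
- by move=> t _; rewrite lee_fin ltW.
- exact: measurable_egint.
move=> t; rewrite in_itv/= => /andP[t1 t2]; rewrite lee_fin.
rewrite /m /gint; apply: ler_pM; [by rewrite le_min !powR_ge0 | exact: expR_ge0 | | by rewrite ler_expR lerN2].
rewrite ge_min; case: (leP 0 (x - 1)) => x1.
  by apply/orP; left; rewrite ge0_ler_powR ?nnegrE// (le_trans _ t1).
apply/orP; right; rewrite -[x - 1]opprK !(powRN _ (- (x - 1))) lef_pV2 ?posrE ?powR_gt0//; last first.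
  exact: lt_le_trans t1.
by rewrite ge0_ler_powR ?nnegrE ?oppr_ge0 ?(ltW x1)// (le_trans _ t1).
Qed.

Lemma eGamma1 : eGamma 1 = 1%E.
Proof.
rewrite -[RHS]/(1%:E) -[X in X%:E]invr1 -integral_expR_neg//.
apply: eq_integral => t _; rewrite /gint subrr powRr0 !mul1r.
by congr (expR _)%:E.
Qed.

Lemma eGamma_nat n : (eGamma n.+1%:R < +oo)%E.
Proof.
elim: n => [|n IH]; first by rewrite eGamma1 ltry.
have IH' : eGamma n.+1%:R \is a fin_num by rewrite ge0_fin_numE// ltW// eGamma_gt0.
rewrite (_ : n.+2%:R = n.+1%:R + 1); last by rewrite -[in LHS]addn1 natrD.
by rewrite eGammaS ?ltr0Sn// -(fineK IH') -EFinM ltry.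
Qed.

(** For y >= 1 the power t^(y-1) is at most 1 + t^N with N the integer part of y, which reduces to
    integer arguments. Small x follow from x + 1 by the functional equation. *)
Lemma eGamma_lty x : 0 < x -> (eGamma x < +oo)%E.
Proof.
have fin1 y : 1 <= y -> (eGamma y < +oo)%E.
  move=> y1.
  pose N := Num.truncn y.
  apply: (@le_lt_trans _ _ (eGamma 1 + eGamma N.+1%:R)%E); last first.
    by apply: (@lte_add_pinfty _ (eGamma 1) (eGamma N.+1%:R)); [rewrite eGamma1 ltry | exact: eGamma_nat].
  rewrite /eGamma -ge0_integralD//=; last 4 first.
  - by move=> t _; rewrite lee_fin gint_ge0.
  - exact: measurable_egint.
  - by move=> t _; rewrite lee_fin gint_ge0.
  - exact: measurable_egint.
  apply: ge0_le_integral => //=.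
  - by move=> t _; rewrite lee_fin gint_ge0.
  - exact: measurable_egint.
  - by apply: emeasurable_funD; exact: measurable_egint.
  move=> t; rewrite in_itv/= andbT => t0; rewrite -EFinD lee_fin /gint -mulrDl.
  rewrite ler_wpM2r ?expR_ge0// subrr powRr0.
  have yN : y - 1 <= N.+1%:R - 1 by rewrite lerD2r ltW// truncnS_gt.
  case: (leP t 1) => t1.
    apply: (@le_trans _ _ 1); last by rewrite lerDl powR_ge0.
    rewrite -[leRHS](powRr0 t); apply: ger_powR; first by rewrite t0.
    by rewrite subr_ge0.
  apply: (@le_trans _ _ (t `^ (N.+1%:R - 1))); last by rewrite lerDr.
  by apply: ler_powR => //; exact: ltW.
move=> x0; have := fin1 (x + 1).
rewrite eGammaS// lerDr => /(_ (ltW x0)).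
have := eGamma_gt0 x; move: (eGamma x) => [r _ _|_|//]; first by rewrite ltry.
by rewrite gt0_muley// lte_fin.
Qed.

Lemma fin_num_eGamma x : 0 < x -> eGamma x \is a fin_num.
Proof. by move=> x0; rewrite ge0_fin_numE ?eGamma_lty// ltW// eGamma_gt0. Qed.

Lemma Gamma_funE x : 0 < x -> (Gamma_fun x)%:E = eGamma x.
Proof. by move=> x0; rewrite -(fineK (fin_num_eGamma x0)). Qed.

Lemma Gamma_fun_gt0 x : 0 < x -> 0 < Gamma_fun x.
Proof. by move=> x0; rewrite -lte_fin Gamma_funE// eGamma_gt0. Qed.

Lemma Gamma_funS x : 0 < x -> Gamma_fun (x + 1) = x * Gamma_fun x.
Proof.
move=> x0; apply: EFin_inj; rewrite EFinM !Gamma_funE ?addr_gt0//.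
exact: eGammaS.
Qed.

(* Weighted AM-GM in the form [(t / y) ^ d <= 1 - d + d (t / y)]. *)
Lemma powR_bernoulli d t y : 0 <= d -> d <= 1 -> 0 < t -> 0 < y ->
  t `^ d <= y `^ d * (1 - d + d / y * t).
Proof.
move=> d0 d1 t0 y0.
have -> : t `^ d = y `^ d * (t / y) `^ d.
  by rewrite -powRM ?divr_ge0 ?ltW//; congr (_ `^ _); field; exact: lt0r_neq0.
rewrite ler_wpM2l ?powR_ge0//.
have ty : 0 < t / y by rewrite divr_gt0.
have -> : d / y * t = d * (t / y) by ring.
move: ty; move: (t / y) => u u0.
have m0 : 0 < 1 - d + d * u.
  case: (leP d (1 / 2)) => d2; first by have := mulr_ge0 d0 (ltW u0); lra.
  have : 0 < d * u by rewrite mulr_gt0//; lra.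
  lra.
have lnB (z : R) : 0 < z -> ln z <= z - 1.
  by move=> z0; have := @le_ln1Dx R (z - 1); rewrite [1 + _]addrC subrK; apply; rewrite ltrBrDl; lra.
have h1 := lnB _ (divr_gt0 u0 m0).
have h2 := lnB _ (divr_gt0 ltr01 m0).
rewrite ln_div ?posrE// in h1; rewrite ln_div ?posrE// ln1 in h2.
have h3 := ler_wpM2l d0 h1.
have d1' : 0 <= 1 - d by lra.
have h4 := ler_wpM2l d1' h2.
(* With m = 1 - d + d u, the bound ln z <= z - 1 at u/m and at 1/m, weighted by d and 1 - d, sums to
   d ln u - ln m <= 0. *)
have E : d * (u / (1 - d + d * u) - 1) + (1 - d) * (1 / (1 - d + d * u) - 1) = 0.
  field; exact: lt0r_neq0.
rewrite -ler_ln ?posrE ?powR_gt0// ln_powR.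
move: h3 h4 E; rewrite !mulrBr !mulrBl !mul1r ?mulr1; lra.
Qed.

(** Integrate [powR_bernoulli] against t^(y-1) e^(-t): since Gamma(y + 1) = y Gamma(y), the affine
    factor integrates to Gamma(y). Its logarithm is the hypothesis [L_le] above. *)
Lemma Gamma_fun_le y d : 0 < y -> 0 <= d -> d <= 1 ->
  Gamma_fun (y + d) <= y `^ d * Gamma_fun y.
Proof.
move=> y0 d0 d1.
rewrite -lee_fin EFinM !Gamma_funE ?ltr_pwDl//.
have c1 : 0 <= y `^ d * (1 - d) by rewrite mulr_ge0 ?powR_ge0// subr_ge0.
have c2 : 0 <= y `^ d * (d / y) by rewrite mulr_ge0 ?powR_ge0// divr_ge0// ltW.
have pos c z t : 0 <= c -> (0 <= (c * gint z t)%:E)%E.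
  by move=> c0; rewrite lee_fin mulr_ge0 ?gint_ge0.
apply: (@le_trans _ _ (\int[mu]_(t in `]0%R, +oo[) ((y `^ d * (1 - d) * gint y t)%:E
   + (y `^ d * (d / y) * gint (y + 1) t)%:E))%E).
  apply: ge0_le_integral => //=.
  - by move=> t _; rewrite lee_fin gint_ge0.
  - exact: measurable_egint.
  - apply: emeasurable_funD; apply/measurable_EFinP; apply: measurable_funM => //;
      exact: measurable_funS (measurable_gint _).
  move=> t; rewrite in_itv/= andbT => t0; rewrite -EFinD lee_fin.
  have := powR_bernoulli d0 d1 t0 y0.
  move=> /(ler_wpM2r (gint_ge0 y t)).
  have -> : t `^ d * gint y t = gint (y + d) t.
    rewrite /gint mulrA -powRD ?(gt_eqF t0) ?implybT//; congr (_ `^ _ * _); ring.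
  move/le_trans; apply; rewrite /gint.
  have -> : t `^ (y + 1 - 1) = t * t `^ (y - 1).
    by rewrite addrK mulr_powRB1// ltW.
  by rewrite le_eqVlt; apply/orP; left; apply/eqP; ring.
rewrite ge0_integralD//=; last 4 first.
- by move=> t _; exact: pos.
- by apply/measurable_EFinP; apply: measurable_funM => //;
    exact: measurable_funS (measurable_gint _).
- by move=> t _; exact: pos.
- by apply/measurable_EFinP; apply: measurable_funM => //;
    exact: measurable_funS (measurable_gint _).
have S c z : 0 <= c -> (\int[mu]_(t in `]0%R, +oo[) (c * gint z t)%:E = c%:E * eGamma z)%E.
  move=> c0; rewrite -ge0_integralZl_EFin//=.
  - by move=> t _; rewrite lee_fin gint_ge0.
  - exact: measurable_egint.
rewrite (S _ _ c1) (S _ _ c2).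
rewrite eGammaS// -Gamma_funE// -!EFinM -EFinD lee_fin.
by rewrite le_eqVlt; apply/orP; left; apply/eqP; field; exact: lt0r_neq0.
Qed.

(** Gamma is differentiated as the exponential of ln Gamma, so the logarithmic derivative is the
    limit l directly. *)
Lemma digammaE (x l : R) : 0 < x ->
  ln (x + n%:R) - \sum_(k < n) (x + k%:R)^-1 @[n --> \oo] --> l -> digamma x = l.
Proof.
move=> x0 cl.
have dL : is_derive x (1 : R) (fun y => ln (Gamma_fun y)) l.
  apply: is_derive_lnGamma x0 cl => [y y0|y d y0 d0 d1].
    by rewrite Gamma_funS// lnM ?posrE ?Gamma_fun_gt0// addrC.
  have yd : 0 < y + d by rewrite ltr_pwDl.
  have := Gamma_fun_le y0 d0 d1.
  have Gy := Gamma_fun_gt0 y0; have py := powR_gt0 d y0.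
  by rewrite -ler_ln ?posrE ?(mulr_gt0 py Gy) ?(Gamma_fun_gt0 yd)// (lnM py Gy) ln_powR.
have dG : is_derive x (1 : R) Gamma_fun (l * Gamma_fun x).
  have := is_derive_expR_comp dL; rewrite (lnK (Gamma_fun_gt0 x0)) mulrC; apply: near_eq_is_derive.
  near=> y; have y0 : 0 < y by near: y; exact: lt_nbhsr.
  by rewrite (lnK (Gamma_fun_gt0 y0)).
by rewrite /digamma (is_derive_derive1 dG) (mulfK (lt0r_neq0 (Gamma_fun_gt0 x0))).
Unshelve. all: by end_near. Qed.

(** [euler_mascheroni] is a bare [limn], so its convergence has to be supplied: from index 1 on the
    sequence decreases and stays nonnegative. *)
Lemma cvg_euler : series harmonic n - ln n%:R @[n --> \oo] --> (euler_mascheroni : R).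
Proof.
rewrite /euler_mascheroni; apply/cvg_ex.
pose u n : R := series harmonic n.+1 - ln n.+1%:R.
have H n : harmonic n.+1 <= ln n.+2%:R - ln n.+1%:R :> R /\
   ln n.+2%:R - ln n.+1%:R <= harmonic n :> R.
  have e : n.+2%:R = n.+1%:R + 1 :> R by rewrite -[n.+2]addn1 natrD.
  have h1 := @ln_diff_ge R n.+1%:R 1 (ltr0Sn _ _).
  have h2 := @ln_diff_le R n.+1%:R 1 (ltr0Sn _ _).
  move: h1 h2; rewrite -e !div1r => h1 h2; by split; [exact: h1 | exact: h2].
have S n : series harmonic n.+1 = series harmonic n + harmonic n :> R.
  by rewrite /series/= big_nat_recr.
have cu : cvgn u.
  apply: (@nonincreasing_is_cvgn _ u).
    apply/nonincreasing_seqP => n; rewrite /u (S n.+1); have [] := H n; lra.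
  have lnH n : ln n.+1%:R <= series harmonic n :> R.
    elim: n => [|n IH]; first by rewrite ln1 /series/= big_nil.
    by rewrite S; have [] := H n; lra.
  exists 0 => _ [n _ <-]; rewrite /u S subr_ge0.
  by apply: (le_trans (lnH n)); rewrite lerDl invr_ge0.
by exists (limn u); rewrite -cvg_shiftS.
Qed.

(** The k-th term is 2 jterm k + 2/(2k+1), and the reciprocals of the first n odd numbers sum to
    H_2n - H_n / 2. *)
Lemma sum_quarter n : \sum_(k < n) (1 / 4 + k%:R : R)^-1 =
  2 * series jterm n + 2 * series harmonic n.*2 - series harmonic n.
Proof.
rewrite /series/= !big_mkord; elim: n => [|n IH]; first by rewrite !big_ord0; ring.
rewrite doubleS !big_ord_recr/= IH /jterm /kb.
have e : n.*2.+1%:R = 2 * n%:R + 1 :> R by rewrite -natr1 -muln2 natrM mulrC.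
rewrite [n.*2.+2%:R]mulrSr e -[n.+1%:R]natr1.
by field; rewrite !lt0r_neq0//; have := ler0n R n; lra.
Qed.

Lemma digamma_quarter : digamma (1 / 4) = ln pi - weil_cst :> R.
Proof.
have q0 : 0 < 1 / 4 :> R by lra.
(* Written in the shape of the limit assembled below: 0 comes from ln (n + 1/4) - ln n, the two
   Euler constants from H_2n and H_n, and ln 2 from ln (2n) - ln n. *)
have -> : ln pi - weil_cst = 0 - 2 * jsum - 2 * euler_mascheroni + euler_mascheroni - 2 * ln 2 :> R.
  have e : 4 = 2 ^+ 2 :> R by rewrite -natrX.
  rewrite /weil_cst e lnM ?posrE ?pi_gt0 ?exprn_gt0// lnXn// mulr2n; ring.
apply: digammaE => //; rewrite -cvg_shiftS.
have c1 : ln (1 / 4 + n.+1%:R) - ln n.+1%:R @[n --> \oo] --> (0 : R).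
  apply: (squeeze_cvgr _ (cvg_cst 0) (@cvg_harmonic R)); apply: nearW => n.
  have n1 : 1 <= n.+1%:R :> R by rewrite ler1n.
  have d : 0 < n.+1%:R + 1 / 4 :> R by lra.
  have h1 := @ln_diff_le R n.+1%:R (1 / 4) (ltr0Sn _ _) d.
  have h2 := @ln_diff_ge R n.+1%:R (1 / 4) (ltr0Sn _ _) d.
  rewrite [1 / 4 + _]addrC; apply/andP; split; first by apply: le_trans h2; rewrite divr_ge0// ltW.
  by apply: (le_trans h1); rewrite -[leRHS]mul1r ler_pM2r ?invr_gt0//; lra.
have c2 : series harmonic n.+1.*2 - ln n.+1.*2%:R @[n --> \oo] --> (euler_mascheroni : R).
  have := @cvg_euler => /(cvg_comp (fun n => n.+1.*2) _).
  apply => //; apply/cvgnyPge => A; near=> n.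
  rewrite -addnn (leq_trans _ (leq_addr _ _))// leqW//; near: n; exact: nbhs_infty_ge.
have c3 : series harmonic n.+1 - ln n.+1%:R @[n --> \oo] --> (euler_mascheroni : R).
  by have := @cvg_euler; rewrite -cvg_shiftS.
have c4 : series jterm n.+1 @[n --> \oo] --> (jsum : R).
  by have := @cvg_jsum R; rewrite -cvg_shiftS.
have E n : ln (1 / 4 + n.+1%:R) - \sum_(k < n.+1) (1 / 4 + k%:R)^-1 =
   ln (1 / 4 + n.+1%:R) - ln n.+1%:R - 2 * series jterm n.+1
   - 2 * (series harmonic n.+1.*2 - ln n.+1.*2%:R) + (series harmonic n.+1 - ln n.+1%:R)
   - 2 * ln 2 :> R.
  rewrite sum_quarter -muln2 natrM lnM ?posrE//; ring.
under eq_fun do rewrite E.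
apply: cvgB; last exact: cvg_cst.
apply: cvgD c3; apply: cvgB; last by apply: cvgM c2; exact: cvg_cst.
by apply: cvgB c1 _; apply: cvgM c4; exact: cvg_cst.
Unshelve. all: by end_near. Qed.

End gamma_function.

(** * The screw function *)

Section kernel.
Context {R : realType}.
Notation mu := (@lebesgue_measure R).
Implicit Types (t T : R).

Definition lser t : R^nat := series (fun n => (kb n) ^- 2 * (1 - expR (- (kb n * t)))).

(** A quarter of the Lerch difference in g, see [lerchE]. Differentiating twice termwise gives -k(t)
    for t > 0, which is how this term produces the energy. *)
Definition lsum t : R := limn (lser t).

Lemma kb2_le n : (kb n) ^- 2 <= 4 * jterm n :> R.
Proof.
have k0 := @kb_gt0 R n.
have k1 : 1 / 2 <= kb n :> R by rewrite /kb lerDr mulr_ge0.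
have k2 : 0 < kb n + 1 / 2 :> R by lra.
have -> : 4 * jterm n = 2 / (kb n * (kb n + 1 / 2)) :> R.
  rewrite /jterm; move: k0 k2; move: (kb n) => k k0 k2; field.
  have k3 : 0 < k * 2 + 1 by lra.
  by rewrite (lt0r_neq0 k0) (lt0r_neq0 k3).
rewrite ler_pdivlMr ?mulr_gt0// mulrC ler_pdivrMr ?exprn_gt0//; nra.
Qed.

Lemma cvg_kb2 : cvgn (series (fun n => (kb n) ^- 2 : R)).
Proof.
apply: (@series_le_cvg _ _ (fun n => 4 * jterm n)).
- by move=> n; rewrite invr_ge0 exprn_ge0// ltW// kb_gt0.
- by move=> n; rewrite mulr_ge0// jterm_ge0.
- exact: kb2_le.
- have := @cvg_jsum R => h; apply/cvg_ex; exists (4 * jsum).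
  have -> : series (fun n => 4 * jterm n) = (fun n => 4 * series jterm n) :> (nat -> R).
    by apply/funext => n; rewrite /series/= mulr_sumr.
  by apply: cvgM => //; exact: cvg_cst.
Qed.

Lemma lterm_ge0 t n : 0 <= t -> 0 <= (kb n) ^- 2 * (1 - expR (- (kb n * t))).
Proof.
move=> t0; rewrite mulr_ge0 ?invr_ge0 ?exprn_ge0 ?(ltW (kb_gt0 _))// subr_ge0.
by rewrite -expR0 ler_expR oppr_le0 mulr_ge0// ltW// kb_gt0.
Qed.

Lemma lterm_le t n : (kb n) ^- 2 * (1 - expR (- (kb n * t))) <= (kb n) ^- 2.
Proof.
by rewrite ler_piMr ?invr_ge0 ?exprn_ge0 ?(ltW (kb_gt0 _))// gerBl expR_ge0.
Qed.

Lemma cvg_lser t : 0 <= t -> lser t @ \oo --> lsum t.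
Proof.
move=> t0; apply: (@series_le_cvg _ _ (fun n => (kb n) ^- 2)).
- by move=> n; exact: lterm_ge0.
- by move=> n; rewrite invr_ge0 exprn_ge0// ltW// kb_gt0.
- by move=> n; exact: lterm_le.
- exact: cvg_kb2.
Qed.

Lemma lser_ge0 t N : 0 <= t -> 0 <= lser t N.
Proof. by move=> t0; apply: sumr_ge0 => n _; exact: lterm_ge0. Qed.

Lemma lser_le t N : lser t N <= 4 * jsum.
Proof.
apply: (@le_trans _ _ (4 * series jterm N)).
  rewrite /lser /series/= mulr_sumr; apply: ler_sum => n _.
  exact: le_trans (lterm_le t n) (kb2_le n).
rewrite ler_pM2l//; apply: nondecreasing_cvgn_le.
  by apply: nondecreasing_series => n _ _; exact: jterm_ge0.
exact: cvg_jsum.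
Qed.

Lemma lsum_bounds t : 0 <= t -> 0 <= lsum t <= 4 * jsum.
Proof.
move=> t0; apply/andP; split.
  apply: limr_ge; first by apply: cvg_lser t0.
  by apply: nearW => N; exact: lser_ge0.
apply: limr_le; first by apply: cvg_lser t0.
by apply: nearW => N; exact: lser_le.
Qed.

Lemma continuous_lser N : continuous (fun t => lser t N).
Proof.
move=> t; rewrite /lser /series/=; elim: N => [|N IH].
  by under eq_fun do rewrite big_nil; exact: cvg_cst.
under eq_fun do rewrite big_nat_recr//=.
apply: cvgD IH _.
apply: cvgM; first exact: cvg_cst.
apply: cvgB; first exact: cvg_cst.
have := is_derive_cont (is_derive_expR_comp (is_derive_affine t (- kb N) 0)).
rewrite /prop_for /continuous_at addr0 mulNr.
by under eq_fun do rewrite addr0 mulNr.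
Qed.

Lemma measurable_lsum : measurable_fun setT (fun t => lsum `|t|).
Proof.
apply: (@measurable_fun_cvg _ _ _ setT (fun N t => lser `|t| N)) => //.
- move=> N; apply: (@measurableT_comp _ _ _ _ _ _ (fun t : R => lser t N)).
    apply: continuous_measurableT; exact: continuous_lser.
  exact: normr_measurable.
- by move=> t _; exact: cvg_lser.
Qed.

Lemma lerchE t : 0 <= t ->
  lerch 1 2 (1 / 4) - expR (- (t / 2)) * lerch (expR (- (2 * t))) 2 (1 / 4) = 4 * lsum t.
Proof.
move=> t0.
have P n : (n%:R + 1 / 4 : R) `^ (- 2) = 4 * (kb n) ^- 2.
  have h : 0 < n%:R + 1 / 4 :> R by rewrite ltr_wpDl//; lra.
  rewrite (powR_invn 2 (ltW h)) /kb; field.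
  by rewrite !lt0r_neq0//; have := ler0n R n; lra.
have c1 : series (fun n => (n%:R + 1 / 4 : R) `^ (- 2) * 1 ^+ n) @ \oo -->
    4 * limn (series (fun n => (kb n) ^- 2 : R)).
  have -> : series (fun n => (n%:R + 1 / 4 : R) `^ (- 2) * 1 ^+ n) =
      (fun n => 4 * series (fun n => (kb n) ^- 2 : R) n).
    by apply/funext => N; rewrite /series/= mulr_sumr; apply: eq_bigr => n _; rewrite P expr1n mulr1.
  by apply: cvgM; [exact: cvg_cst | exact: cvg_kb2].
have c2 : series (fun n => (n%:R + 1 / 4 : R) `^ (- 2) * expR (- (2 * t)) ^+ n) @ \oo -->
    expR (t / 2) * (4 * (limn (series (fun n => (kb n) ^- 2 : R)) - lsum t)).
  have -> : series (fun n => (n%:R + 1 / 4 : R) `^ (- 2) * expR (- (2 * t)) ^+ n) =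
      (fun n => expR (t / 2) * (4 * (series (fun n => (kb n) ^- 2 : R) n - lser t n))).
    apply/funext => N; rewrite /lser /series/= -sumrB !mulr_sumr; apply: eq_bigr => n _.
    have e : expR (- (2 * t)) ^+ n = expR (t / 2) * expR (- (kb n * t)).
      by rewrite -expRM_natl -expRD /kb; congr expR; ring.
    rewrite P e; ring.
  apply: cvgM; first exact: cvg_cst.
  apply: cvgM; first exact: cvg_cst.
  by apply: cvgB; [exact: cvg_kb2 | exact: cvg_lser].
rewrite /lerch (cvg_lim _ c1)// (cvg_lim _ c2)// mulrA -expRD addNr expR0; ring.
Qed.

Definition pos_part (l t : R) : R := Num.max (t - l) 0.

(** The screw function on |t| <= T, with a range of summation independent of t: positive parts
    replace the condition n <= e^|t|, so the sum can be integrated term by term. *)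
Definition screw_on (T t : R) : R :=
  - 4 * (weight t - 2)
  + \sum_(1 <= n < cutoff T) von_mangoldt n / Num.sqrt n%:R * pos_part (ln n%:R) `|t|
  + weil_cst / 2 * `|t| - lsum `|t|.

Lemma screw_onE T t : `|t| <= T -> screw t = screw_on T t.
Proof.
move=> tT; rewrite /screw /screw_on digamma_quarter lerchE// -/(weight t).
have -> : \sum_(1 <= n < (Num.truncn (expR `|t|)).+1)
    von_mangoldt n / Num.sqrt n%:R * (`|t| - ln n%:R) =
  \sum_(1 <= n < cutoff T) von_mangoldt n / Num.sqrt n%:R * pos_part (ln n%:R) `|t|.
  have c : ((Num.truncn (expR `|t|)).+1 <= cutoff T)%N.
    by rewrite ltnS; apply: le_truncn; rewrite ler_expR.
  rewrite [RHS](big_cat_nat _ c)//= [X in _ = _ + X]big_nat_cond [X in _ = _ + X]big1 ?addr0; last first.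
    move=> n /andP[/andP[n1 _] _]; rewrite /pos_part max_r ?mulr0// subr_le0.
    rewrite -[leLHS]expRK ler_ln ?posrE ?expR_gt0 ?ltr0n ?(leq_trans _ n1)//.
    by apply: ltW; apply: lt_le_trans (truncnS_gt _) _; rewrite ler_nat.
  rewrite big_nat_cond [RHS]big_nat_cond; apply: eq_bigr => n /andP[/andP[n1 n2] _].
  rewrite /pos_part max_l// subr_ge0 -[leRHS]expRK ler_ln ?posrE ?expR_gt0 ?ltr0n//.
  rewrite -truncn_ge_nat ?expR_ge0//.
by field.
Qed.

Lemma screwN t : screw (- t) = screw t.
Proof.
rewrite !(@screw_onE `|t|) ?normrN// /screw_on normrN; congr (_ * (_ - _) + _ + _ - _).
by rewrite /weight mulNr opprK addrC.
Qed.

Lemma measurable_screw_on T : measurable_fun setT (screw_on T).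
Proof.
have mn : measurable_fun setT (fun t : R => `|t|) by exact: normr_measurable.
apply: measurable_funB; last exact: measurable_lsum.
apply: measurable_funD; last by apply: measurable_funM => //; exact: measurable_cst.
apply: measurable_funD.
  apply: measurable_funM; first exact: measurable_cst.
  apply: measurable_funB; last exact: measurable_cst.
  exact: continuous_measurableT continuous_weight.
apply: measurable_sum => n; apply: measurable_funM; first exact: measurable_cst.
apply: measurable_maxr; last exact: measurable_cst.
by apply: measurable_funB => //; exact: measurable_cst.
Qed.

(** For x and y in (-a, a) only the values of g on [-2a, 2a] enter g(x - y); the truncation is an
    integrable kernel. *)
Definition tscrew (T t : R) : R := if `|t| <= T then screw t else 0.

Lemma tscrewE T t : tscrew T t = screw_on T t * \1_(`[- T, T]%classic) t.
Proof.
rewrite /tscrew indicE mem_setE in_itv/= -ler_norml; case: ifPn => tT.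
  by rewrite mulr1 (screw_onE tT).
by rewrite mulr0.
Qed.

Lemma measurable_tscrew T : measurable_fun setT (tscrew T).
Proof.
rewrite (_ : tscrew T = (fun t => screw_on T t * \1_(`[- T, T]%classic) t)); last first.
  by apply/funext => t; exact: tscrewE.
apply: measurable_funM; first exact: measurable_screw_on.
by apply: measurable_indic; exact: measurable_itv.
Qed.

Lemma tscrew_bounded T : exists2 M, 0 <= M & forall t, `|tscrew T t| <= M.
Proof.
pose cn n : R := `|von_mangoldt n / Num.sqrt n%:R|.
pose M := 4 * (expR T + expR T + 2) + \sum_(1 <= n < cutoff T) cn n * T +
   `|weil_cst / 2| * T + 4 * jsum.
have M1 t : `|tscrew T t| <= Num.max 0 M.
  rewrite /tscrew; case: ifPn => tT; last by rewrite normr0 le_max lexx.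
  rewrite le_max; apply/orP; right.
  have T0 : 0 <= T by exact: le_trans tT.
  rewrite (screw_onE tT) /screw_on.
  apply: (le_trans (ler_normB _ _)); apply: lerD; last first.
    by have /andP[l0 l1] := lsum_bounds (normr_ge0 t); rewrite ger0_norm.
  apply: (le_trans (ler_normD _ _)); apply: lerD; last by rewrite normrM normr_id ler_wpM2l.
  apply: (le_trans (ler_normD _ _)); apply: lerD.
    rewrite normrM normrN normr_nat ler_pM2l//.
    apply: (le_trans (ler_normB _ _)); rewrite normr_nat lerD2r.
    rewrite ger0_norm ?weight_ge0//; apply: lerD; rewrite ler_expR;
      move: tT; rewrite ler_norml => /andP[]; lra.
  apply: (le_trans (ler_norm_sum _ _ _)); rewrite big_nat_cond [leRHS]big_nat_cond.
  apply: ler_sum => n /andP[/andP[n1 _] _]; rewrite normrM ler_wpM2l//.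
  rewrite /pos_part ger0_norm ?le_max ?lexx ?orbT// ge_max T0 andbT.
  by apply: le_trans tT; rewrite gerBl ln_ge0// ler1n.
by exists (Num.max 0 M) => //; rewrite le_max lexx.
Qed.

(** [supp_in] also constrains the points at the radius itself, and the truncated kernel need not
    vanish at |t| = T; hence T + 1. *)
Lemma tscrew_supp T : supp_in (T + 1) (tscrew T).
Proof. by move=> t; rewrite /tscrew; case: ifPn => // h1 h2; exfalso; lra. Qed.

Lemma tscrew_integrable T : mu.-integrable setT (EFin \o tscrew T).
Proof.
have [M _ h] := tscrew_bounded T.
exact: bounded_supp_integrable (measurable_tscrew T) (@tscrew_supp T) h.
Qed.

Lemma tscrewN T t : tscrew T (- t) = tscrew T t.
Proof. by rewrite /tscrew normrN screwN. Qed.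

End kernel.

Lemma integral_even_half {R : realType} (T : R) (f : R -> R) : 0 <= T -> lebesgue_measure.-integrable setT (EFin \o f) ->
  (forall t, f (- t) = f t) -> (forall t, T < `|t| -> f t = 0) ->
  \int[lebesgue_measure]_t f t = 2 * \int[lebesgue_measure]_(t in `[0, T]) f t.
Proof.
move=> T0 fi fe fs.
pose g1 t := f t * \1_(`[0, T]%classic) t.
(* Open at 0, so that after reflection the origin is not counted twice. *)
pose g2 t := f t * \1_(`]0, T]%classic) t.
have sub (D : set (measurableTypeR R)) : measurable D -> lebesgue_measure.-integrable D (EFin \o f).
  by move=> mD; apply: integrableS fi => //.
have i1 : lebesgue_measure.-integrable setT (EFin \o g1).
  by apply: integrable_itv_indic; apply: sub; exact: measurable_itv.
have i2 : lebesgue_measure.-integrable setT (EFin \o g2).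
  by apply: integrable_itv_indic; apply: sub; exact: measurable_itv.
have m2 : measurable_fun setT g2 by apply/measurable_EFinP; exact: measurable_int i2.
have i2' : lebesgue_measure.-integrable setT (EFin \o (fun t => g2 (- t))).
  apply/integrableP; split.
    by apply/measurable_EFinP; apply: measurableT_comp => //; exact: measurable_funN.
  have /integrableP[_ +] := i2.
  rewrite -(@integral_reflection R (fun t => `|(EFin \o g2) t|)%E)//.
  by apply: measurableT_comp => //; apply/measurable_EFinP.
have E t : f t = g1 t + g2 (- t).
  rewrite /g1 /g2 !indicE !mem_setE !in_itv/= fe oppr_gt0.
  case: (ltP T `|t|) => tT; first by rewrite fs// !mul0r addr0.
  move: tT; rewrite ler_norml => /andP[t1 t2].
  case: (ltP t 0) => t0/=; first by rewrite mulr0 add0r lerNl t1 mulr1.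
  by rewrite t2 mulr1 mulr0 addr0.
have e1 : \int[lebesgue_measure]_t g1 t = \int[lebesgue_measure]_(t in `[0, T]) f t.
  rewrite [RHS]Rintegral_mkcond; apply: eq_Rintegral => t _.
  by rewrite /g1 patchE indicE; case: ifP => _; rewrite ?mulr1 ?mulr0.
have e2 : \int[lebesgue_measure]_t g2 (- t) = \int[lebesgue_measure]_(t in `[0, T]) f t.
  rewrite -Rintegral_itv_obnd_cbnd; last by apply: sub; exact: measurable_itv.
  rewrite [RHS]Rintegral_mkcond.
  have -> : \int[lebesgue_measure]_t g2 (- t) = \int[lebesgue_measure]_t g2 t.
    congr fine; apply: (@integral_reflection R (fun t => (g2 t)%:E)).
    by apply/measurable_EFinP.
  apply: eq_Rintegral => t _.
  by rewrite /g2 patchE indicE; case: ifP => _; rewrite ?mulr1 ?mulr0.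
under eq_Rintegral do rewrite E.
rewrite RintegralD// e1 e2; ring.
Qed.

(** * Integrating each piece of the screw function against a second derivative *)

Section integration_by_parts.
Context {R : realType}.
Notation mu := (@lebesgue_measure R).
Variables (T : R) (h h1 h2 : R -> R).
Hypothesis dh : forall t, is_derive t (1 : R) h (h1 t).
Hypothesis dh1 : forall t, is_derive t (1 : R) h1 (h2 t).
Hypothesis ch2 : continuous h2.
Hypotheses (hT : h T = 0) (h1T : h1 T = 0).

Let ch : continuous h. Proof. by move=> t; exact: is_derive_cont (dh t). Qed.

(** A primitive of k h'' - k'' h is k h' - k' h, which vanishes at T. *)
Lemma parts_twice (k k1 k2 : R -> R) a : a <= T ->
  (forall t, is_derive t (1 : R) k (k1 t)) -> (forall t, is_derive t (1 : R) k1 (k2 t)) ->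
  continuous k2 ->
  \int[mu]_(t in `[a, T]) (k t * h2 t) =
  \int[mu]_(t in `[a, T]) (k2 t * h t) - k a * h1 a + k1 a * h a.
Proof.
move=> aT dk dk1 ck2.
have ck : continuous k by move=> t; exact: is_derive_cont (dk t).
have c1 : continuous (fun t => k t * h2 t) by move=> t; apply: cvgM; [exact: ck | exact: ch2].
have c2 : continuous (fun t => k2 t * h t) by move=> t; apply: cvgM; [exact: ck2 | exact: ch].
have mD : measurable (`[a, T]%classic : set (measurableTypeR R)) by exact: measurable_itv.
have := @FTC_itv R (fun t => k t * h1 t - k1 t * h t) (fun t => k t * h2 t - k2 t * h t) a T aT.
rewrite hT h1T !mulr0 subr0 => FTC.
have {FTC} E : \int[mu]_(t in `[a, T]) (k t * h2 t - k2 t * h t) = 0 - (k a * h1 a - k1 a * h a).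
  apply: FTC; last by move=> t; apply: cvgB; [exact: c1 | exact: c2].
  move=> t; apply: is_derive_eq (is_derive_sub (is_derive_mul (dk t) (dh1 t))
    (is_derive_mul (dk1 t) (dh t))) _; ring.
have i1 := @continuous_integrable_itv R _ a T c1.
have i2 := @continuous_integrable_itv R _ a T c2.
have := RintegralB mD i1 i2; rewrite E; lra.
Qed.

Hypothesis T0 : 0 <= T.

(** The kernel weight - 2 vanishes to second order at 0, so no boundary term remains, and its second
    derivative is weight / 4. *)
Lemma parts_weight : \int[mu]_(t in `[0, T]) ((weight t - 2) * h2 t) =
  4^-1 * \int[mu]_(t in `[0, T]) (h t * weight t).
Proof.
have mD : measurable (`[0, T]%classic : set (measurableTypeR R)) by exact: measurable_itv.
pose e (s : R) t := expR (s * t + 0).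
have de s t : is_derive t (1 : R) (e s) (s * e s t).
  by have := is_derive_expR_comp (is_derive_affine t s 0); rewrite mulrC.
have dk t : is_derive t (1 : R) (fun t => weight t - 2) (2^-1 * e (2^-1) t - 2^-1 * e (- 2^-1) t).
  have := is_derive_sub (is_derive_add (de (2^-1) t) (de (- 2^-1) t)) (is_derive_cst (2 : R) t 1).
  rewrite subr0 mulNr.
  rewrite (_ : (fun x => e 2^-1 x + e (- 2^-1) x - 2) = (fun t => weight t - 2))//.
  by apply/funext => x; rewrite /e /weight !addr0 mulNr [2^-1 * x]mulrC.
have dk1 t : is_derive t (1 : R) (fun t => 2^-1 * e (2^-1) t - 2^-1 * e (- 2^-1) t) (4^-1 * weight t).
  apply: is_derive_eq (is_derive_sub (is_derive_scale (2^-1) (de (2^-1) t))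
   (is_derive_scale (2^-1) (de (- 2^-1) t))) _.
  have -> : weight t = e 2^-1 t + e (- 2^-1) t by rewrite /e /weight !addr0 mulNr [2^-1 * t]mulrC.
  by field.
have ck2 : continuous (fun t : R => 4^-1 * weight t).
  by move=> t; apply: cvgM; [exact: cvg_cst | exact: continuous_weight].
rewrite (parts_twice T0 dk dk1 ck2).
have w0 : weight 0 = 2 :> R by rewrite /weight mul0r oppr0 expR0.
rewrite w0 subrr mul0r subr0 /e !mulr0 addr0 subrr mul0r addr0.
rewrite -RintegralZl//; last first.
  apply: continuous_integrable_itv => t; apply: cvgM; [exact: ch | exact: continuous_weight].
by apply: eq_Rintegral => t _; ring.
Qed.

Lemma parts_linear l : l <= T -> \int[mu]_(t in `[l, T]) ((t - l) * h2 t) = h l.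
Proof.
move=> lT.
have dk t : is_derive t (1 : R) (fun t => t - l) 1.
  by have := is_derive_sub (is_derive_id t (1 : R)) (is_derive_cst l t 1); rewrite subr0.
have dk1 t : is_derive t (1 : R) (fun _ : R => (1 : R)) 0 by exact: is_derive_cst.
have c0 : continuous (fun _ : R => (0 : R)) by move=> t; exact: cvg_cst.
rewrite (parts_twice lT dk dk1 c0) subrr mul0r subr0 mul1r.
rewrite (_ : \int[mu]_(t in `[l, T]) (0 * h t) = 0) ?add0r//.
by rewrite /Rintegral integral0_eq// => t _; rewrite mul0r.
Qed.

Lemma parts_pos_part l : 0 <= l -> l <= T ->
  \int[mu]_(t in `[0, T]) (pos_part l t * h2 t) = h l.
Proof.
move=> l0 lT; rewrite -(parts_linear lT).
rewrite Rintegral_mkcond [RHS]Rintegral_mkcond; apply: eq_Rintegral => t _.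
rewrite !patchE !mem_setE !in_itv/= /pos_part.
case: (leP l t) => lt; first by rewrite (le_trans l0 lt)/= max_l// subr_ge0.
by rewrite max_r ?mul0r ?if_same// subr_le0 ltW.
Qed.

Lemma parts_exp b : 0 < b -> \int[mu]_(t in `[0, T]) ((1 - expR (- (b * t))) * h2 t) =
  b * h 0 - b ^+ 2 * \int[mu]_(t in `[0, T]) (expR (- (b * t)) * h t).
Proof.
move=> b0.
have mD : measurable (`[0, T]%classic : set (measurableTypeR R)) by exact: measurable_itv.
have de t : is_derive t (1 : R) (fun t => expR (- (b * t))) (- b * expR (- (b * t))).
  have := is_derive_expR_comp (is_derive_affine t (- b) 0).
  have -> : (fun y => expR (- b * y + 0)) = (fun t => expR (- (b * t))).
    by apply/funext => x; rewrite addr0 mulNr.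
  by rewrite mulrC addr0 !mulNr.
have ce : continuous (fun t => expR (- (b * t))) by move=> t; exact: is_derive_cont (de t).
have dk t : is_derive t (1 : R) (fun t => 1 - expR (- (b * t))) (b * expR (- (b * t))).
  have := is_derive_sub (is_derive_cst (1 : R) t 1) (de t).
  by rewrite sub0r mulNr opprK.
have dk1 t : is_derive t (1 : R) (fun t => b * expR (- (b * t))) (- b ^+ 2 * expR (- (b * t))).
  by apply: is_derive_eq (is_derive_scale b (de t)) _; ring.
have ck2 : continuous (fun t => - b ^+ 2 * expR (- (b * t))).
  by move=> t; apply: cvgM; [exact: cvg_cst | exact: ce].
rewrite (parts_twice T0 dk dk1 ck2) mulr0 oppr0 expR0 subrr mul0r subr0 mulr1 addrC.
suff -> : \int[mu]_(t in `[0, T]) (- b ^+ 2 * expR (- (b * t)) * h t) =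
    - b ^+ 2 * \int[mu]_(t in `[0, T]) (expR (- (b * t)) * h t) by ring.
rewrite -RintegralZl//; last first.
  apply: continuous_integrable_itv => t; apply: cvgM; [exact: ce | exact: ch].
by apply: eq_Rintegral => t _; ring.
Qed.

Lemma integrable_bounded_mul (f : R -> R) M : measurable_fun setT f ->
  (forall t, 0 <= t -> `|f t| <= M) ->
  mu.-integrable `[0, T] (EFin \o (fun t => f t * h2 t)).
Proof.
move=> mf fM.
have mD : measurable (`[0, T]%classic : set (measurableTypeR R)) by exact: measurable_itv.
have c2 : continuous (fun t => M * `|h2 t|).
  move=> t; apply: cvgM; [exact: cvg_cst | apply: cvg_norm; exact: ch2].
apply: le_integrable (@continuous_integrable_itv R _ 0 T c2) => //.
  apply/measurable_EFinP; apply: measurable_funTS; apply: measurable_funM => //.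
  exact: continuous_measurableT.
move=> t /=; rewrite in_itv/= => /andP[t0 _]; rewrite lee_fin !normrM normr_id ler_wpM2r//.
exact: le_trans (fM t t0) (ler_norm _).
Qed.

Lemma cvg_parts_lser :
  \int[mu]_(t in `[0, T]) (lser t N * h2 t) @[N --> \oo] --> \int[mu]_(t in `[0, T]) (lsum `|t| * h2 t).
Proof.
have mD : measurable (`[0, T]%classic : set (measurableTypeR R)) by exact: measurable_itv.
have i1 N : mu.-integrable `[0, T] (EFin \o (fun t => lser t N * h2 t)).
  apply: continuous_integrable_itv => t; apply: cvgM; [exact: continuous_lser | exact: ch2].
have i2 : mu.-integrable `[0, T] (EFin \o (fun t => lsum `|t| * h2 t)).
  apply: (@integrable_bounded_mul _ (4 * jsum)); first exact: measurable_lsum.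
  by move=> t _; have /andP[l0 l1] := lsum_bounds (normr_ge0 t); rewrite ger0_norm.
have ch3 : continuous (fun t => 4 * jsum * `|h2 t|).
  move=> t; apply: cvgM; [exact: cvg_cst | apply: cvg_norm; exact: ch2].
apply: fine_cvg; rewrite fineK; last exact: integrable_fin_num i2.
apply: (@dominated_cvg _ _ _ mu _ mD _ _ (EFin \o (fun t => 4 * jsum * `|h2 t|))) => //.
- by move=> N; exact: measurable_int (i1 N).
- move=> t /=; rewrite in_itv/= => /andP[t0 _].
  rewrite ger0_norm//; apply: cvg_EFin; first exact: nearW.
  by apply: cvgM; [exact: cvg_lser | exact: cvg_cst].
- exact: continuous_integrable_itv ch3.
- move=> N t /=; rewrite in_itv/= => /andP[t0 _]; rewrite lee_fin normrM ler_wpM2r//.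
  by rewrite ger0_norm ?lser_ge0// lser_le.
Qed.

Lemma continuous_pos_part (l : R) : continuous (pos_part l).
Proof.
move=> t; rewrite (_ : pos_part l = (fun t => (t - l + `|t - l|) / 2)); last first.
  apply/funext => s; rewrite /pos_part; case: (leP 0 (s - l)) => sl.
    by rewrite ger0_norm//; field.
  by rewrite ltr0_norm// subrr mul0r.
have c : (fun t : R => t - l) @ t --> t - l by apply: cvgB; [exact: cvg_id | exact: cvg_cst].
apply: cvgM; last exact: cvg_cst.
by apply: cvgD; [exact: c | apply: cvg_norm; exact: c].
Qed.

Lemma continuous_prime_part M : continuous (fun t : R =>
  \sum_(1 <= n < M) von_mangoldt n / Num.sqrt n%:R * pos_part (ln n%:R) t).
Proof.
move=> t; elim: M => [|[|M] IH].
- by under eq_fun do rewrite big_geq//; exact: cvg_cst.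
- by under eq_fun do rewrite big_geq//; exact: cvg_cst.
under eq_fun do rewrite big_nat_recr//=.
by apply: cvgD IH _; apply: cvgM; [exact: cvg_cst | exact: continuous_pos_part].
Qed.

Lemma parts_prime N : (forall n, (0 < n < N)%N -> ln n%:R <= T) ->
  \int[mu]_(t in `[0, T]) ((\sum_(1 <= n < N) von_mangoldt n / Num.sqrt n%:R * pos_part (ln n%:R) t) * h2 t) =
  \sum_(1 <= n < N) von_mangoldt n / Num.sqrt n%:R * h (ln n%:R).
Proof.
have mD : measurable (`[0, T]%classic : set (measurableTypeR R)) by exact: measurable_itv.
have ih (k : R -> R) : continuous k -> mu.-integrable `[0, T] (EFin \o (fun t => k t * h2 t)).
  by move=> ck; apply: continuous_integrable_itv => t; apply: cvgM; [exact: ck | exact: ch2].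
elim: N => [|[|N] IH] HN.
- rewrite big_geq// /Rintegral integral0_eq// => t _; by rewrite big_geq// mul0r.
- rewrite big_geq// /Rintegral integral0_eq// => t _; by rewrite big_geq// mul0r.
rewrite big_nat_recr//= -IH; last first.
  by move=> n /andP[n0 nN]; apply: HN; rewrite n0 ltnW.
have lN : ln N.+1%:R <= T by apply: HN; rewrite ltnSn.
have l0 : 0 <= ln N.+1%:R :> R by rewrite ln_ge0// ler1n.
rewrite -(parts_pos_part l0 lN) -(RintegralZl _ mD (ih _ (@continuous_pos_part (ln N.+1%:R)))).
rewrite -RintegralD//.
- by apply: eq_Rintegral => t _; rewrite big_nat_recr//= mulrDl mulrA.
- by apply: ih; exact: continuous_prime_part.
- have := integrableZl mD (von_mangoldt N.+1 / Num.sqrt N.+1%:R) (ih _ (@continuous_pos_part (ln N.+1%:R))).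
  by apply: eq_integrable => // t _; rewrite /= EFinM.
Qed.

Hypothesis supp_h : forall t, T <= `|t| -> h t = 0.

(** The termwise bridge between the energy and the Lerch part: with b = kb n the left side is one
    exponential of k against D_p = 2 (h 0 - h), and the right side is twice the matching term of
    [lser] against h''. *)
Lemma integral_exp_tail b (M : R) : 0 < b -> (forall t, `|h t| <= M) ->
  (\int[mu]_(t in `]0%R, +oo[) (expR (- (b * t)) * (2 * (h 0 - h t)))%:E =
   (2 * (b ^- 2 * \int[mu]_(t in `[0, T]) ((1 - expR (- (b * t))) * h2 t)))%:E)%E.
Proof.
move=> b0 hM.
have mD : measurable (`]0, +oo[%classic : set (measurableTypeR R)) by exact: measurable_itv.
have me : measurable_fun setT (fun t : R => expR (- (b * t))).
  by apply: measurableT_comp => //; apply: measurableT_comp => //; exact: measurable_funM.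
have ie : mu.-integrable `]0%R, +oo[ (EFin \o (fun t => expR (- (b * t)))).
  apply/integrableP; split; first by apply/measurable_EFinP; exact: measurable_funTS me.
  have := integral_expR_neg b0.
  under [X in (X < _)%E]eq_integral do rewrite /= ger0_norm ?expR_ge0//.
  by move=> ->; rewrite ltry.
have mh : measurable_fun setT h by apply: continuous_measurableT.
have ieh : mu.-integrable `]0%R, +oo[ (EFin \o (fun t => expR (- (b * t)) * h t)).
  apply: le_integrable (integrableZl mD M ie) => //.
    by apply/measurable_EFinP; apply: measurable_funTS; exact: measurable_funM.
  move=> t _; rewrite /= lee_fin !normrM mulrC ler_wpM2r//.
  exact: le_trans (hM t) (ler_norm _).
have i1 : mu.-integrable `]0%R, +oo[ (EFin \o (fun t => 2 * h 0 * expR (- (b * t)))).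
  by have := integrableZl mD (2 * h 0) ie; apply: eq_integrable => // t _; rewrite /= EFinM.
have i2 : mu.-integrable `]0%R, +oo[ (EFin \o (fun t => 2 * (expR (- (b * t)) * h t))).
  by have := integrableZl mD 2 ieh; apply: eq_integrable => // t _; rewrite /= EFinM.
have -> : (\int[mu]_(t in `]0%R, +oo[) (expR (- (b * t)) * (2 * (h 0 - h t)))%:E =
   \int[mu]_(t in `]0%R, +oo[) (2 * h 0 * expR (- (b * t)) - 2 * (expR (- (b * t)) * h t))%:E)%E.
  by apply: eq_integral => t _; congr EFin; ring.
have -> : (\int[mu]_(t in `]0%R, +oo[) (2 * h 0 * expR (- (b * t)) - 2 * (expR (- (b * t)) * h t))%:E =
  (\int[mu]_(t in `]0%R, +oo[) (2 * h 0 * expR (- (b * t)) - 2 * (expR (- (b * t)) * h t)))%:E)%E.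
  rewrite fineK//; exact: (integrable_fin_num mD (integrableB mD i1 i2)).
rewrite (RintegralB mD i1 i2) (RintegralZl _ mD ie) (RintegralZl _ mD ieh).
have -> : \int[mu]_(t in `]0%R, +oo[) expR (- (b * t)) = b^-1.
  by rewrite /Rintegral integral_expR_neg.
have -> : \int[mu]_(t in `]0%R, +oo[) (expR (- (b * t)) * h t) =
    \int[mu]_(t in `[0, T]) (expR (- (b * t)) * h t).
  rewrite -Rintegral_itv_obnd_cbnd; last first.
    apply: (@integrableS _ _ _ mu `]0, +oo[) => //.
      by move=> t /=; rewrite !in_itv/= => /andP[->].
  rewrite Rintegral_mkcond [RHS]Rintegral_mkcond; apply: eq_Rintegral => t _.
  rewrite !patchE !mem_setE !in_itv/= andbT; case: (ltP 0 t) => t0//=.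
  case: (leP t T) => tT//; rewrite supp_h ?mulr0//.
  by rewrite ger0_norm ltW.
rewrite parts_exp//; congr EFin; field; exact: lt0r_neq0.
Qed.

End integration_by_parts.

(** * The screw kernel paired with the correlation of a derivative *)

Section screw_form.
Context {R : realType}.
Notation mu := (@lebesgue_measure R).
Implicit Types (p : R -> R) (b T : R).

Definition refl p : R -> R := fun x => p (- x).

Lemma csmooth_refl p : csmooth p -> csmooth (refl p).
Proof.
move=> [sp [b sb]]; split; last by exists b => x bx; rewrite /refl sb// normrN.
have := @smooth_scale R p 1 (-1) sp; congr smooth_real.
by apply/funext => x; rewrite mul1r mulN1r.
Qed.

Lemma derive1_refl p x : smooth_real p -> derive1 (refl p) x = - derive1 p (- x).
Proof.
move=> sp; apply: is_derive_derive1.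
have dN := is_derive_opp (is_derive_id x (1 : R)).
have := is_derive_compo (g := fun t => - t) (smooth_is_derive sp (- x)) dN.
by rewrite mulrN1.
Qed.

Lemma corr_conv p x : measurable_fun setT p -> corr p x = convol (refl p) p x.
Proof.
move=> mp; rewrite /corr /ip /convol /Rintegral.
congr fine; rewrite -[LHS](@integral_reflection R (fun y => (p (y + x) * p y)%:E)).
  by apply: eq_integral => y _; rewrite /refl mulrC [- y + x]addrC.
apply/measurable_EFinP; apply: measurable_funM => //.
by apply: measurableT_comp => //; exact: measurable_funD.
Qed.

Lemma is_derive_corr p x : csmooth p ->
  is_derive x (1 : R) (corr p) (convol (refl p) (derive1 p) x).
Proof.
move=> cp; have mp := smooth_measurable cp.1.
rewrite (_ : corr p = convol (refl p) p); last by apply/funext => y; exact: corr_conv.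
exact: is_derive_conv (csmooth_integrable (csmooth_refl cp)) cp.
Qed.

(** The second derivative is put on the other factor of the convolution; reflecting it produces the
    minus sign. *)
Lemma is_derive_corr1 p x : csmooth p ->
  is_derive x (1 : R) (convol (refl p) (derive1 p)) (- corr (derive1 p) x).
Proof.
move=> cp; have cp' := csmooth_derive1 cp; have cr := csmooth_refl cp.
have mp := smooth_measurable cp.1; have mp' := smooth_measurable cp'.1.
have mr := smooth_measurable cr.1.
rewrite (_ : convol (refl p) (derive1 p) = convol (derive1 p) (refl p)); last first.
  by apply/funext => y; rewrite (convE _ mr mp').
apply: is_derive_eq (is_derive_conv x (csmooth_integrable cp') cr) _.
rewrite -(corrN x (csmooth_real_L2 cp')) /corr /ip /convol.
rewrite -mulN1r -RintegralZl//.
  apply: eq_Rintegral => z _; rewrite derive1_refl//; last exact: cp.1.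
  by rewrite opprB; ring.
exact: (integrable_mul (real_L2_shift (- x) (csmooth_real_L2 cp')) (csmooth_real_L2 cp')).
Qed.

Lemma continuous_corr p : csmooth p -> continuous (corr p).
Proof. by move=> cp x; exact: is_derive_cont (is_derive_corr x cp). Qed.

(** For h = corr p one has h'' = - corr p', so the left side is -int g h''. Since T > 2b, both h and
    h' vanish at T, and evenness reduces everything to [0, T]. *)
Lemma screw_form p b T : smooth_real p -> supp_in b p -> 0 < T -> 2 * b < T ->
  (en p < +oo)%E /\
  \int[mu]_t (tscrew T t * corr (derive1 p) t) = creg p + fine (en p).
Proof.
move=> sp sb T0 bT.
have cp : csmooth p by split => //; exists b.
have cp' := csmooth_derive1 cp.
have Lp := csmooth_real_L2 cp; have Lp' := csmooth_real_L2 cp'.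
pose h := corr p; pose h1 := convol (refl p) (derive1 p).
pose h2 t := - corr (derive1 p) t.
have dh t : is_derive t (1 : R) h (h1 t) by exact: is_derive_corr.
have dh1 t : is_derive t (1 : R) h1 (h2 t) by exact: is_derive_corr1.
have ch2 : continuous h2 by move=> t; apply: cvgN; exact: continuous_corr.
have bT' : b < T - b by lra.
have hs t : T <= `|t| -> h t = 0.
  by move=> tT; apply: (corr_supp sb); exact: le_trans (ltW bT) tT.
have hT : h T = 0 by apply: hs; rewrite ger0_norm// ltW.
have rs : supp_in b (refl p) by move=> x bx; rewrite /refl sb// normrN.
have h1T : h1 T = 0.
  apply: (conv_supp rs (supp_in_derive1 sp bT' sb)).
  by rewrite addrC subrK ger0_norm// ltW.
have h2s t : T < `|t| -> h2 t = 0.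
  move=> tT; rewrite /h2 (@corr_supp _ (derive1 p) (`|t| / 2)) ?oppr0//; last by rewrite mulrC divfK.
  have tb : b < `|t| / 2 by rewrite ltr_pdivlMr// mulrC (lt_trans bT).
  exact: supp_in_derive1 sp tb sb.
have hN t : h (- t) = h t by exact: corrN.
have hM t : `|h t| <= ip p p by exact: corr_le.
have T0' := ltW T0.
have mD : measurable (`[0, T]%classic : set (measurableTypeR R)) by exact: measurable_itv.
pose J (f : R -> R) := \int[mu]_(t in `[0, T]) (f t * h2 t).
(* The kernel is expanded into exponentials; sum and integral commute because h 0 - h >= 0. *)
have enE : (en p = \sum_(n <oo) (2 * ((kb n) ^- 2 * J (fun t => (1 - expR (- (kb n * t))))))%:E)%E.
  have mD0 : measurable (`]0, +oo[%classic : set (measurableTypeR R)) by exact: measurable_itv.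
  have -> : (en p = \int[mu]_(t in `]0%R, +oo[) (\sum_(n <oo) (expR (- (kb n * t)) * (2 * (h 0 - h t)))%:E))%E.
    apply: eq_integral => t; rewrite inE/= in_itv/= andbT => t0.
    rewrite tdiffE// -EFinM; apply/esym/cvg_lim => //.
    have -> : (fun N => \sum_(0 <= n < N) (expR (- (kb n * t)) * (2 * (h 0 - h t)))%:E)%E =
        EFin \o (fun N => series (fun n => expR (- (kb n * t))) N * (2 * (h 0 - h t))).
      by apply/funext => N /=; rewrite sumEFin -mulr_suml.
    apply: cvg_EFin; first exact: nearW.
    by apply: cvgM; [exact: cvg_kap | exact: cvg_cst].
  rewrite integral_nneseries//.
  - by apply: eq_eseriesr => n _; rewrite (integral_exp_tail dh dh1 ch2 hT h1T T0' hs (kb_gt0 n) hM).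
  - move=> n; apply/measurable_EFinP; apply: measurable_funTS; apply: measurable_funM.
      by apply: measurableT_comp => //; apply: measurableT_comp => //; exact: measurable_funM.
    apply: measurable_funM; first exact: measurable_cst.
    apply: measurable_funB; first exact: measurable_cst.
    exact: measurable_corr.
  - move=> n t _; rewrite lee_fin mulr_ge0 ?expR_ge0// mulr_ge0// subr_ge0 /h corr0.
    exact: le_trans (ler_norm _) (hM t).
(* The partial sums converge to the pairing of h'' with [lsum] by dominated convergence; finiteness
   of the energy comes as a by-product. *)
have enL : en p = (2 * J (fun t => lsum `|t|))%:E.
  rewrite enE; apply: cvg_lim => //.
  have -> : (fun n => \sum_(0 <= i < n) (2 * ((kb i) ^- 2 * J (fun t => (1 - expR (- (kb i * t))))))%:E)%E =
      EFin \o (fun n => 2 * J (lser^~ n)).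
    apply/funext => N /=; rewrite sumEFin -mulr_sumr; congr (2 * _)%:E.
    rewrite /J /lser; elim: N => [|N IH].
      by rewrite big_geq// /Rintegral integral0_eq// => t _; rewrite /series/= big_geq// mul0r.
    rewrite big_nat_recr//= IH.
    have ce : continuous (fun t : R => 1 - expR (- (kb N * t))).
      move=> t; apply: cvgB; first exact: cvg_cst.
      have := is_derive_cont (is_derive_expR_comp (is_derive_affine t (- kb N) 0)).
      rewrite /prop_for /continuous_at addr0 mulNr.
      by under eq_fun do rewrite addr0 mulNr.
    have ih (k : R -> R) : continuous k -> mu.-integrable `[0, T] (EFin \o (fun t => k t * h2 t)).
      by move=> ck; apply: continuous_integrable_itv => t; apply: cvgM; [exact: ck | exact: ch2].
    rewrite -(RintegralZl _ mD (ih _ ce)) -RintegralD//.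
    + by apply: eq_Rintegral => t _; rewrite seriesSr; ring.
    + by apply: ih; exact: continuous_lser.
    + have := integrableZl mD ((kb N) ^- 2) (ih _ ce).
      by apply: eq_integrable => // t _; rewrite /= EFinM.
  apply: cvg_EFin; first exact: nearW.
  apply: cvgM; first exact: cvg_cst.
  have := cvg_parts_lser.
  rewrite /J; apply; exact: ch2.
split; first by rewrite enL ltry.
have gi : mu.-integrable setT (EFin \o (fun t => tscrew T t * corr (derive1 p) t)).
  have [M M0 gM] := tscrew_bounded T.
  apply: (@bounded_supp_integrable _ _ (T + 1) (M * ip (derive1 p) (derive1 p))).
  - apply: measurable_funM; [exact: measurable_tscrew | exact: measurable_corr].
  - by move=> t /tscrew_supp ->; rewrite mul0r.
  - by move=> t; rewrite normrM ler_pM// corr_le.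
rewrite (@integral_even_half R T _ T0' gi); last 2 first.
- by move=> t; rewrite tscrewN corrN.
- by move=> t tT; rewrite /tscrew leNgt tT mul0r.
have hwi : mu.-integrable setT (EFin \o (fun t => h t * weight t)).
  exact: integrable_weight (bounded_supp_corr Lp sb).
have hw : \int[mu]_t (h t * weight t) = 2 * \int[mu]_(t in `[0, T]) (h t * weight t).
  apply: (@integral_even_half R T _ T0' hwi) => t.
  - by rewrite hN /weight mulNr opprK [expR _ + _]addrC.
  - by move=> tT; rewrite hs ?mul0r// ltW.
rewrite enL /creg (regularE hs) hw /=.
pose S t : R := \sum_(1 <= n < cutoff T) von_mangoldt n / Num.sqrt n%:R * pos_part (ln n%:R) t.
have JE : J (fun t => weight t - 2) = 4^-1 * \int[mu]_(t in `[0, T]) (h t * weight t).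
  exact: (parts_weight dh dh1 ch2 hT h1T T0').
have JS : J S = \sum_(1 <= n < cutoff T) von_mangoldt n / Num.sqrt n%:R * h (ln n%:R).
  apply: (parts_prime dh dh1 ch2 hT h1T) => n /andP[n0 nT].
  rewrite -[leRHS]expRK ler_ln ?posrE ?expR_gt0 ?ltr0n//.
  by rewrite -truncn_ge_nat ?expR_ge0.
have JL : J (fun t => t - 0) = h 0 by exact: (parts_linear dh dh1 ch2 hT h1T T0').
have PE : prime_sum h (cutoff T) = 2 * J S.
  rewrite JS /prime_sum mulr_sumr; apply: eq_bigr => n _; rewrite hN; ring.
rewrite PE -corr0 -/h -JL.
have -> : \int[mu]_(t in `[0, T]) (tscrew T t * corr (derive1 p) t) =
    \int[mu]_(t in `[0, T]) (- (screw_on T t * h2 t)).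
  apply: eq_Rintegral => t; rewrite inE/= in_itv/= => /andP[t0 tT].
  have tT' : `|t| <= T by rewrite ger0_norm.
  by rewrite /tscrew tT' (screw_onE tT') /h2; ring.
have cS : continuous S.
  exact: continuous_prime_part.
have ih (k : R -> R) : continuous k -> mu.-integrable `[0, T] (EFin \o (fun t => k t * h2 t)).
  by move=> ck; apply: continuous_integrable_itv => t; apply: cvgM; [exact: ck | exact: ch2].
have ck1 : continuous (fun t : R => weight t - 2).
  by move=> t; apply: cvgB; [exact: continuous_weight | exact: cvg_cst].
have ck2 : continuous (fun t : R => t - 0).
  by move=> t; apply: cvgB; [exact: cvg_id | exact: cvg_cst].
(* This is -g without its Lerch part, which is kept apart because only its measurability and
   boundedness are known here. *)
pose k t := 4 * (weight t - 2) - S t - weil_cst / 2 * (t - 0).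
have iZ (f : R -> R) c : continuous f -> continuous (fun t => c * f t).
  by move=> cf t; apply: cvgM; [exact: cvg_cst | exact: cf].
have c4 := iZ _ 4 ck1; have cW := iZ _ (weil_cst / 2) ck2.
have c4S : continuous (fun t : R => 4 * (weight t - 2) - S t).
  by move=> t; apply: cvgB; [exact: c4 | exact: cS].
have ck : continuous k by move=> t; apply: cvgB; [exact: c4S | exact: cW].
have JD (f g : R -> R) : mu.-integrable `[0, T] (EFin \o (fun t => f t * h2 t)) ->
    mu.-integrable `[0, T] (EFin \o (fun t => g t * h2 t)) ->
    J (fun t => f t - g t) = J f - J g.
  move=> fi gi'; rewrite /J -(RintegralB mD fi gi').
  by apply: eq_Rintegral => t _; rewrite mulrBl.
have JZ (f : R -> R) c : continuous f -> J (fun t => c * f t) = c * J f.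
  move=> cf; rewrite /J -(RintegralZl _ mD (ih _ cf)).
  by apply: eq_Rintegral => t _; rewrite mulrA.
have Jk : J k = 4 * J (fun t => weight t - 2) - J S - weil_cst / 2 * J (fun t => t - 0).
  by rewrite /k (JD _ _ (ih _ c4S) (ih _ cW)) (JD _ _ (ih _ c4) (ih _ cS)) !JZ.
have iL : mu.-integrable `[0, T] (EFin \o (fun t => lsum `|t| * h2 t)).
  apply: (@integrable_bounded_mul _ T h2 ch2 _ (4 * jsum)); first exact: measurable_lsum.
  by move=> t _; have /andP[l0 l1] := lsum_bounds (normr_ge0 t); rewrite ger0_norm.
have -> : \int[mu]_(t in `[0, T]) - (screw_on T t * h2 t) = J k + J (fun t => lsum `|t|).
  rewrite /J -(RintegralD mD (ih _ ck) iL).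
  apply: eq_Rintegral => t; rewrite inE/= in_itv/= => /andP[t0 tT].
  by rewrite /screw_on /k /S ger0_norm// subr0; ring.
by rewrite Jk JE; field.
Qed.

End screw_form.

(** * Test functions and weak derivatives *)

Section orthogonality.
Context {R : realType}.
Notation mu := (@lebesgue_measure R).
Implicit Types (p q w psi : R -> R) (a : R).

Definition rL2 a p := real_L2 p /\ supp_in a p.

(** The strict inequality encodes compact support inside the open interval, see [CcinftyP]. *)
Definition test a psi := smooth_real psi /\ exists2 b, b < a & supp_in b psi.

Lemma test_csmooth a psi : test a psi -> csmooth psi.
Proof. by move=> [s [b _ sb]]; split => //; exists b. Qed.

Lemma test_rL2 a psi : test a psi -> rL2 a psi.
Proof.
move=> t; split; first exact: csmooth_real_L2 (test_csmooth t).
by case: t => _ [b ba sb] x ax; apply: sb; exact: le_trans (ltW ba) ax.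
Qed.

Lemma test_derive1 a psi : test a psi -> test a (derive1 psi).
Proof.
move=> [s [b ba sb]]; split; first exact: smooth_derive1.
exists ((a + b) / 2); first by lra.
by apply: supp_in_derive1 s _ sb; lra.
Qed.

Lemma null_ip p q : real_L2 p -> real_L2 q -> ip p p = 0 -> ip p q = 0.
Proof.
move=> Lp Lq p0; apply/eqP; apply/negPn/negP => pq.
have c0 : 0 < `|ip p q| by rewrite normr_gt0.
have M0 := ip_ge0 q.
(* With c = |ip p q| and M = ip q q, this weight turns the bound of [norm_ip_le] into c M / (2 (M +
   1)), which is less than c. *)
have e0 : 0 < (ip q q + 1) / `|ip p q| by rewrite divr_gt0// ltr_wpDl.
have := norm_ip_le e0 Lp Lq; rewrite p0 mulr0 add0r invf_div.
move: c0 M0; move: (`|ip p q|) (ip q q) => c M c0 M0.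
have -> : c / (M + 1) * M / 2 = (c * M) / (2 * (M + 1)) by field; rewrite lt0r_neq0//; lra.
rewrite ler_pdivlMr; last by lra.
nra.
Qed.

Definition ind (c d : R) : R -> R := \1_(`[c, d]%classic).

Lemma indE c d y : ind c d y = if c <= y <= d then 1 else 0.
Proof. by rewrite /ind indicE mem_setE in_itv/=; case: ifP. Qed.

Lemma ind_ge0 c d y : 0 <= ind c d y.
Proof. by rewrite indE; case: ifP. Qed.

Lemma measurable_ind c d : measurable_fun setT (ind c d).
Proof. by apply: measurable_indic; exact: measurable_itv. Qed.

Lemma integral_ind c d : c <= d -> (\int[mu]_x (ind c d x)%:E = (d - c)%:E)%E.
Proof.
move=> cd; rewrite /ind integral_indic//= setIT.
rewrite lebesgue_measure_itv/= lte_fin; case: ltP => // h.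
by have -> : d = c by [apply/eqP; rewrite eq_le h cd]; rewrite subrr.
Qed.

Lemma ind_sqr c d y : ind c d y ^+ 2 = ind c d y.
Proof. by rewrite indE; case: ifP; rewrite ?expr1n ?expr0n. Qed.

Lemma real_L2_ind c d : real_L2 (ind c d).
Proof.
split; first exact: measurable_ind.
rewrite /sq; under eq_integral do rewrite ind_sqr.
have [cd|dc] := leP c d; first by rewrite integral_ind// ltry.
rewrite integral0_eq ?ltry// => x _; rewrite indE.
by case: (leP c x) => //= cx; rewrite leNgt (lt_le_trans dc cx).
Qed.

(** The indicator and its translate differ only where y lies within x to the left of an endpoint. *)
Lemma tdiff_ind_le c d x : 0 <= x -> (tdiff (ind c d) x <= (2 * x)%:E)%E.
Proof.
move=> x0.
have i1 : (\int[mu]_y (ind (c - x) c y)%:E = x%:E)%E.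
  by rewrite integral_ind; [congr EFin; ring | lra].
have i2 : (\int[mu]_y (ind (d - x) d y)%:E = x%:E)%E.
  by rewrite integral_ind; [congr EFin; ring | lra].
have -> : ((2 * x)%:E = \int[mu]_y ((ind (c - x) c y)%:E + (ind (d - x) d y)%:E))%E.
  rewrite ge0_integralD//=.
  - by rewrite i1 i2 -EFinD; congr EFin; ring.
  - by move=> y _; rewrite lee_fin ind_ge0.
  - by apply/measurable_EFinP; exact: measurable_ind.
  - by move=> y _; rewrite lee_fin ind_ge0.
  - by apply/measurable_EFinP; exact: measurable_ind.
apply: ge0_le_integral => //=.
- by move=> y _; rewrite lee_fin sqr_ge0.
- apply/measurable_EFinP; apply: measurable_funX; apply: measurable_funB.
    by apply: measurable_shift; exact: measurable_ind.
  exact: measurable_ind.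
- by apply: emeasurable_funD; apply/measurable_EFinP; exact: measurable_ind.
move=> y _; rewrite -EFinD lee_fin !indE.
case: (boolP (c <= y + x <= d)) => h1; case: (boolP (c <= y <= d)) => h2;
  rewrite ?subrr ?expr0n/= ?addr_ge0 ?ler01//; try by case: ifP.
  move: h1 h2; rewrite negb_and -!ltNge subr0 expr1n => /andP[h1 h2] h3.
  have -> : (c - x <= y <= c) = true.
    by apply/andP; split; [lra | case/orP: h3 => h3; lra].
  by rewrite lerDl; case: ifP.
move: h1 h2; rewrite negb_and -!ltNge sub0r sqrrN expr1n => h3 /andP[h1 h2].
have -> : (d - x <= y <= d) = true.
  by apply/andP; split; [case/orP: h3 => h3; lra | lra].
by rewrite lerDr; case: ifP.
Qed.

(** Jumps have finite energy: the factor 2x of [tdiff_ind_le] cancels the singularity 3/(2x) of the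
    kernel. Hence [csmooth_dense] also approximates indicators. *)
Lemma en_ind_lty c d : (en (ind c d) < +oo)%E.
Proof.
have mi := measurable_ind c d.
apply: (le_lt_trans (en_le_split mi ltr01)).
have L := (real_L2_ind c d).2.
apply: (@lte_add_pinfty _ (enloc (ind c d) 1)); last first.
  move: L (sq_ge0 (ind c d)); case: (sq _) => [r _ _|//|//].
  by rewrite -EFinM ltry.
apply: (@le_lt_trans _ _ (\int[mu]_(x in `]0%R, 1%R]) (cst 3%:E) x)%E); last first.
  rewrite integral_cst/=; last exact: measurable_itv.
  by rewrite lebesgue_measure_itv/= lte_fin ltr01 -EFinB -EFinM ltry.
apply: ge0_le_integral => //=.
- by move=> x /=; rewrite in_itv/= => /andP[x0 _]; apply: integrand_en_ge0; rewrite /= in_itv/= x0.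
- by apply: measurable_integrand_enS => //; exact: sub_loc.
move=> x /=; rewrite in_itv/= => /andP[x0 x1].
apply: (@le_trans _ _ ((3 / (2 * x))%:E * (2 * x)%:E)%E).
  apply: lee_pmul; rewrite ?tdiff_ge0 ?lee_fin ?(ltW (kap_gt0 x0))//; first exact: kap_le.
  exact: tdiff_ind_le (ltW x0).
by rewrite -EFinM lee_fin divfK// lt0r_neq0// mulr_gt0.
Qed.

Lemma test_orthogonal_itv a w c d : 0 < a -> rL2 a w ->
  (forall psi, test a psi -> ip w psi = 0) -> - a < c -> d < a -> ip w (ind c d) = 0.
Proof.
move=> a0 [Lw sw] H ac da; have Li := real_L2_ind c d.
apply/eqP; apply/negPn/negP => wi.
have si : supp_in a (ind c d).
  move=> x ax; rewrite indE; case: (boolP (c <= x <= d)) => // /andP[h1 h2].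
  by exfalso; move: ax; rewrite leNgt ltr_norml (lt_le_trans ac h1) (le_lt_trans h2 da).
pose s := ip w (ind c d).
have s0 : 0 < `|s| by rewrite normr_gt0.
have M0 := ip_ge0 w.
(* Chosen so that both terms in the weighted Cauchy-Schwarz bound are at most |s|, one of them
   strictly; their mean is then below |s|, a contradiction. *)
pose k := `|s| / (ip w w + 1).
have k0 : 0 < k by rewrite divr_gt0// ltr_wpDl.
have [psi [b [sp [ba sb] h1 h2]]] := csmooth_dense a0 Li si (en_ind_lty c d) (mulr_gt0 k0 s0).
have tp : test a psi by split => //; exists b.
have Lp := (test_rL2 tp).1.
have Ld := real_L2B Li Lp.
have E : ip w (fun x => ind c d x - psi x) = s.
  by rewrite ipC (ipBl Li Lp Lw) [ip psi w]ipC (H _ tp) subr0 ipC.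
have := norm_ip_le k0 Lw Ld; rewrite E.
have h3 : ip (fun x => ind c d x - psi x) (fun x => ind c d x - psi x) < k * `|s|.
  by rewrite -lte_fin -sqE.
have h4 : k^-1 * ip (fun x => ind c d x - psi x) (fun x => ind c d x - psi x) < `|s|.
  by rewrite mulrC ltr_pdivrMr// mulrC.
have h5 : k * ip w w <= `|s|.
  rewrite /k mulrAC ler_pdivrMr; last by rewrite ltr_wpDl.
  by rewrite ler_wpM2l//; lra.
by lra.
Qed.

(** By [test_orthogonal_itv] w has mean 0 on every small interval around x. If w x were nonzero, the
    mean of |w - w x| there would be at least |w x|, so x would not be a Lebesgue point. *)
Lemma test_orthogonal a w : 0 < a -> rL2 a w ->
  (forall psi, test a psi -> ip w psi = 0) -> ip w w = 0.
Proof.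
move=> a0 rw H; have [Lw sw] := rw.
have iw := integrable_real_L2 Lw sw.
have lw : locally_integrable setT w.
  by apply: open_integrable_locally => //; exact: openT.
have ae0 : {ae mu, forall x, w x = 0}.
  have [N [mN N0 sN]] := lebesgue_differentiation lw.
  exists N; split => //; apply: subset_trans sN; apply: subsetC => x px.
  have [/sw //|xa] := lerP a `|x|.
  apply/eqP; apply/negPn/negP => wx.
  have h : {near (0 : R)^'+, forall r, (`|w x|%:E <= davg w x r)%E}.
    near=> r.
    have r0 : 0 < r by near: r; exact: nbhs_right_gt.
    have ra : r < a - `|x| by near: r; apply: nbhs_right_lt; rewrite subr_gt0.
    have xr1 : - a < x - r by have := ler_norm (- x); rewrite normrN; lra.
    have xr2 : x + r < a by have := ler_norm x; lra.
    have iI : mu.-integrable `[x - r, x + r] (EFin \o w).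
      by apply: integrableS iw => //; exact: measurable_itv.
    have cc : continuous (fun _ : R => w x) by move=> y; exact: cvg_cst.
    have ic := @continuous_integrable_itv R _ (x - r) (x + r) cc.
    have mI : measurable (`[x - r, x + r]%classic : set (measurableTypeR R)) by exact: measurable_itv.
    have rr : x - r <= x + r by lra.
    have E : \int[mu]_(y in `[x - r, x + r]) (w y - w x) = - (2 * r * w x).
      rewrite (RintegralB mI iI ic).
      have -> : \int[mu]_(y in `[x - r, x + r]) w y = 0.
        rewrite -[RHS](test_orthogonal_itv a0 rw H xr1 xr2) Rintegral_mkcond.
        apply: eq_Rintegral => y _; rewrite patchE /ind indicE.
        by case: ifP; rewrite ?mulr1 ?mulr0.
      rewrite (FTC_itv rr (fun y => is_derive_affine y (w x) 0) cc); ring.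
    have mI' : measurable (`]x - r, x + r[%classic : set (measurableTypeR R)) by exact: measurable_itv.
    have iD : mu.-integrable `[x - r, x + r] (EFin \o (fun y => w y - w x)).
      have := integrableB mI iI ic; apply: eq_integrable => // y _.
    have iD' : mu.-integrable `]x - r, x + r[ (EFin \o (fun y => w y - w x)).
      apply: integrableS iD => //.
      by move=> y /=; rewrite !in_itv/= => /andP[/ltW -> /ltW ->].
    have iD'' : mu.-integrable `]x - r, x + r] (EFin \o (fun y => w y - w x)).
      apply: integrableS iD => //.
      by move=> y /=; rewrite !in_itv/= => /andP[/ltW -> ->].
    rewrite -(Rintegral_itv_obnd_cbnd iD'') -(Rintegral_itv_bndo_bndc iD') in E.
    have h1 := le_abse_integral mu mI' (measurable_int mu iD').
    have h2 : (\int[mu]_(y in `](x - r)%R, (x + r)%R[) (EFin \o (fun y => (w y - w x)%R)) y = (- (2 * r * w x)%R)%:E)%E.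
      by rewrite -E /Rintegral fineK//; exact: (integrable_fin_num mI' iD').
    rewrite h2 in h1.
    have rr0 : 0 < 2 * r by rewrite mulr_gt0.
    rewrite /davg /iavg lebesgue_measure_ball ?(ltW r0)// ball_itv -mulr_natl.
    rewrite inver (gt_eqF rr0).
    have -> : (`|w x|%:E = (2 * r)^-1%:E * `|(- (2 * r * w x))%:E|)%E.
      rewrite abse_EFin normrN normrM (ger0_norm (ltW rr0)) -EFinM mulKf//.
      exact: lt0r_neq0.
    by rewrite lee_pmul2l ?lte_fin ?invr_gt0.
  have : (`|w x|%:E <= 0)%E.
    have cc : (fun _ : R => `|w x|%:E) r @[r --> (0 : R)^'+] --> `|w x|%:E by exact: cvg_cst.
    exact: lee_cvg_to cc px h.
  by rewrite lee_fin normr_le0 (negbTE wx).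
rewrite /ip /Rintegral (ae_eq_integral (cst 0%E))//.
- by rewrite integral0.
- by have := integrable_mul Lw Lw => /measurable_int.
- case: ae0 => N [mN N0 sN]; exists N; split => //; apply: subset_trans sN.
  by apply: subsetC => x /= wx _; rewrite wx mul0r.
Unshelve. all: by end_near. Qed.

End orthogonality.

(** * Weak derivatives of real functions on (-a, a) *)

Section real_weak_derivative.
Context {R : realType}.
Notation mu := (@lebesgue_measure R).
Implicit Types (p q w psi : R -> R) (a : R).

Definition rwd a p w := [/\ rL2 a p, rL2 a w &
  forall psi, test a psi -> ip p (derive1 psi) = - ip w psi].

Lemma rL2B a p q : rL2 a p -> rL2 a q -> rL2 a (fun x => p x - q x).
Proof.
move=> [Lp sp] [Lq sq_]; split; first exact: real_L2B.
by move=> x ax; rewrite sp// sq_// subrr.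
Qed.

Lemma null_subl p q : real_L2 p -> real_L2 q ->
  ip (fun x => p x - q x) (fun x => p x - q x) = 0 ->
  forall r, real_L2 r -> ip p r = ip q r.
Proof.
move=> Lp Lq pq r Lr; apply/eqP; rewrite -subr_eq0 -ipBl//; apply/eqP.
exact: null_ip (real_L2B Lp Lq) Lr pq.
Qed.

(** [weak_deriv] is an arbitrary choice; uniqueness up to a null function is what identifies it with
    a classical derivative. *)
Lemma rwd_unique a p q w v : 0 < a -> rwd a p w -> rwd a q v ->
  ip (fun x => p x - q x) (fun x => p x - q x) = 0 ->
  ip (fun x => w x - v x) (fun x => w x - v x) = 0.
Proof.
move=> a0 [Lp Lw Dp] [Lq Lv Dq] pq.
apply: (test_orthogonal a0 (rL2B Lw Lv)) => psi tpsi.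
have Lpsi := (test_rL2 tpsi).1; have Ld := (test_rL2 (test_derive1 tpsi)).1.
rewrite ipBl//; [|exact: Lw.1|exact: Lv.1].
have := null_subl Lp.1 Lq.1 pq Ld; rewrite Dp// Dq// => /oppr_inj ->.
by rewrite subrr.
Qed.

Lemma rwd_eq a p q w : rwd a p w -> rL2 a q ->
  ip (fun x => p x - q x) (fun x => p x - q x) = 0 -> rwd a q w.
Proof.
move=> [Lp Lw Dp] Lq pq; split => // psi tpsi.
have Ld := (test_rL2 (test_derive1 tpsi)).1.
by rewrite -(null_subl Lp.1 Lq.1 pq Ld) Dp.
Qed.

Definition clip a p : R -> R := fun x => p x * \1_(`]- a, a[%classic) x.

Lemma clipE a p x : clip a p x = if `|x| < a then p x else 0.
Proof.
rewrite /clip indicE mem_setE in_itv/= -ltr_norml.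
by case: ifP; rewrite ?mulr1 ?mulr0.
Qed.

Lemma rL2_clip a p : continuous p -> rL2 a (clip a p).
Proof.
move=> cp.
have [M _ pM] : exists2 M, 0 <= M & forall x, `|clip a p x| <= M.
  have [a0|a0] := lerP a 0.
    by exists 0 => // x; rewrite clipE ltNge (le_trans a0)//= normr0.
  have aa : - a <= a by lra.
  have cn : {within `[- a, a], continuous (fun x => `|p x|)}.
    by apply: continuous_subspaceT => x; apply: cvg_norm; exact: cp.
  have [c _ cmax] := EVT_max aa cn.
  exists `|p c| => // x; rewrite clipE; case: ifP => xa; last by rewrite normr0.
  by apply: cmax; rewrite in_itv/=; move: xa; rewrite ltr_norml => /andP[/ltW -> /ltW ->].
have sc : supp_in a (clip a p) by move=> x ax; rewrite clipE ltNge ax.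
have mc : measurable_fun setT (clip a p).
  apply: measurable_funM; first exact: continuous_measurableT.
  by apply: measurable_indic; exact: measurable_itv.
split => //; split => //.
have h : mu.-integrable setT (EFin \o (fun x => clip a p x ^+ 2)).
  apply: (@bounded_supp_integrable _ _ a (M ^+ 2)).
  - exact: measurable_funX.
  - by move=> x /sc ->; rewrite expr0n.
  - by move=> x; rewrite normrX lerXn2r ?nnegrE// (le_trans _ (pM x)).
exact: (integrable_lty measurableT h).
Qed.

Lemma ip_clip a p q : supp_in a q -> ip (clip a p) q = ip p q.
Proof.
move=> sq_; apply: eq_Rintegral => x _; rewrite clipE.
by case: ltP => // ax; rewrite sq_// !mulr0.
Qed.

Lemma ip_itv p q b : supp_in b q -> ip p q = \int[mu]_(x in `[- b, b]) (p x * q x).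
Proof.
move=> sb; rewrite [RHS]Rintegral_mkcond; apply: eq_Rintegral => x _.
rewrite patchE mem_setE in_itv/= -ler_norml; case: leP => // bx.
by rewrite sb ?mulr0// ltW.
Qed.

Lemma ip_derive1 p p' psi b : (forall x, is_derive x (1 : R) p (p' x)) -> continuous p' ->
  smooth_real psi -> supp_in b psi -> ip p (derive1 psi) = - ip p' psi.
Proof.
move=> dp cp' sp sb.
(* Beyond b, so that the derivative of psi vanishes from c on as well, and positive even for
   negative b. *)
pose c := Num.max b 0 + 1.
have c0 : 0 < c by rewrite ltr_wpDl// le_max lexx orbT.
have bc : b < c by rewrite ltr_pwDr// le_max lexx.
have cc : - c <= c by lra.
have sc : supp_in c psi by move=> x cx; apply: sb; exact: le_trans (ltW bc) cx.
have sc' : supp_in c (derive1 psi) by exact: supp_in_derive1 sp bc sb.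
have cp : continuous p by move=> x; exact: is_derive_cont (dp x).
have cd := smooth_continuous (smooth_derive1 sp); have cs := smooth_continuous sp.
have c1 : continuous (fun x => p x * derive1 psi x) by move=> x; apply: cvgM; [exact: cp | exact: cd].
have c2 : continuous (fun x => p' x * psi x) by move=> x; apply: cvgM; [exact: cp' | exact: cs].
have dF x : is_derive x (1 : R) (fun x => p x * psi x) (p x * derive1 psi x + p' x * psi x).
  by apply: is_derive_eq (is_derive_mul (dp x) (smooth_is_derive sp x)) _; ring.
have c3 : continuous (fun x => p x * derive1 psi x + p' x * psi x).
  by move=> x; apply: cvgD; [exact: c1 | exact: c2].
have := FTC_itv cc dF c3.
rewrite (sc c) ?(sc (- c)) ?normrN ?ger0_norm ?(ltW c0)// !mulr0 subr0.
have mI : measurable (`[- c, c]%classic : set (measurableTypeR R)) by exact: measurable_itv.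
have i1 := @continuous_integrable_itv R _ (- c) c c1.
have i2 := @continuous_integrable_itv R _ (- c) c c2.
rewrite (RintegralD mI i1 i2) (ip_itv p sc') (ip_itv p' sc) => /eqP.
by rewrite addr_eq0 => /eqP.
Qed.

(** Clipping may create jumps at -a and a, but test functions vanish near these points and do not
    see them; this is how the domain H^1 of the adjoint comes without boundary values. *)
Lemma rwd_clip a p p' : (forall x, is_derive x (1 : R) p (p' x)) -> continuous p' ->
  rwd a (clip a p) (clip a p').
Proof.
move=> dp cp'.
have cp : continuous p by move=> x; exact: is_derive_cont (dp x).
split; [exact: rL2_clip | exact: rL2_clip |] => psi tpsi.
have [sp [b ba sb]] := tpsi.
rewrite !ip_clip; [exact: ip_derive1 dp cp' sp sb |exact: (test_rL2 tpsi).2|].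
exact: (test_rL2 (test_derive1 tpsi)).2.
Qed.

Lemma clip_id a p : supp_in a p -> clip a p = p.
Proof. by move=> sp; apply/funext => x; rewrite clipE; case: ltP => // /sp. Qed.

Lemma rwd_test a psi : test a psi -> rwd a psi (derive1 psi).
Proof.
move=> t; have sd := smooth_is_derive t.1.
have := rwd_clip a sd (smooth_continuous (smooth_derive1 t.1)).
by rewrite !clip_id//; [exact: (test_rL2 (test_derive1 t)).2 | exact: (test_rL2 t).2].
Qed.

End real_weak_derivative.

(** * The operator B_a *)

Section convolution_form.
Context {R : realType}.
Notation mu := (@lebesgue_measure R).
Implicit Types (g p q : R -> R).

(** Fubini applies because g and q are integrable and p is bounded. *)
Lemma ip_convol g p q : mu.-integrable setT (EFin \o g) -> csmooth p ->
  mu.-integrable setT (EFin \o q) ->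
  ip (convol g p) q = \int[mu]_t (g t * ip (fun x => p (x - t)) q).
Proof.
move=> ig cp iq.
have [M M0 pM] := csmooth_bounded cp.
have mp := smooth_measurable cp.1.
have mg : measurable_fun setT g by apply/measurable_EFinP; exact: measurable_int ig.
have mq : measurable_fun setT q by apply/measurable_EFinP; exact: measurable_int iq.
pose F (x : R * R) : \bar R := (g x.2 * p (x.1 - x.2) * q x.1)%:E.
have mF : measurable_fun setT F.
  apply/measurable_EFinP; apply: measurable_funM; last first.
    by apply: (@measurableT_comp _ _ _ _ _ _ q).
  apply: measurable_funM; first by apply: (@measurableT_comp _ _ _ _ _ _ g).
  by apply: (@measurableT_comp _ _ _ _ _ _ p) => //; exact: measurable_funB.
have iF : (mu \x mu)%E.-integrable setT F.
  apply/(integrable12ltyP mu mu mF).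
  have /integrableP[_ ngl] := ig; have /integrableP[_ nql] := iq.
  have mng : measurable_fun setT (fun t : R => `|g t|%:E).
    by apply/measurable_EFinP; exact: measurableT_comp.
  have mnq : measurable_fun setT (fun t : R => `|q t|%:E).
    by apply/measurable_EFinP; exact: measurableT_comp.
  pose ng := fine (\int[mu]_t `|(EFin \o g) t|)%E.
  have ngE : (\int[mu]_t `|(EFin \o g) t| = ng%:E)%E.
    by rewrite /ng fineK// ge0_fin_numE// integral_ge0.
  have ng0 : 0 <= ng by rewrite -lee_fin -ngE integral_ge0.
  apply: (@le_lt_trans _ _ (\int[mu]_x ((ng * M)%:E * `|(EFin \o q) x|))%E).
    apply: ge0_le_integral => //=.
    - by move=> x _; exact: integral_ge0.
    - have nF0 z : (0 <= (abse \o F) z)%E by exact: abse_ge0.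
      have mnF : measurable_fun setT (abse \o F) by exact: measurableT_comp.
      exact: (@measurable_fun_fubini_tonelli_F _ _ _ _ _ mu _ mnF nF0).
    - by apply: emeasurable_funM; [exact: measurable_cst | exact: mnq].
    move=> x _; rewrite EFinM -ngE -muleA -ge0_integralZr//=.
    - apply: ge0_le_integral => //=.
      + apply/measurable_EFinP; apply: measurableT_comp => //.
        apply: measurable_funM => //; apply: measurable_funM => //.
        by apply: measurableT_comp => //; exact: measurable_funB.
      + by apply: emeasurable_funM => //; exact: measurable_cst.
      move=> t _; rewrite -!EFinM lee_fin !normrM mulrA ler_wpM2r// ler_wpM2l//.
    - by rewrite mule_ge0// lee_fin.
  rewrite ge0_integralZl//=.
  - rewrite lte_mul_pinfty// ?lee_fin ?mulr_ge0//.
  - by rewrite lee_fin mulr_ge0.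
have := Fubini iF.
have E1 x : (\int[mu]_y F (x, y) = (convol g p x * q x)%:E)%E.
  have i := integrable_conv x ig mp (ex_intro2 _ _ M M0 pM).
  rewrite /F/= /convol -RintegralZr// /Rintegral fineK//.
  have := integrableZr measurableT (q x) i.
  by move=> /(integrable_fin_num measurableT).
have E2 y : (\int[mu]_x F (x, y) = (g y * ip (fun x => p (x - y)) q)%:E)%E.
  have i : mu.-integrable setT (EFin \o (fun x => p (x - y) * q x)).
    apply: le_integrable (integrableZl measurableT M iq) => //.
      apply/measurable_EFinP; apply: measurable_funM => //.
      by apply: measurableT_comp => //; exact: measurable_funB.
    move=> x _; rewrite /= lee_fin !normrM ler_wpM2r//.
    exact: le_trans (pM _) (ler_norm _).
  rewrite /ip -RintegralZl// /Rintegral fineK//.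
    by apply: eq_integral => x _; rewrite /F/= mulrA.
  have := integrableZl measurableT (g y) i.
  by move=> /(integrable_fin_num measurableT).
move=> E; rewrite {1}/ip /Rintegral.
under eq_integral do rewrite -E1.
rewrite [X in fine X]E.
by congr fine; apply: eq_integral => y _; rewrite E2.
Qed.

(** The substitution t -> -t leaves g invariant and turns the correlation of p with q into that of q
    with p. *)
Lemma convol_form_sym g p q : mu.-integrable setT (EFin \o g) -> (forall t, g (- t) = g t) ->
  csmooth p -> csmooth q -> ip (convol g p) q = ip (convol g q) p.
Proof.
move=> ig eg cp cq; have mp := smooth_measurable cp.1; have mq := smooth_measurable cq.1.
rewrite (ip_convol ig cp (csmooth_integrable cq)) (ip_convol ig cq (csmooth_integrable cp)).
have mg : measurable_fun setT g by apply/measurable_EFinP; exact: measurable_int ig.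
rewrite /Rintegral -(@integral_reflection R (fun t => (g t * ip (fun x => p (x - t)) q)%:E)).
  congr fine; apply: eq_integral => t _; rewrite eg; congr (_ * _)%:E.
  rewrite -(@ip_shift _ _ _ (- t))//; last by apply: measurable_shift.
  rewrite ipC; congr ip; apply/funext => x; congr p; ring.
apply/measurable_EFinP; apply: measurable_funM => //.
have E : (fun t => ip (fun x => p (x - t)) q) = convol q (refl p).
  by apply/funext => t; apply: eq_Rintegral => x _; rewrite /refl opprB mulrC.
rewrite E; apply: continuous_measurableT => t.
exact: is_derive_cont (is_derive_conv t (csmooth_integrable cq) (csmooth_refl cp)).
Qed.

Lemma convol_form_corr g p : mu.-integrable setT (EFin \o g) -> csmooth p ->
  ip (convol g p) p = \int[mu]_t (g t * corr p t).
Proof.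
move=> ig cp; rewrite (ip_convol ig cp (csmooth_integrable cp)).
by apply: eq_Rintegral => t _; rewrite -(corrN t (csmooth_real_L2 cp)).
Qed.

End convolution_form.

(** * From complex functions to pairs of real ones *)

Section complex_functions.
Context {R : realType}.
Notation mu := (@lebesgue_measure R).
Implicit Types (p q : R -> R) (a : R) (u v w h : R -> R[i]).

Definition cpx p q : R -> R[i] := fun x => (p x) +i* (q x).

Lemma re_cpx p q : re (cpx p q) = p. Proof. by []. Qed.
Lemma im_cpx p q : im (cpx p q) = q. Proof. by []. Qed.

Lemma complex_eta v x : v x = (re v x) +i* (im v x).
Proof. by rewrite /re /im; case: (v x). Qed.

Lemma L2P a v : L2 a v <-> rL2 a (re v) /\ rL2 a (im v).
Proof.
split; first by move/L2_parts => [].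
move=> [[Lp sp] [Lq sq_]]; split; [exact/Lfun_real_L2|exact/Lfun_real_L2|].
move=> x /negP; rewrite /= in_itv/= -ltr_norml -leNgt => ax.
by rewrite complex_eta sp// sq_.
Qed.

Lemma innerE u v : real_L2 (re u) -> real_L2 (im u) -> real_L2 (re v) -> real_L2 (im v) ->
  inner u v = (ip (re u) (re v) + ip (im u) (im v)) +i* (ip (im u) (re v) - ip (re u) (im v)).
Proof.
move=> L1 L2 L3 L4; rewrite /inner /cintegral; congr (_ +i* _).
  rewrite /ip -RintegralD//; try exact: integrable_mul.
  by apply: eq_Rintegral => x _; rewrite (complex_eta u) (complex_eta v)/=; ring.
rewrite /ip -RintegralB//; try exact: integrable_mul.
by apply: eq_Rintegral => x _; rewrite (complex_eta u) (complex_eta v)/=; ring.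
Qed.

Lemma cintegral_mulE u v : real_L2 (re u) -> real_L2 (im u) -> real_L2 (re v) -> real_L2 (im v) ->
  cintegral (fun x => u x * v x) =
  (ip (re u) (re v) - ip (im u) (im v)) +i* (ip (re u) (im v) + ip (im u) (re v)).
Proof.
move=> L1 L2 L3 L4; rewrite /cintegral; congr (_ +i* _).
  rewrite /ip -RintegralB//; try exact: integrable_mul.
  by apply: eq_Rintegral => x _; rewrite (complex_eta u) (complex_eta v)/=; ring.
rewrite /ip -RintegralD//; try exact: integrable_mul.
by apply: eq_Rintegral => x _; rewrite (complex_eta u) (complex_eta v)/=; ring.
Qed.

Lemma supp_closure a v b : b < a -> supp_in b (re v) -> supp_in b (im v) ->
  closure [set x | v x != 0] `<=` `[- b, b].
Proof.
move=> ba sp sq_.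
have cl : closed (`[- b, b]%classic : set R) by exact: interval_closed.
rewrite [X in _ `<=` X]((closure_id _).1 cl); apply: closure_subset => x /= vx.
rewrite in_itv/= -ler_norml leNgt; apply/negP => bx; move/eqP: vx; apply.
by rewrite complex_eta sp ?sq_// ltW.
Qed.

(** On the compact support |x| attains its maximum, which is below a; this provides the radius b.
    Conversely a radius b < a confines the support to the compact segment [-b, b]. *)
Lemma CcinftyP a v : 0 < a -> Ccinfty a v <-> test a (re v) /\ test a (im v).
Proof.
move=> a0; split.
  move=> [sp sq_ cK sK].
  pose K := closure [set x | v x != 0].
  have vK x : v x != 0 -> K x by move=> vx; apply: subset_closure.
  have [b [ba bK]] : exists b, b < a /\ forall x, K x -> `|x| < b.
    have [K0|/set0P[y Ky]] := eqVneq K set0.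
      by exists 0; split => // x; rewrite K0.
    have cn : {within K, continuous (fun x : R => `|x|)}.
      by apply: continuous_subspaceT => x; exact: norm_continuous.
    have [c cK' cmax] := compact_EVT_max (ex_intro _ y Ky) cK cn.
    have ca : `|c| < a.
      by have := sK c; rewrite inE in cK' => /(_ cK'); rewrite /= in_itv/= ltr_norml.
    (* The midpoint lies strictly beyond the support, which reaches |c| itself. *)
    exists ((`|c| + a) / 2); split; first by lra.
    move=> x Kx; have := cmax x; rewrite inE => /(_ Kx); lra.
  have h x : b <= `|x| -> v x = 0.
    by move=> bx; apply/eqP; apply/negPn/negP => /vK/bK; rewrite ltNge bx.
  by split; split => //; exists b => // x /h; rewrite /re /im => ->.
move=> [[sp [b ba sb]] [sq_ [c ca sc]]].
have bc : Num.max b c < a by rewrite gt_max ba.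
have sb' : supp_in (Num.max b c) (re v) by move=> x; rewrite ge_max => /andP[/sb].
have sc' : supp_in (Num.max b c) (im v) by move=> x; rewrite ge_max => /andP[_ /sc].
have sub := supp_closure bc sb' sc'.
split => //.
  by apply: (subclosed_compact _ (@segment_compact R _ _) sub); exact: closed_closure.
move=> x /sub/=; rewrite !in_itv/= => /andP[h1 h2].
by rewrite (le_lt_trans h2 bc) andbT (lt_le_trans _ h1)// ltrN2.
Qed.

Lemma re_cderiv v : re (cderiv v) = derive1 (re v). Proof. by []. Qed.
Lemma im_cderiv v : im (cderiv v) = derive1 (im v). Proof. by []. Qed.

Lemma smooth_real0 : smooth_real (fun _ : R => (0 : R)).
Proof.
apply: (@smooth_class _ (fun f => f = (fun _ => 0))) => // f ->.
by exists (fun _ => 0) => // x; exact: is_derive_cst.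
Qed.

Lemma test0 a : 0 < a -> test a (fun _ : R => (0 : R)).
Proof. by move=> a0; split; [exact: smooth_real0 | exists 0]. Qed.

Lemma derive1_0 : derive1 (fun _ : R => (0 : R)) = (fun _ => 0).
Proof. by apply/funext => x; apply: is_derive_derive1; exact: is_derive_cst. Qed.

Lemma ip0r p : ip p (fun _ => 0) = 0.
Proof. by rewrite /ip /Rintegral integral0_eq// => x _; rewrite mulr0. Qed.

(** A real test function, seen as a complex one, separates the real and imaginary parts of the
    identity. *)
Lemma is_weak_derivP a u w : 0 < a -> is_weak_deriv a u w <->
  rwd a (re u) (re w) /\ rwd a (im u) (im w).
Proof.
move=> a0; split.
  move=> [/L2P[L1 L2] /L2P[L3 L4] D].
  have key psi : test a psi -> ip (re u) (derive1 psi) = - ip (re w) psi /\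
      ip (im u) (derive1 psi) = - ip (im w) psi.
    move=> tp; have td := test_derive1 tp.
    have Lp := (test_rL2 tp).1; have Ld := (test_rL2 td).1.
    have L0 := (test_rL2 (test0 a0)).1.
    have C : Ccinfty a (cpx psi (fun _ => 0)) by apply/CcinftyP => //; split => //; exact: test0.
    have := D _ C.
    rewrite (@cintegral_mulE u (cderiv (cpx psi (fun=> 0))) L1.1 L2.1 Ld); last by rewrite im_cderiv im_cpx derive1_0.
    rewrite (@cintegral_mulE w (cpx psi (fun=> 0)) L3.1 L4.1 Lp L0).
    rewrite re_cderiv im_cderiv re_cpx im_cpx derive1_0 !ip0r !subr0 !add0r => -[-> ->].
    by [].
  by split; split => // psi /key[].
move=> [[L1 L3 D1] [L2 L4 D2]]; split; [by apply/L2P|by apply/L2P|].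
move=> phi /(CcinftyP _ a0)[tp tq].
have Lp := (test_rL2 tp).1; have Ldp := (test_rL2 (test_derive1 tp)).1.
have Lq := (test_rL2 tq).1; have Ldq := (test_rL2 (test_derive1 tq)).1.
rewrite (@cintegral_mulE u (cderiv phi) L1.1 L2.1 Ldp Ldq).
rewrite (@cintegral_mulE w phi L3.1 L4.1 Lp Lq).
rewrite re_cderiv im_cderiv !D1// !D2//; apply/eqP; rewrite eq_complex/=.
by apply/andP; split; apply/eqP; ring.
Qed.

Lemma Ccinfty_L2 a v : 0 < a -> Ccinfty a v -> L2 a v.
Proof. by move=> a0 /(CcinftyP _ a0)[tp tq]; apply/L2P; split; exact: test_rL2. Qed.

Lemma is_weak_deriv_test a v : 0 < a -> Ccinfty a v -> is_weak_deriv a v (cderiv v).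
Proof.
move=> a0 /(CcinftyP _ a0)[tp tq]; apply/is_weak_derivP => //.
by split; exact: rwd_test.
Qed.

Lemma weak_deriv_spec a v : H1 a v -> is_weak_deriv a v (weak_deriv a v).
Proof. by move=> [w vw]; exact: (xgetPex 0 (ex_intro _ w vw)). Qed.

Lemma l2norm0 : l2norm (fun _ : R => (0 : R[i])) = 0.
Proof.
have L0 := (test_rL2 (test0 (@ltr01 R))).1.
apply/eqP; rewrite -sqrf_eq0; apply/eqP.
by rewrite (@l2norm_sqr _ (fun=> 0) L0 L0) !ip0r addr0.
Qed.

Lemma H01_test a v : 0 < a -> Ccinfty a v -> H01 a v.
Proof.
move=> a0 Cv; split; first by exists (cderiv v); exact: is_weak_deriv_test.
move=> e e0; exists v => //.
have E w : w \- w = (fun _ => 0) by apply/funext => x; rewrite /= subrr.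
by rewrite !E l2norm0 expr0n addr0 sqrtr0.
Qed.

End complex_functions.

(** * The quadratic form of B_a on test functions *)

Section operator_form.
Context {R : realType}.
Notation mu := (@lebesgue_measure R).
Implicit Types (p q : R -> R) (a : R) (u v w h : R -> R[i]).

Definition rL20 a p := rL2 a p /\ \int[mu]_x p x = 0.

Lemma L20P a u : L20 a u <-> rL20 a (re u) /\ rL20 a (im u).
Proof.
split.
  by move=> [/L2P[L1 L2]]; rewrite /cintegral => -[h1 h2]; split; split.
move=> [[L1 h1] [L2 h2]]; split; first by apply/L2P.
by rewrite /cintegral; apply/eqP; rewrite eq_complex/=; apply/andP; split; apply/eqP.
Qed.

(** The predicate from which [projL20] chooses, named so that existence and uniqueness up to null
    functions can be treated separately. *)
Definition is_proj a w u := L20 a u /\ forall h, L20 a h -> inner (fun x => w x - u x) h = 0.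

Lemma projL20_spec a w u : is_proj a w u -> is_proj a w (projL20 a w).
Proof. by move=> H; exact: (xgetPex 0 (ex_intro _ u H)). Qed.

Lemma eq_inner_supp a u v h : L2 a h -> (forall x, `|x| < a -> u x = v x) ->
  inner u h = inner v h.
Proof.
move=> [_ _ sh] uv.
have E : (fun x => u x * conjc (h x)) = (fun x => v x * conjc (h x)).
  apply/funext => x; have [xa|ax] := ltP `|x| a; first by rewrite uv.
  rewrite sh; last by rewrite /= in_itv/= -ltr_norml => /(le_lt_trans ax); rewrite ltxx.
  by rewrite conjc0 !mulr0.
by rewrite /inner E.
Qed.

Lemma rL20_0 a : rL20 a (fun _ => 0).
Proof.
split; last by rewrite /Rintegral integral0_eq.
split=> //; have := (test_rL2 (test0 (@ltr01 R))).1 => //.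
Qed.

(** w may grow at infinity; wc is a square-integrable function with the same values on (-a, a), so
    its inner products can be expanded. *)
Lemma is_proj_real a w wc u r : L2 a wc -> (forall x, `|x| < a -> w x = wc x) ->
  is_proj a w u -> rL20 a r ->
  ip (re wc) r = ip (re u) r /\ ip (im wc) r = ip (im u) r.
Proof.
move=> /L2P[[L1 s1] [L2 s2]] wwc [/L20P[[[L3 s3] h3] [[L4 s4] h4]] H] Lr.
have Lh : L20 a (cpx r (fun _ => 0)) by apply/L20P; split => //; exact: rL20_0.
have Lr1 := Lr.1.1; have L0 := (rL20_0 a).1.1.
have := H _ Lh; rewrite (@eq_inner_supp a _ (fun x => wc x - u x) _ Lh.1); last first.
  by move=> x xa; rewrite wwc.
have reB : re (fun x => wc x - u x) = (fun x => re wc x - re u x).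
  by apply/funext => x; rewrite /re; case: (wc x); case: (u x).
have imB : im (fun x => wc x - u x) = (fun x => im wc x - im u x).
  by apply/funext => x; rewrite /im; case: (wc x); case: (u x).
rewrite innerE ?reB ?imB ?re_cpx ?im_cpx//; try exact: real_L2B.
rewrite !ip0r addr0 subr0 !ipBl// => -[/eqP + /eqP].
by rewrite !subr_eq0 => /eqP -> /eqP ->.
Qed.

Lemma rL20B a p q : rL20 a p -> rL20 a q -> rL20 a (fun x => p x - q x).
Proof.
move=> [Lp p0] [Lq q0]; split; first exact: rL2B.
rewrite RintegralB//; first by rewrite p0 q0 subrr.
  exact: integrable_real_L2 Lp.1 Lp.2.
exact: integrable_real_L2 Lq.1 Lq.2.
Qed.

Lemma null_of_orthogonal a p q : rL20 a p -> rL20 a q ->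
  (forall r, rL20 a r -> ip p r = ip q r) ->
  ip (fun x => p x - q x) (fun x => p x - q x) = 0.
Proof.
move=> Lp Lq H; have Ld := rL20B Lp Lq.
rewrite ipBl//; [|exact: Lp.1.1|exact: Lq.1.1|exact: Ld.1.1].
by rewrite H// subrr.
Qed.

Lemma is_proj_unique a w wc u v : L2 a wc -> (forall x, `|x| < a -> w x = wc x) ->
  is_proj a w u -> is_proj a w v ->
  ip (fun x => re u x - re v x) (fun x => re u x - re v x) = 0 /\
  ip (fun x => im u x - im v x) (fun x => im u x - im v x) = 0.
Proof.
move=> Lw wwc Pu Pv.
have [/L20P[u1 u2] _] := Pu; have [/L20P[v1 v2] _] := Pv.
have H r : rL20 a r -> ip (re u) r = ip (re v) r /\ ip (im u) r = ip (im v) r.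
  move=> Lr; have [e1 e2] := is_proj_real Lw wwc Pu Lr.
  by have [e3 e4] := is_proj_real Lw wwc Pv Lr; rewrite -e1 -e2 e3 e4.
split; first by apply: null_of_orthogonal u1 v1 _ => r /H[].
by apply: null_of_orthogonal u2 v2 _ => r /H[].
Qed.

Definition mean a p : R := (2 * a)^-1 * \int[mu]_x clip a p x.

(** An explicit representative of the projection of a continuous function onto mean-zero functions
    on (-a, a). *)
Definition centered a p : R -> R := clip a (fun x => p x - mean a p).

Lemma rL20_centered a p : 0 < a -> continuous p -> rL20 a (centered a p).
Proof.
move=> a0 cp.
have cc (c : R) : continuous (fun _ : R => c) by move=> x; exact: cvg_cst.
have cB : continuous (fun x => p x - mean a p).
  by move=> x; apply: cvgB; [exact: cp | exact: cc].
split; first exact: rL2_clip.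
have Lp := rL2_clip a cp; have Lc := rL2_clip a (cc (mean a p)).
have E x : centered a p x = clip a p x - clip a (fun _ => mean a p) x.
  by rewrite /centered /clip mulrBl.
under eq_Rintegral do rewrite E.
rewrite RintegralB//; [|exact: integrable_real_L2 Lp.1 Lp.2|exact: integrable_real_L2 Lc.1 Lc.2].
have -> : \int[mu]_x clip a (fun _ => mean a p) x = mean a p * (2 * a).
  rewrite /clip RintegralZl//; last first.
    have := integrable_real_L2 (rL2_clip a (cc 1)).1 (rL2_clip a (cc 1)).2.
    by apply: eq_integrable => // x _; rewrite /= /clip mul1r.
  congr (_ * _); rewrite /Rintegral integral_indic//= setIT lebesgue_measure_itv/=.
  by rewrite lte_fin (lt_trans _ a0) ?oppr_lt0//= opprK mulrDl mul1r.
by rewrite /mean mulrAC mulVf ?mul1r ?subrr// lt0r_neq0// mulr_gt0.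
Qed.

Lemma is_proj_centered a w p q : 0 < a -> continuous p -> continuous q ->
  (forall x, `|x| < a -> w x = cpx p q x) ->
  is_proj a w (cpx (centered a p) (centered a q)).
Proof.
move=> a0 cp cq wE.
have cc (c : R) : continuous (fun _ : R => c) by move=> x; exact: cvg_cst.
split; first by apply/L20P; split; exact: rL20_centered.
move=> h Lh; have /L20P[[h1 i1] [h2 i2]] := Lh.
have Lc c := rL2_clip a (cc c).
rewrite (@eq_inner_supp a _ (cpx (clip a (fun _ => mean a p)) (clip a (fun _ => mean a q))) _ Lh.1).
  rewrite innerE ?re_cpx ?im_cpx//; try exact: (Lc _).1; [|exact: h1.1|exact: h2.1].
  have key (c : R) r : rL2 a r -> \int[mu]_x r x = 0 -> ip (clip a (fun _ => c)) r = 0.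
    move=> [Lr sr] r0; rewrite ip_clip// /ip RintegralZl ?r0 ?mulr0//.
    exact: integrable_real_L2 Lr sr.
  by rewrite !key// addr0 subr0.
move=> x xa; rewrite wE// /cpx /centered !clipE xa.
by apply/eqP; rewrite eq_complex/=; apply/andP; split; apply/eqP; ring.
Qed.

Lemma rL20_test_derive a psi : test a psi -> rL20 a (derive1 psi).
Proof.
move=> t; split; first exact: test_rL2 (test_derive1 t).
have d1 (x : R) : is_derive x (1 : R) (fun _ : R => (1 : R)) ((fun _ => 0) x) by exact: is_derive_cst.
have c0 : continuous (fun _ : R => (0 : R)) by move=> x; exact: cvg_cst.
have [sp [b _ sb]] := t.
have := ip_derive1 d1 c0 sp sb.
rewrite [ip (fun=> 0) _]ipC ip0r oppr0 => <-.
by apply: eq_Rintegral => x _; rewrite mul1r.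
Qed.

Lemma re_mulI u : re (fun x => 'i%C * u x) = (fun x => - im u x).
Proof. by apply/funext => x; rewrite /re /im; case: (u x) => y z /=; ring. Qed.

Lemma im_mulI u : im (fun x => 'i%C * u x) = re u.
Proof. by apply/funext => x; rewrite /re /im; case: (u x) => y z /=; ring. Qed.

Lemma tscrew_shift_real_L2 (T x : R) : real_L2 (fun y => tscrew T (x - y)).
Proof.
have Lg : real_L2 (tscrew T).
  have [M M0 gM] := tscrew_bounded T; split; first exact: measurable_tscrew.
  have h : mu.-integrable setT (EFin \o (fun x => tscrew T x ^+ 2)).
    apply: (@bounded_supp_integrable _ _ (T + 1) (M ^+ 2)).
    - by apply: measurable_funX; exact: measurable_tscrew.
    - by move=> y /tscrew_supp ->; rewrite expr0n.
    - by move=> y; rewrite normrX lerXn2r ?nnegrE.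
  exact: (integrable_lty measurableT h).
have := real_L2_reflect (real_L2_shift x Lg).
by congr real_L2; apply/funext => y; rewrite addrC.
Qed.

(** u is known only up to a null function. Translates of the truncated kernel are square-integrable,
    so integrating against them allows u to be replaced by its smooth model; x - y stays within 2a
    on the support. *)
Lemma Gop_cpx a u p q : rL2 a (re u) -> rL2 a (im u) -> csmooth p -> csmooth q ->
  (forall r, real_L2 r -> ip (re u) r = ip p r) ->
  (forall r, real_L2 r -> ip (im u) r = ip q r) ->
  forall x, `|x| < a ->
  Gop u x = cpx (convol (tscrew (2 * a)) p) (convol (tscrew (2 * a)) q) x.
Proof.
move=> Lu Lv cp cq Hp Hq x xa.
have key r s : supp_in a r -> csmooth s -> (forall k, real_L2 k -> ip r k = ip s k) ->
    \int[mu]_y (screw (x - y) * r y) = convol (tscrew (2 * a)) s x.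
  move=> sr cs H; have ms := smooth_measurable cs.1.
  rewrite (convE _ (measurable_tscrew _) ms).
  rewrite -[RHS](H _ (tscrew_shift_real_L2 (2 * a) x)).
  apply: eq_Rintegral => y _; have [ay|ya] := leP a `|y|.
    by rewrite sr// mulr0 mul0r.
  have xy : `|x - y| <= 2 * a by have := ler_normB x y; lra.
  by rewrite /tscrew xy mulrC.
rewrite /Gop /cintegral /cpx; congr (_ +i* _).
  rewrite -(key _ _ Lu.2 cp Hp); apply: eq_Rintegral => y _.
  by rewrite /re; case: (u y) => r s /=; ring.
rewrite -(key _ _ Lv.2 cq Hq); apply: eq_Rintegral => y _.
by rewrite /im; case: (u y) => r s /=; ring.
Qed.

Definition gform a p q : R := ip (convol (tscrew (2 * a)) (derive1 p)) (derive1 q).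

Lemma inner_Bop_algebra (x1 x2 x3 x4 x5 x6 x7 x8 x9 x10 x11 x12 x13 x14 : R) :
  x1 = - x5 -> x2 = - x6 -> x3 = - x7 -> x4 = - x8 ->
  x9 = x1 -> x11 = x3 -> x10 = x2 -> x12 = x4 -> x10 = - x13 -> x9 = - x14 -> x12 = x14 ->
  (- x7 + x6) +i* (x5 - - x8) = (x11 + x13)%:C.
Proof. by move=> *; apply/eqP; rewrite eq_complex/=; apply/andP; split; apply/eqP; lra. Qed.

(** Each choice in the operator is compared with a smooth model: i v' for D v, convolution with the
    truncated kernel for G, subtraction of the mean for the projection. The outer derivative is
    moved back onto v by the weak derivative identity, and the subtracted means are orthogonal to
    derivatives of test functions. *)
Lemma inner_Bop a v : 0 < a -> Ccinfty a v ->
  inner (Bop a v) v = (gform a (re v) (re v) + gform a (im v) (im v))%:C.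
Proof.
move=> a0 Cv; have /(CcinftyP _ a0)[tp tq] := Cv.
set P := re v in tp *; set Q := im v in tq *.
have tP := test_derive1 tp; have tQ := test_derive1 tq.
have LP := (test_rL2 tP).1; have LQ := (test_rL2 tQ).1.
have cP := test_csmooth tP; have cQ := test_csmooth tQ.
have H01v := H01_test a0 Cv; have H1v := H01v.1.
set wd := weak_deriv a v.
have /(is_weak_derivP _ _ a0)[D1 D2] := weak_deriv_spec H1v.
have [_ Lw1 _] := D1; have [_ Lw2 _] := D2.
have null0 p : ip (fun x => p x - p x) (fun x => p x - p x) = 0.
  by under [X in ip _ X]eq_fun do rewrite subrr; exact: ip0r.
have N1 := rwd_unique a0 D1 (rwd_test tp) (null0 _).
have N2 := rwd_unique a0 D2 (rwd_test tq) (null0 _).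
set u := fun x => 'i%C * wd x.
have DE : Dop a v = u by rewrite /Dop mem_set.
pose Q' x := - derive1 Q x.
have LQ' : rL2 a Q'.
  split; first by have := real_L2Z (-1) LQ; congr real_L2; apply/funext => x; rewrite mulN1r.
  by move=> x ax; rewrite /Q' (test_rL2 tQ).2// oppr0.
have iQ' : \int[mu]_x Q' x = 0.
  have [_ h] := rL20_test_derive tq.
  have iQ := integrable_real_L2 LQ (test_rL2 tQ).2.
  have := RintegralZl (-1) measurableT iQ; rewrite h mulr0 => <-.
  by apply: eq_Rintegral => x _; rewrite mulN1r.
have cQ' : csmooth Q'.
  split; last by exists a; exact: LQ'.2.
  have := @smooth_scale R (derive1 Q) (-1) 1 cQ.1; congr smooth_real.
  by apply/funext => x; rewrite mulN1r mul1r.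
have Lu : L2 a u.
  apply/L2P; rewrite re_mulI im_mulI; split => //; split.
    by have := real_L2Z (-1) Lw2.1; congr real_L2; apply/funext => x; rewrite mulN1r.
  by move=> x ax; rewrite Lw2.2// oppr0.
(* i v' already has mean zero, so it represents its own projection. *)
have Pu : is_proj a u (cpx Q' (derive1 P)).
  split; first by apply/L20P; split; [split | exact: rL20_test_derive].
  move=> h /L20P[[Lh1 _] [Lh2 _]].
  have B1 : re (fun x => u x - cpx Q' (derive1 P) x) = (fun x => derive1 Q x - im wd x).
    by apply/funext => x; rewrite /u /cpx /Q' /re /im; case: (wd x) => y z /=; ring.
  have B2 : im (fun x => u x - cpx Q' (derive1 P) x) = (fun x => re wd x - derive1 P x).
    by apply/funext => x; rewrite /u /cpx /Q' /re /im; case: (wd x) => y z /=; ring.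
  have N2' : ip (fun x => derive1 Q x - im wd x) (fun x => derive1 Q x - im wd x) = 0.
    by rewrite -[RHS]N2; apply: eq_Rintegral => x _; ring.
  have L1 := real_L2B LQ Lw2.1; have L2 := real_L2B Lw1.1 LP.
  rewrite innerE ?B1 ?B2//; [|exact: Lh1.1|exact: Lh2.1].
  rewrite (null_ip L1 Lh1.1 N2') (null_ip L2 Lh2.1 N1) (null_ip L2 Lh1.1 N1).
  by rewrite (null_ip L1 Lh2.1 N2') addr0 subr0.
have Pu1 := projL20_spec Pu.
set u1 := projL20 a u in Pu1.
have [E1 E2] := is_proj_unique Lu (fun _ _ => erefl) Pu1 Pu.
have [/L20P[[Lu1 _] [Lu2 _]] _] := Pu1.
have GE := Gop_cpx Lu1 Lu2 cQ' cP (null_subl Lu1.1 LQ'.1 E1) (null_subl Lu2.1 LP E2).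
set A1 := convol (tscrew (2 * a)) Q' in GE.
set A2 := convol (tscrew (2 * a)) (derive1 P) in GE.
have ig := @tscrew_integrable R (2 * a).
have sA1 : smooth_real A1 := smooth_conv ig cQ'.
have sA2 : smooth_real A2 := smooth_conv ig cP.
have cA1 := smooth_continuous sA1; have cA2 := smooth_continuous sA2.
have Pm := is_proj_centered a0 cA1 cA2 GE.
have Pm1 := projL20_spec Pm.
set m := projL20 a (Gop u1) in Pm1.
have Lc : L2 a (cpx (clip a A1) (clip a A2)) by apply/L2P; split; exact: rL2_clip.
have GEc x : `|x| < a -> Gop u1 x = cpx (clip a A1) (clip a A2) x.
  by move=> xa; rewrite GE// /cpx !clipE xa.
have [M1 M2] := is_proj_unique Lc GEc Pm Pm1.
have [/L20P[[Lm1 _] [Lm2 _]] _] := Pm1.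
have dcen A : smooth_real A -> rwd a (centered a A) (clip a (derive1 A)).
  move=> sA; apply: rwd_clip; last exact: smooth_continuous (smooth_derive1 sA).
  move=> x; have := is_derive_sub (smooth_is_derive sA x) (is_derive_cst (mean a A) x 1).
  by rewrite subr0.
have H1m : H1 a m.
  exists (cpx (clip a (derive1 A1)) (clip a (derive1 A2))); apply/(is_weak_derivP _ _ a0).
  by split; [exact: rwd_eq (dcen _ sA1) Lm1 M1 | exact: rwd_eq (dcen _ sA2) Lm2 M2].
have /(is_weak_derivP _ _ a0)[[_ Lwm1 F1] [_ Lwm2 F2]] := weak_deriv_spec H1m.
have BE : Bop a v = fun x => 'i%C * weak_deriv a m x.
  by rewrite /Bop /Gop_a DE -/u1 -/m /Dop_adj mem_set.
set wm := weak_deriv a m in BE F1 F2 Lwm1 Lwm2.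
have Lv1 := (test_rL2 tp).1; have Lv2 := (test_rL2 tq).1.
have Ln : real_L2 (fun x => - im wm x).
  by have := real_L2Z (-1) Lwm2.1; congr real_L2; apply/funext => x; rewrite mulN1r.
have ipN (r s : R -> R) : real_L2 r -> real_L2 s -> ip (fun x => - r x) s = - ip r s.
  move=> Lr Ls; rewrite -mulN1r -ipZl//; congr ip; apply/funext => x; by rewrite mulN1r.
rewrite BE innerE ?re_mulI ?im_mulI//; try exact: Lwm1.1.
rewrite -/P -/Q !ipN//; try exact: Lwm2.1.
have [G1 G2] := is_proj_real Lc GEc Pm1 (rL20_test_derive tp).
have [G3 G4] := is_proj_real Lc GEc Pm1 (rL20_test_derive tq).
have sP := (test_rL2 tP).2; have sQ := (test_rL2 tQ).2.
move: G1 G2 G3 G4; rewrite re_cpx im_cpx !(ip_clip _ sP) !(ip_clip _ sQ) => G1 G2 G3 G4.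
have K1 := F1 _ tp; have K2 := F1 _ tq; have K3 := F2 _ tp; have K4 := F2 _ tq.
have cgQ : csmooth (convol (tscrew (2 * a)) (derive1 Q)).
  split; first exact: smooth_conv ig cQ.
  have [_ [b sb]] := cQ; exists (2 * a + 1 + b).
  exact: conv_supp (@tscrew_supp _ _) sb.
have A1E r : csmooth r -> ip A1 r = - ip (convol (tscrew (2 * a)) (derive1 Q)) r.
  move=> cr; rewrite -ipN; [|exact: csmooth_real_L2|exact: csmooth_real_L2].
  congr ip; apply/funext => x; rewrite /A1 /convol /Q' -mulN1r -RintegralZl//.
    by apply: eq_Rintegral => z _; ring.
  by apply: integrable_conv => //; [exact: smooth_measurable cQ.1 | exact: csmooth_bounded].
(* This symmetry cancels the cross terms, so the form value is real. *)
have cr := convol_form_sym ig (@tscrewN R (2 * a)) cP cQ.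
exact: (inner_Bop_algebra K1 K2 K3 K4 G1 G2 G3 G4 (A1E _ cQ) (A1E _ cP) cr).
Qed.

End operator_form.

(** * Density in the form domain and the infimum *)

Section approximation.
Context {R : realType}.
Notation mu := (@lebesgue_measure R).
Implicit Types (p q psi : R -> R) (a : R) (v w phi : R -> R[i]).

Definition Qreal p : R := creg p + fine (en p).

Definition creg_bound a : R := regular_bound (2 * a) + `|weil_cst|.

Lemma creg_bound_ge0 a : 0 <= creg_bound a.
Proof. by rewrite addr_ge0// regular_bound_ge0. Qed.

Lemma en_fineK p : (en p < +oo)%E -> (fine (en p))%:E = en p.
Proof. by move=> ep; rewrite fineK// ge0_fin_numE// en_ge0. Qed.

Lemma Qreal_ge a p : rL2 a p -> - (creg_bound a * ip p p) <= Qreal p.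
Proof.
move=> [Lp sp]; have := creg_le Lp sp; rewrite -/(creg_bound a) ler_norml => /andP[h _].
by rewrite /Qreal; have := fine_ge0 (en_ge0 p); lra.
Qed.

Lemma QW_real a v : L2 a v -> (en (re v) < +oo)%E -> (en (im v) < +oo)%E ->
  QW v = (Qreal (re v) + Qreal (im v))%:E.
Proof.
move=> Lv e1 e2; rewrite (QWE Lv) -(en_fineK e1) -(en_fineK e2) -!EFinD.
by rewrite /Qreal addrACA.
Qed.

Lemma domQW_en a v : domQW a v -> (en (re v) < +oo)%E /\ (en (im v) < +oo)%E.
Proof.
move=> [Lv]; rewrite (QWE Lv).
have := en_ge0 (re v); have := en_ge0 (im v).
by case: (en (re v)) => [r| |]; case: (en (im v)) => [s| |]; rewrite ?ltry.
Qed.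

Lemma domQWP a v : L2 a v -> (en (re v) < +oo)%E -> (en (im v) < +oo)%E -> domQW a v.
Proof. by move=> Lv e1 e2; split=> //; rewrite (QW_real Lv e1 e2) ltry. Qed.

Lemma l2norm_sqrE a v : L2 a v -> l2norm v ^+ 2 = ip (re v) (re v) + ip (im v) (im v).
Proof. by move=> /L2P[[L1 _] [L2 _]]; exact: l2norm_sqr. Qed.

Lemma Qreal_test a psi : 0 < a -> test a psi ->
  (en psi < +oo)%E /\ gform a psi psi = Qreal psi.
Proof.
move=> a0 tp; have [sp [b ba sb]] := tp.
have T0 : 0 < 2 * a by rewrite mulr_gt0.
have bT : 2 * b < 2 * a by lra.
have [e E] := screw_form sp sb T0 bT; split=> //.
rewrite /Qreal -E /gform; apply: convol_form_corr; first exact: tscrew_integrable.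
exact: test_csmooth (test_derive1 tp).
Qed.

Lemma Ccinfty_dom a v : 0 < a -> Ccinfty a v -> domQW a v.
Proof.
move=> a0 Cv; have /(CcinftyP _ a0)[tp tq] := Cv.
apply: domQWP (Ccinfty_L2 a0 Cv) _ _.
  exact: (Qreal_test a0 tp).1.
exact: (Qreal_test a0 tq).1.
Qed.

Lemma rayleighQW_real a v : domQW a v ->
  rayleighQW v = (Qreal (re v) + Qreal (im v)) / (ip (re v) (re v) + ip (im v) (im v)).
Proof.
move=> dv; have [e1 e2] := domQW_en dv; have [Lv _] := dv.
by rewrite /rayleighQW (QW_real Lv e1 e2) (l2norm_sqrE Lv).
Qed.

Lemma rayleighB_test a v : 0 < a -> Ccinfty a v -> rayleighB a v = (rayleighQW v)%:C.
Proof.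
move=> a0 Cv; have /(CcinftyP _ a0)[tp tq] := Cv.
have dv := Ccinfty_dom a0 Cv.
rewrite (rayleighQW_real dv) /rayleighB (inner_Bop a0 Cv) (l2norm_sqrE dv.1).
rewrite (Qreal_test a0 tp).2 (Qreal_test a0 tq).2.
by rewrite fmorph_div.
Qed.

Lemma approx_algebra (x k1 A E e : R) : 0 < e -> 0 <= A ->
  x + e * k1 + (E + e * (E + 2)) <= x + E + e * (A + 2 + k1 + E + 2).
Proof. by move=> e0 A0; have := mulr_ge0 (ltW e0) A0; lra. Qed.

Lemma quotient_algebra (z x1 x2 y1 y2 s1 s2 q1 q2 e C1 C2 : R) :
  `|y1 - x1| <= e * C1 -> `|y2 - x2| <= e * C2 ->
  q1 <= s1 + e * C1 -> q2 <= s2 + e * C2 -> z * (y1 + y2) <= q1 + q2 ->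
  z * (x1 + x2) <= s1 + s2 + e * ((C1 + C2) * (`|z| + 1)).
Proof.
rewrite !ler_norml => /andP[h1 h2] /andP[h3 h4] h5 h6 h7.
have : z * (x1 + x2 - (y1 + y2)) <= `|z| * (e * C1 + e * C2).
  apply: (le_trans (ler_norm _)); rewrite normrM ler_wpM2l// ler_norml.
  by apply/andP; split; lra.
lra.
Qed.

Lemma split_algebra (x1 x2 l y1 y2 m : R) : x1 + l * y1 < m -> x2 + l * y2 < m ->
  x1 + x2 + l * (y1 + y2) < 2 * m.
Proof. lra. Qed.

(** An upper bound for the form suffices to compare infima. The error is linear in e, with a
    constant that depends on a and p only. *)
Lemma Qreal_approx a p : 0 < a -> rL2 a p -> (en p < +oo)%E ->
  exists2 C : R, 0 <= C & forall e : R, 0 < e -> e <= 1 ->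
  exists2 psi, test a psi &
    `|ip psi psi - ip p p| <= e * C /\ Qreal psi <= Qreal p + e * C.
Proof.
move=> a0 [Lp sp] ep; set K := creg_bound a; set A := ip p p; set E := fine (en p).
have K0 : 0 <= K by exact: creg_bound_ge0.
have A0 : 0 <= A by exact: ip_ge0.
have E0 : 0 <= E by exact/fine_ge0/en_ge0.
exists (A + 2 + K * (2 * A + 2) + E + 2); first by rewrite !addr_ge0// mulr_ge0// addr_ge0// mulr_ge0.
move=> e e0 e1.
(* Accuracy e^2 keeps the errors weighted by 1/e, for the norm as well as for the energy, at most
   e. *)
have [psi [b [s_psi [ba sb] h1 h2]]] := csmooth_dense a0 Lp sp ep (exprn_gt0 2 e0).
have tpsi : test a psi by split => //; exists b.
have [Lpsi spsi] := test_rL2 tpsi.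
exists psi => //.
have Lr := real_L2B Lp Lpsi.
set r := fun x => p x - psi x in h1 h2 Lr.
have B1 : ip r r <= e ^+ 2 by rewrite ltW// -lte_fin -sqE.
have B0 := ip_ge0 r.
have eB : e^-1 * ip r r <= e by rewrite ler_pdivrMl// -expr2.
have ei : 0 < e^-1 by rewrite invr_gt0.
have ee : e ^+ 2 <= e by rewrite expr2 ler_piMl// ltW.
have X := norm_ip_le e0 Lp Lr; rewrite -/A in X.
have psiE : ip psi psi = A - 2 * ip p r + ip r r.
  have -> : psi = (fun x => p x - r x) by apply/funext => x; rewrite /r; ring.
  by rewrite ip_sqB.
have D1 : `|ip psi psi - A| <= e * (A + 2).
  rewrite psiE; move: X; rewrite !ler_norml => /andP[X1 X2]; apply/andP; split; lra.
have D2 : creg psi <= creg p + e * (K * (2 * A + 2)).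
  have c1 : `|creg p - creg psi| <= K * (e * (A + ip psi psi) / 2 + e^-1 * ip r r).
    exact: (cregB_le e0 Lp Lpsi sp spsi).
  have B2 : ip psi psi <= 2 * A + 2.
    move: D1; rewrite ler_norml => /andP[_ d]; have : e * (A + 2) <= 1 * (A + 2).
      by rewrite ler_wpM2r// addr_ge0.
    lra.
  have B3 : e * (A + ip psi psi) / 2 + e^-1 * ip r r <= e * (2 * A + 2).
    have : e * ip psi psi <= e * (2 * A + 2) by rewrite ler_pM2l.
    have : 0 <= e * A by rewrite mulr_ge0// ltW.
    lra.
  have c2 := le_trans c1 (ler_wpM2l K0 B3).
  rewrite -lerBlDl mulrCA; apply: le_trans c2; rewrite distrC; exact: ler_norm.
have D3 : (en psi <= (E + e * (E + 2))%:E)%E.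
  have -> : en psi = en (fun x => p x + (- r x))%R.
    by apply: eq_en => x; rewrite /r; ring.
  have mN : measurable_fun setT (fun x : R => - r x) by exact: measurableT_comp Lr.1.
  apply: (le_trans (le_enD e0 Lp.1 mN)).
  rewrite (enN r) -(en_fineK ep) -/E.
  have er : (en r <= (e ^+ 2)%:E)%E by exact: ltW.
  have erf : (en r < +oo)%E by rewrite (le_lt_trans er)// ltry.
  move: er; rewrite -(en_fineK erf) lee_fin => er.
  rewrite -!EFinM -EFinD lee_fin.
  have : e^-1 * fine (en r) <= e by rewrite ler_pdivrMl// -expr2.
  move: (fine (en r)) er => y er ey; rewrite !mulrDl !mul1r; lra.
have D4 : fine (en psi) <= E + e * (E + 2).
  by have := (Qreal_test a0 tpsi).1 => epsi; rewrite -lee_fin en_fineK.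
have K1 : 0 <= K * (2 * A + 2) by rewrite mulr_ge0// addr_ge0// mulr_ge0.
split; first by apply: (le_trans D1); rewrite ler_pM2l//; lra.
apply: (le_trans (lerD D2 D4)); exact: approx_algebra.
Qed.

Lemma form_norm_dense a v : 0 < a -> domQW a v -> forall e : R, 0 < e ->
  exists2 phi : R -> R[i], Ccinfty a phi & (normQW a (v \- phi)%R < e%:E)%E.
Proof.
move=> a0 dv e e0; have [e1 e2] := domQW_en dv; have [/L2P[[L1 s1] [L2 s2]] _] := dv.
(* The three summands bound the regular part, the L2 term of the form norm and the energy; with
   accuracy d the real and imaginary parts each contribute less than d C = e^2 / 2. *)
pose C := creg_bound a + `|1 - lambda a| + 1.
have C0 : 0 < C by rewrite ltr_wpDl// addr_ge0// creg_bound_ge0.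
have d0 : 0 < e ^+ 2 / (2 * C) by rewrite divr_gt0 ?exprn_gt0// mulr_gt0.
set d := e ^+ 2 / (2 * C) in d0.
have dC : 2 * (d * C) = e ^+ 2 by rewrite /d; field; exact: lt0r_neq0.
have [p [b [sp [ba sb] hp1 hp2]]] := csmooth_dense a0 L1 s1 e1 d0.
have [q [c [sq_ [ca sc] hq1 hq2]]] := csmooth_dense a0 L2 s2 e2 d0.
have tp : test a p by split => //; exists b.
have tq : test a q by split => //; exists c.
have [Lp sp'] := test_rL2 tp; have [Lq sq'] := test_rL2 tq.
exists (cpx p q); first by apply/CcinftyP.
have rE : re (v \- cpx p q) = (fun x => re v x - p x).
  by apply/funext => x; rewrite /re /=; case: (v x).
have iE : im (v \- cpx p q) = (fun x => im v x - q x).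
  by apply/funext => x; rewrite /im /=; case: (v x).
have R1 := rL2B (conj L1 s1) (conj Lp sp'); have R2 := rL2B (conj L2 s2) (conj Lq sq').
have Lw : Defs.L2 a (v \- cpx p q) by apply/L2P; rewrite rE iE.
have f1 := lt_trans hp2 (ltry d); have f2 := lt_trans hq2 (ltry d).
have main (r : R -> R) : rL2 a r -> (sq r < d%:E)%E -> (en r < d%:E)%E ->
    Qreal r + (1 - lambda a) * ip r r < d * C.
  move=> [Lr sr] h1 h2.
  have B1 : ip r r < d by rewrite -lte_fin -sqE.
  have B2 : fine (en r) < d by rewrite -lte_fin (en_fineK (lt_trans h2 (ltry d))).
  have B3 : creg r <= creg_bound a * d.
    apply: le_trans (ler_norm _) _; apply: le_trans (creg_le Lr sr) _.
    by rewrite ler_wpM2l ?creg_bound_ge0// ltW.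
  have B4 : (1 - lambda a) * ip r r <= `|1 - lambda a| * d.
    apply: (le_trans (ler_norm _)); rewrite normrM ler_wpM2l//.
    by rewrite ger0_norm ?ip_ge0// ltW.
  rewrite /Qreal /C; lra.
have M1 := main _ R1 hp1 hp2; have M2 := main _ R2 hq1 hq2.
have f1' : (en (re (v \- cpx p q)%R) < +oo)%E
  by rewrite rE; exact: f1.
have f2' : (en (im (v \- cpx p q)%R) < +oo)%E
  by rewrite iE; exact: f2.
rewrite /normQW (QW_real Lw f1' f2') (l2norm_sqrE Lw) rE iE -EFinD /sqrte lte_fin.
set X := (X in Num.sqrt X).
have X1 : X < e ^+ 2 by rewrite -dC; exact: split_algebra M1 M2.
(* The sign of the radicand is not established here; the square root of a negative number is 0 by
   convention. *)
have [X0|X0] := lerP 0 X; last by rewrite ltr0_sqrtr.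
by rewrite -(ltr_pXn2r (ltn0Sn 1)) ?nnegrE ?sqrtr_ge0 ?ltW// sqr_sqrtr.
Qed.

Lemma exists_test a : 0 < a -> exists2 v, Ccinfty a v & l2norm v != 0.
Proof.
move=> a0; have d0 : 0 < a / 2 by rewrite divr_gt0.
have t : test a (rho (a / 2)).
  by split; [exact: (csmooth_rho d0).1 | exists (a / 2); [lra | exact: rho_supp_in]].
have [Lr sr] := test_rL2 t.
have L0 := (test_rL2 (test0 a0)).1.
have Cv : Ccinfty a (cpx (rho (a / 2)) (fun _ => 0)).
  by apply/CcinftyP => //; split => //; exact: test0.
exists (cpx (rho (a / 2)) (fun _ => 0)) => //.
apply/eqP => n0; have := l2norm_sqrE (Ccinfty_L2 a0 Cv).
rewrite n0 expr0n/= re_cpx im_cpx ip0r addr0 => /esym r0.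
have := null_ip Lr (real_L2_ind (- a) a) r0.
have -> : ip (rho (a / 2)) (ind (- a) a) = \int[mu]_x rho (a / 2) x.
  apply: eq_Rintegral => x _; rewrite indE -ler_norml.
  by case: leP => xa; rewrite ?mulr1// sr ?mul0r// ltW.
by rewrite rho_mass// => /eqP; rewrite oner_eq0.
Qed.

(** Lower boundedness, without which the real [inf] in [lambda] would be a default value. *)
Lemma rayleighQW_ge a v : domQW a v -> l2norm v != 0 -> - creg_bound a <= rayleighQW v.
Proof.
move=> dv v0; have [Lv _] := dv.
rewrite (rayleighQW_real dv).
have N0 : 0 < ip (re v) (re v) + ip (im v) (im v).
  by rewrite -(l2norm_sqrE Lv) lt0r sqrf_eq0 v0 sqr_ge0.
have /L2P[L1 L2] := Lv.
rewrite ler_pdivlMr// mulNr mulrDr opprD.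
by apply: lerD; exact: Qreal_ge.
Qed.

Lemma lambda_le a v : domQW a v -> l2norm v != 0 -> lambda a <= rayleighQW v.
Proof.
move=> dv v0; apply: ge_inf; last by exists v.
by exists (- creg_bound a) => _ [w [dw w0] <-]; exact: rayleighQW_ge.
Qed.

Lemma le_lambda a (z : R) : 0 < a ->
  (forall v, Ccinfty a v -> l2norm v != 0 -> z <= rayleighQW v) -> z <= lambda a.
Proof.
move=> a0 H; apply: lb_le_inf.
  have [v Cv v0] := exists_test a0.
  by exists (rayleighQW v); exists v => //; split => //; exact: Ccinfty_dom.
move=> _ [v [dv v0] <-].
have [Lv _] := dv; have [e1 e2] := domQW_en dv; have /L2P[L1 L2] := Lv.
have N0 : 0 < ip (re v) (re v) + ip (im v) (im v).
  by rewrite -(l2norm_sqrE Lv) lt0r sqrf_eq0 v0 sqr_ge0.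
rewrite (rayleighQW_real dv) ler_pdivlMr//.
have [C1 C10 A1] := Qreal_approx a0 L1 e1; have [C2 C20 A2] := Qreal_approx a0 L2 e2.
set N := ip (re v) (re v) + ip (im v) (im v) in N0 *.
set Q := Qreal (re v) + Qreal (im v).
pose C := (C1 + C2) * (`|z| + 1).
have C0 : 0 <= C by rewrite mulr_ge0// addr_ge0.
have key e : 0 < e -> e <= 1 -> z * N <= Q + e * C.
  move=> e0 e1'; have [p tp [p1 p2]] := A1 e e0 e1'; have [q tq [q1 q2]] := A2 e e0 e1'.
  have Cphi : Ccinfty a (cpx p q) by apply/CcinftyP.
  have dphi := Ccinfty_dom a0 Cphi.
  have h : z * (ip p p + ip q q) <= Qreal p + Qreal q.
    (* The approximating test function may have norm 0; then the left side is 0 and [Qreal_ge] makes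
       the right side nonnegative. *)
    have [n0|n0] := eqVneq (l2norm (cpx p q)) 0.
      have := l2norm_sqrE dphi.1; rewrite n0 expr0n/= re_cpx im_cpx => /esym s0.
      have /andP[/eqP p0 /eqP q0] : (ip p p == 0) && (ip q q == 0).
        by rewrite -paddr_eq0 ?ip_ge0// s0.
      have Q1 := Qreal_ge (test_rL2 tp); have Q2 := Qreal_ge (test_rL2 tq).
      rewrite p0 mulr0 oppr0 in Q1; rewrite q0 mulr0 oppr0 in Q2.
      by rewrite s0 mulr0; exact: (addr_ge0 Q1 Q2).
    have := H _ Cphi n0; rewrite (rayleighQW_real dphi) re_cpx im_cpx ler_pdivlMr//.
    by rewrite -(l2norm_sqrE dphi.1) lt0r sqrf_eq0 n0 sqr_ge0.
  exact: quotient_algebra p1 q1 p2 q2 h.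
apply/ler_addgt0Pr => d d0.
have e0 : 0 < Num.min 1 (d / (C + 1)) by rewrite lt_min ltr01 divr_gt0// ltr_wpDl.
have e1' : Num.min 1 (d / (C + 1)) <= 1 by rewrite ge_min lexx.
apply: (le_trans (key _ e0 e1')); rewrite lerD2l.
apply: (@le_trans _ _ (d / (C + 1) * C)); first by rewrite ler_wpM2r// ge_min lexx orbT.
by rewrite mulrAC ler_pdivrMr ?ltr_wpDl// ler_pM2l// lerDl.
Qed.

End approximation.

Theorem corollary1p2 (R : realType) (a : R) (ha : 0 < a) :
  (forall v : R -> R[i], domQW a v -> l2norm v != 0 ->
     rayleighQW v = lambda a ->
     forall e : R, 0 < e ->
     exists2 phi : R -> R[i], Ccinfty a phi & (normQW a (v \- phi)%R < e%:E)%E)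
  /\ infimums
       [set rayleighB a v | v in [set v : R -> R[i] | Ccinfty a v /\ l2norm v != 0]]
       (lambda a)%:C.
Proof.
split; first by move=> v dv _ _; exact: form_norm_dense.
split.
  move=> _ [v [Cv v0] <-]; rewrite (rayleighB_test ha Cv) lecR.
  exact: lambda_le (Ccinfty_dom ha Cv) v0.
move=> z zlb.
have zle v : Ccinfty a v -> l2norm v != 0 -> z <= (rayleighQW v)%:C.
  by move=> Cv v0; rewrite -(rayleighB_test ha Cv); apply: zlb; exists v.
have [v Cv v0] := exists_test ha.
(* Comparable complex numbers have equal imaginary parts, so a single test function forces any lower
   bound z to be real. *)
have z0 : complex.Im z = 0 by move: (zle v Cv v0); rewrite lecE/= => /andP[/eqP <- _].
rewrite lecE/= z0 eqxx/=; apply: le_lambda ha _ => w Cw w0.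
by have := zle w Cw w0; rewrite lecE/= => /andP[_].
Qed.
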